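(* Let $q\ge1$ be an integer, $1\le p\le\infty$, $s>q/p$, $f\in W^p_s$, and let $Y=(Y_n)_{n\ge1}$ be an interpolation matrix with rows $Y_n=\{\mathbf y_{1,n},\dots,\mathbf y_{M_n,n}\}\subset[-\pi,\pi]^q$. For each $n$ let $N^*\sim\eta_n^{-1}$ and $\mathbb P_n^*\in\mathbb H^q_{N^*}$ be the degree and the minimal interpolant described in the context; in particular $\mathbb P_n^*(\mathbf y_{j,n})=f(\mathbf y_{j,n})$ for $j=1,\dots,M_n$ and $\|\mathbb P_n^*\|_{W^p_s}\le c\|f\|_{W^p_s}$. (a) If $\Lambda$ is a subsequence of the positive integers, $\mathbf x_0\in[-\pi,\pi]^q$, and $$\lim_{n\to\infty,\ n\in\Lambda}\mathrm{dist}(Y_n,\mathbf x_0)=0,$$ then $$\lim_{n\to\infty,\ n\in\Lambda}\mathbb P_n^*(\mathbf x_0)=f(\mathbf x_0).$$ (b) There exists a constant $\gamma=\gamma(p,q,s)>0$ (independent of $n$) with the following property. If $\mathbf x_0\in[-\pi,\pi]^q$, $\delta>0$, $K=[\mathbf x_0-\delta,\mathbf x_0+\delta]^q:=\prod_{k=1}^q[x_{0,k}-\delta,x_{0,k}+\delta]$, and $\delta_n(K)\le\gamma\delta$, then $$\|f-\mathbb P_n^*\|_{\infty,K}\le c\,\delta^{s-q/p}\|f\|_{W^p_s},$$ where $c$ depends only on $p,q,s$.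
   Context: Functions $2\pi$-periodic in each of $q$ variables are regarded as functions on $[-\pi,\pi]^q$, identified with the $q$-dimensional torus. $\|\cdot\|$ is the Euclidean norm on $\mathbb R^q$; for two points $\mathbf x,\mathbf y$ of the torus, $\|\mathbf x-\mathbf y\|$ is understood modulo $2\pi$, i.e. as $\min_{\mathbf k\in\mathbb Z^q}\|\mathbf x-\mathbf y+2\pi\mathbf k\|$. $\|f\|_{p,K}$ is the $L^p$ norm on $K$ (Lebesgue measure; essential supremum if $p=\infty$), and $\|f\|_p$, $L^p$ refer to $K=[-\pi,\pi]^q$. For real $t\ge 0$, $\mathbb H^q_t$ is the space of trigonometric polynomials $\sum_{\mathbf k\in\mathbb Z^q,\ \|\mathbf k\|\le t}a_{\mathbf k}e^{i\mathbf k\cdot\mathbf x}$, $a_{\mathbf k}\in\mathbb C$. Fourier coefficients: $\hat f(\mathbf k)=(2\pi)^{-q}\int_{[-\pi,\pi]^q}f(\mathbf x)e^{-i\mathbf k\cdot\mathbf x}d\mathbf x$. $W^p_s$ consists of all $f\in L^p$ for which there is $f^{(s)}\in L^p$ with $\widehat{f^{(s)}}(\mathbf k)=(\|\mathbf k\|^2+1)^{s/2}\hat f(\mathbf k)$ for all $\mathbf k\in\mathbb Z^q$; $\|f\|_{W^p_s}:=\|f^{(s)}\|_p$. For $s>q/p$ every $f\in W^p_s$ is a.e. equal to a continuous function, and $f$ denotes this representative. For a set $\mathcal C\subseteq[-\pi,\pi]^q$: $\mathrm{dist}(\mathcal C,\mathbf x)=\inf_{\mathbf y\in\mathcal C}\|\mathbf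 x-\mathbf y\|$; mesh norm $\delta(\mathcal C,K)=\sup_{\mathbf x\in K}\mathrm{dist}(\mathcal C,\mathbf x)$; separation radius $\eta_{\mathcal C}=\frac12\inf_{\mathbf x\neq\mathbf y\in\mathcal C}\|\mathbf x-\mathbf y\|$. Write $\delta_n(K)=\delta(Y_n,K)$, $\eta_n=\eta_{Y_n}$; each $Y_n$ is a finite set with at least two distinct points of the torus. Definition of $N^*$ and $\mathbb P_n^*$. It is known (and may be assumed) that there are constants depending only on $p,q,s$ such that for each $n$ there is an integer $N^*$ with $N^*\sim\eta_n^{-1}$ and a mapping $\mathbf P:W^p_s\to\mathbb H^q_{N^*}$ such that, for every $g\in W^p_s$, $\mathbf P(g)$ agrees with $g$ on $Y_n$ and $\|g-\mathbf P(g)\|_{W^p_s}\le c\inf_{T\in\mathbb H^q_{N^*}}\|g-T\|_{W^p_s}$; fix such an $N^*$. Then $\mathbb P_n^*$ is a solution of the problem: minimize $\big\{(N^* )^{-q}\sum_{0\le k_1,\dots,k_q\le 3N^*-1}|P^{(s)}(2\pi\mathbf k/(3N^* ))|^p\big\}^{1/p}$ (a maximum if $p=\infty$) over all $P\in\mathbb H^q_{N^*}$ with $P(\mathbf y_{j,n})=f(\mathbf y_{j,n})$, $j=1,\dots,M_n$; such a solution exists and is chosen so that $\|\mathbb P_n^*\|_{W^p_s}\le c\|f\|_{W^p_s}$ with $c$ depending only on $p,q,s$. $A\sim B$ means $c_1A\le B\le c_2A$ with positive constants depending only on $p,q,s$. *)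

(* Defs.v *)
From HB Require Import structures.
From mathcomp Require Import all_boot all_order all_algebra.
From mathcomp Require Import all_classical all_reals all_analysis.
From mathcomp Require Import complex.

Set Implicit Arguments.
Unset Strict Implicit.
Unset Printing Implicit Defensive.

Import Order.TTheory GRing.Theory Num.Theory.
Import numFieldNormedType.Exports.

Local Open Scope classical_set_scope.
Local Open Scope ring_scope.

(* [lebesgueq q] is q-dimensional Lebesgue measure on Borel sets, built as an
   iterated product. R^q is [q.-tuple R] here, because that is the type which
   carries the product sigma-algebra in the library. *)
Section lebesgueq.
Context {R : realType}.
Local Notation RT := (measurableTypeR R).

Definition tcons q (u : RT * q.-tuple RT) : q.+1.-tuple RT :=
  [the q.+1.-tuple RT of u.1 :: u.2].

Lemma measurable_tcons q : measurable_fun setT (@tcons q).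
Proof. exact: measurable_cons. Qed.

Definition tuncons q (t : q.+1.-tuple RT) : RT * q.-tuple RT :=
  (thead t, [tuple of behead t]).

Lemma measurable_tuncons q : measurable_fun setT (@tuncons q).
Proof.
apply: (@measurable_fun_pair _ _ _ _ _ _ (fun t : q.+1.-tuple RT => thead t)).
  exact: measurable_tnth.
exact: measurable_behead.
Qed.

Section step.
Variables (q : nat) (m : {sigma_finite_measure set (q.-tuple RT) -> \bar R}).

Definition lebesgue_step : set (q.+1.-tuple RT) -> \bar R :=
  pushforward (@lebesgue_measure R \x m)%E (@tcons q).

Let step0 : lebesgue_step set0 = 0%E.
Proof. by rewrite /lebesgue_step /pushforward preimage_set0 measure0. Qed.

Let step_ge0 A : (0 <= lebesgue_step A)%E.
Proof. by rewrite /lebesgue_step /pushforward; exact: measure_ge0. Qed.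

Let step_sigma_additive : semi_sigma_additive lebesgue_step.
Proof.
move=> F mF tF mUF; rewrite /lebesgue_step /pushforward preimage_bigcup.
have mt A : measurable A -> measurable (@tcons q @^-1` A).
  by move=> mA; rewrite -[X in measurable X]setTI; exact: measurable_tcons.
apply: measure_semi_sigma_additive.
- by move=> n; exact: mt.
- apply/trivIsetP => /= i j _ _ ij; rewrite -preimage_setI.
  by move/trivIsetP : tF => /(_ _ _ _ _ ij) ->//; rewrite preimage_set0.
- by rewrite -preimage_bigcup; exact: mt.
Qed.

HB.instance Definition _ := isMeasure.Build _ _ _ lebesgue_step
  step0 step_ge0 step_sigma_additive.

Lemma lebesgue_step_sigma_finite : sigma_finite setT lebesgue_step.
Proof.
have /sigma_finiteP[F [TF ndF Foo]] := sigma_finiteT (@lebesgue_measure R).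
have /sigma_finiteP[G [TG ndG Goo]] := sigma_finiteT m.
exists (fun n => @tuncons q @^-1` (F n `*` G n)).
  rewrite -preimage_bigcup (_ : \bigcup_n _ = setT) ?preimage_setT//.
  rewrite -setXTT TF TG predeqE => -[x y]; split.
    by move=> [n _ []/= ? ?]; split; exists n.
  move=> [/= [n _ Fnx] [k _ Gky]]; exists (maxn n k) => //; split.
  - by move: x Fnx; exact/subsetPset/ndF/leq_maxl.
  - by move: y Gky; exact/subsetPset/ndG/leq_maxr.
move=> n; have [mF Fn] := Foo n; have [mG Gn] := Goo n; split.
  rewrite -[X in measurable X]setTI; apply: measurable_tuncons => //.
  exact: measurableX.
rewrite /lebesgue_step /pushforward -comp_preimage.
rewrite (_ : @tuncons q \o @tcons q = id); last first.
  by apply/funext => -[x t] /=; congr pair; apply/val_inj.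
by rewrite preimage_id product_measure1E// lte_mul_pinfty// ge0_fin_numE.
Qed.

HB.instance Definition _ := Measure_isSigmaFinite.Build _ _ _ lebesgue_step
  lebesgue_step_sigma_finite.

Definition lebesgueS : {sigma_finite_measure set (q.+1.-tuple RT) -> \bar R} :=
  lebesgue_step.
End step.

Fixpoint lebesgueq (q : nat) :
    {sigma_finite_measure set (q.-tuple RT) -> \bar R} :=
  if q is q'.+1 then lebesgueS (lebesgueq q')
  else (dirac [tuple] : {sigma_finite_measure set (0.-tuple RT) -> \bar R}).

End lebesgueq.

Section torus.
Context {R : realType} {q : nat}.
Local Notation RT := (measurableTypeR R).
Local Notation C := (complex R).
Local Notation point := 'rV[R]_q.
Local Notation freq := 'rV[int]_q.
Local Notation normc := ComplexField.Normc.normc.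
Implicit Types (x y : point) (k : freq) (p : \bar R) (s t r : R).
Implicit Types (f g P T : point -> C) (K Y : set point).

Definition torow (u : q.-tuple RT) : point := \row_i tnth u i.

Definition intvec k : point := map_mx intr k.

(* the library norm on row vectors is the max norm *)
Definition enorm x : R := Num.sqrt (\sum_i x 0 i ^+ 2).

Definition box x r : set point :=
  [set y | forall i, y 0 i \in `[x 0 i - r, x 0 i + r]].

Definition cell : set point := box 0 pi.

Definition torus_eq x y := exists k, x - y = (2 * pi) *: intvec k.

(* the infimum over Z^q is attained *)
Definition tdist x y : R :=
  inf (range (fun k => enorm (x - y + (2 * pi) *: intvec k))).

Definition dist_set Y x : R := inf [set tdist x y | y in Y].

Definition mesh_norm Y K : R := sup [set dist_set Y x | x in K].

Definition sep_radius Y : R :=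
  2^-1 * inf [set d | exists x y, [/\ Y x, Y y, ~ torus_eq x y & d = tdist x y]].

Definition periodic f := forall x k, f (x + (2 * pi) *: intvec k) = f x.

Definition LpnormK K p f : \bar R :=
  Lnorm (lebesgueq q) p (((fun x => (normc (f x))%:E) \_ K) \o torow).

Definition Lpnorm p f : \bar R := LpnormK cell p f.

(* functions on the torus are periodic functions on R^q *)
Definition Lp p : set (point -> C) :=
  [set f | [/\ periodic f,
    measurable_fun setT (fun u => complex.Re (f (torow u))),
    measurable_fun setT (fun u => complex.Im (f (torow u))) &
    (Lpnorm p f < +oo)%E]].

Definition expi k x : C :=
  let theta := \sum_i (k 0 i)%:~R * x 0 i in Complex (cos theta) (sin theta).

Definition integral_cell f : C :=
  Complex (\int[lebesgueq q]_(u in torow @^-1` cell) complex.Re (f (torow u)))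
          (\int[lebesgueq q]_(u in torow @^-1` cell) complex.Im (f (torow u))).

Definition fourier f k : C :=
  Complex ((2 * pi) ^- q) 0 * integral_cell (fun x => f x * expi (- k) x).

Definition weight s k : C := Complex ((enorm (intvec k) ^+ 2 + 1) `^ (s / 2)) 0.

Definition freqs t : set freq := [set k | enorm (intvec k) <= t].

(* hence the finitely supported sum below is the full sum over [freqs t] *)
Lemma finite_freqs t : finite_set (freqs t).
Proof.
pose m := Num.bound t.
apply: (@sub_finite_set _ _ [set \row_i ((u i)%:Z - m%:Z) |
    u in [set: {ffun 'I_q -> 'I_(m.*2).+1}]]); last exact/finite_image/finite_finset.
move=> k /= hk.
have hb i : (`|k 0 i| <= m)%R.
  have h : `|(k 0 i)%:~R : R| <= t.
    apply: le_trans hk; rewrite -sqrtr_sqr ler_sqrt ?sumr_ge0// => [|j _];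
      rewrite ?sqr_ge0//.
    rewrite (bigD1 i)//= mxE lerDl sumr_ge0 // => j _; exact: sqr_ge0.
  have t0 : 0 <= t by apply: le_trans h.
  have := le_lt_trans h (archi_boundP t0).
  by rewrite -intr_norm -[X in _ < X]/((m%:Z)%:~R) ltr_int => /ltW.
exists [ffun i : 'I_q => inord (absz (k 0 i + m%:Z))] => //.
apply/rowP => i; rewrite !mxE ffunE.
have := hb i; rewrite ler_norml => /andP[h1 h2].
have h3 : 0 <= k 0 i + m%:Z by rewrite -lerBlDr sub0r.
rewrite inordK ?gez0_abs ?addrK//.
by rewrite ltnS -lez_nat gez0_abs// -addnn PoszD lerD2r.
Qed.

Definition trigpoly t (a : freq -> C) : point -> C :=
  fun x => \sum_(k \in freqs t) a k * expi k x.

Definition trig_space t : set (point -> C) := range (trigpoly t).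

Definition is_sderiv p s f g :=
  Lp p g /\ forall k, fourier g k = weight s k * fourier f k.

Definition sobolev p s : set (point -> C) :=
  [set f | Lp p f /\ exists g, is_sderiv p s f g].

(* the space W^p_s for s > q/p, where each class is identified with its
   continuous representative *)
Definition csobolev p s : set (point -> C) :=
  [set f | sobolev p s f /\ continuous (f : point -> C^o)].

(* f^(s) is determined only almost everywhere; any choice has the same norm.
   Outside of W^p_s the value is junk. *)
Definition sderiv p s f : point -> C := xget (fun=> 0) (is_sderiv p s f).

Definition Wnorm p s f : \bar R := Lpnorm p (sderiv p s f).

(* the representative of P^(s) in H_t, for P in H_t: the one whose point
   values enter the discrete norm *)
Definition trig_sderiv t s P : point -> C :=
  trigpoly t (fun k => weight s k * fourier P k).

Definition node (N : nat) (k : {ffun 'I_q -> 'I_(3 * N)}) : point :=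
  \row_i (2 * pi * (k i)%:R / (3 * N)%:R).

Definition discrete_norm p (N : nat) g : R :=
  if p is r%:E%E then
    (N%:R ^- q * \sum_(k : {ffun 'I_q -> 'I_(3 * N)}) normc (g (node k)) `^ r)
      `^ r^-1
  else \big[Num.max/0]_(k : {ffun 'I_q -> 'I_(3 * N)}) normc (g (node k)).

Definition interpolates Y f P := forall y, Y y -> P y = f y.

(* N is an admissible N^* for the row Y, with equivalence constants c1, c2 and
   near-best approximation constant c3 *)
Definition admissible_degree (c1 c2 c3 : R) p s Y (N : nat) :=
  [/\ c1 * N%:R <= (sep_radius Y)^-1, (sep_radius Y)^-1 <= c2 * N%:R &
   exists Pi : (point -> C) -> (point -> C), forall g, csobolev p s g ->
    [/\ trig_space N%:R (Pi g), interpolates Y g (Pi g) &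
      (Wnorm p s (g \- Pi g)%R <=
       c3%:E * ereal_inf [set Wnorm p s (g \- T)%R | T in trig_space N%:R])%E]].

Definition minimal_interpolant p s Y (N : nat) f P :=
  [/\ trig_space N%:R P, interpolates Y f P &
   forall Q, trig_space N%:R Q -> interpolates Y f Q ->
    discrete_norm p N (trig_sderiv N%:R s P) <=
    discrete_norm p N (trig_sderiv N%:R s Q)].

(* q / p, equal to 0 for p = +oo *)
Definition qdivp p : R := q%:R * fine (p^-1)%E.

End torus.
Arguments cell {R q}.
Arguments qdivp {R} q p.

(* Main.v *)
Require Import Defs.
From mathcomp Require Import all_boot all_order all_algebra.
From mathcomp Require Import all_classical all_reals all_analysis.
From mathcomp Require Import complex.
From mathcomp Require Import measurable_realfun ess_sup_inf.
From mathcomp Require Import ring lra zify.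
Set Implicit Arguments.
Unset Strict Implicit.
Unset Printing Implicit Defensive.
Import Order.TTheory GRing.Theory Num.Theory.
Import numFieldNormedType.Exports.
Local Open Scope classical_set_scope.
Local Open Scope ring_scope.

(* Let [F] be the real or imaginary part of some [f] in W^p_s. The Gamma integral
   (1+|k|^2)^(-s/2) = Ga^-1 \int_R exp(s v/2) exp(-(1+|k|^2) exp v) dv writes [F]
   as a superposition of heat flows of f^(s) at the times t = exp v. At time t,
   with N ~ 1 + t^(-1/2), an m-th partial derivative of the flow is at most
   C N^(m+q/p) |f^(s)|_p. Hence Lagrange interpolation of the flow at m nodes of
   spacing de/m on a line parallel to a coordinate axis has an error of at most
   C N^(q/p) min(1, (de N)^m) |f^(s)|_p, and integration over v bounds the
   interpolation error of [F] by C de^(2 ka) |f|_W as soon as 2 ka < m and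
   2 ka <= s - q/p. This holds for f and for P_n^*, hence for D = f - P_n^*, which
   vanishes on Y_n.
   (a) For m = 1, D changes little when one moves to x0 from a nearby zero of D,
   one coordinate at a time.
   (b) For m > s - q/p every point of K has a zero of D at distance at most
   ga delta. The Lagrange polynomials are Lipschitz, so that for small ga the same
   path gives sup_K |D| <= C delta^(s-q/p) |f|_W + 1/2 sup_K |D|. *)

(** The exponent s - q/p is reached without loss because both factors of the bound are geometric
    around t = de^2: below that time the gain is a positive power of t, above it the factor (de N)^m
    wins since m > 2 ka. In the variable v = ln t this is exponential decay in |v - 2 ln de|, whose
    integral does not depend on de. The obstacle is that the Fourier series of a continuous function
    need not converge to it. Hence every Fourier sum here is finite and carries Fejer factors, all
    bounds are uniform in the truncation n, and n tends to infinity only at the end, where the Fejer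
    means of [F] converge pointwise. A sharp cutoff would not do: for t below n^(-2) the heat factor
    gives no decay, and the kernel would not be integrable uniformly in n. Interpolation is
    one-dimensional, so only pure partial derivatives of a product kernel occur. The dimension
    enters through q/p and through the number of steps of a coordinate path. Functions are split
    into real and imaginary parts, whose Fourier data are the real numbers [cosint]. *)

Section derivation.
Variable R : realType.
Implicit Types (f g : R -> R) (x a b : R).

(** The derivation rules are restated for explicit function bodies, so that the derivative of a
    composite formula is assembled by application and adjusted once with [is_derive_eq]. *)
Lemma der_cst x a : is_derive x 1 (fun _ : R => a) 0.
Proof. exact: is_derive_cst. Qed.
Lemma der_id x : is_derive x 1 (fun z : R => z) 1.
Proof. exact: is_derive_id. Qed.
Lemma der_add f g x a b : is_derive x 1 f a -> is_derive x 1 g b ->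
  is_derive x 1 (fun z => f z + g z) (a + b).
Proof. by move=> ? ?; apply: is_deriveD. Qed.
Lemma der_mul f g x a b : is_derive x 1 f a -> is_derive x 1 g b ->
  is_derive x 1 (fun z => f z * g z) (f x * b + g x * a).
Proof. by move=> hf hg; apply: (is_deriveM hf hg). Qed.
Lemma der_comp f g x a b : is_derive (g x) 1 f a -> is_derive x 1 g b ->
  is_derive x 1 (fun z => f (g z)) (a * b).
Proof. by move=> hf hg; apply: is_derive1_comp. Qed.
Lemma der_scale f x a c : is_derive x 1 f a -> is_derive x 1 (fun z => c * f z) (c * a).
Proof. by move=> hf; apply: is_deriveZ. Qed.
Lemma der_X n x : is_derive x 1 (fun z : R => z ^+ n) (n%:R * x ^+ n.-1).
Proof.
have h := @is_deriveX _ _ (fun z : R => z) n x 1 1 (der_id x).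
have -> : (fun z : R => z ^+ n) = ((fun z : R => z) : R -> R) ^+ n.
  by apply/funext => z; rewrite exprfctE.
by apply: (is_derive_eq h); rewrite /GRing.scale/= mulr1.
Qed.
End derivation.

(** * Derivatives of the truncated heat kernel *)
Section kernel.
Variable R : realType.
Implicit Types (t tau y z v e : R) (n a : nat) (k : int).

(** The inequality x <= exp x at x = (1 + z) / b, raised to the power b, gives the constant b^b e.
    The division by b is why b = 0 is separate. *)
Lemma expR_poly_bound b : exists C : R, 0 < C /\
  forall z, 0 <= z -> (1 + z) ^+ b <= C * expR z.
Proof.
case: b => [|b].
  by exists 1; split=> // z z0; rewrite expr0 mul1r -expR0 ler_expR.
exists (b.+1%:R ^+ b.+1 * expR 1); split.
  by rewrite mulr_gt0 ?expR_gt0// exprn_gt0.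
move=> z z0; rewrite -mulrA -expRD.
have b0 : (0 : R) < b.+1%:R by [].
have -> : 1 + z = b.+1%:R * ((1 + z) / b.+1%:R).
  by rewrite mulrC mulfVK// lt0r_neq0.
rewrite exprMn ler_pM2l ?exprn_gt0//.
rewrite (_ : expR (_ * _) = expR ((1 + z) / b.+1%:R) ^+ b.+1); last first.
  by rewrite -expRM_natl; congr expR; rewrite [RHS]mulrC mulfVK// lt0r_neq0.
apply: lerXn2r; rewrite ?nnegrE ?expR_ge0//.
  by rewrite divr_ge0 // addr_ge0.
apply: le_trans (expR_ge1Dx _); rewrite lerDr//.
Qed.

(** The profile of the heat multiplier: by [kmon_gpow], k^a exp (-t k^2) is N^a times
    [gpow (t N^2) a] sampled at k / N, so that bounds uniform in tau serve all times at once. *)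
Definition gpow tau a y := y ^+ a * expR (- tau * y ^+ 2).

(* With N = kscale n t, the rescaled parameters tau = t N^2 and y = k / N either
   have tau = 1, or N = n and then |y| <= 1; [2] leaves room for shifts by 1 / N. *)
Definition gdom tau y := (0 <= tau <= 1) /\ (tau = 1 \/ `|y| <= 2).

Lemma gpow_bound a : exists C : R, 0 < C /\
  forall tau y, gdom tau y -> `|gpow tau a y| <= C / (1 + y ^+ 2).
Proof.
have [C [C0 hC]] := expR_poly_bound a.+1.
exists (C * expR 4); split; first by rewrite mulr_gt0 ?expR_gt0.
move=> tau y [/andP[t0 t1] hy].
have y2 : 0 <= y ^+ 2 by exact: sqr_ge0.
rewrite ler_pdivlMr; last by rewrite ltr_pwDl.
(* For tau < 1 the Gaussian may be almost flat, but then y^2 <= 4 and exp (4 - y^2) is at least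
   1. *)
have h1 : expR (- tau * y ^+ 2) <= expR 4 * expR (- y ^+ 2).
  rewrite -expRD ler_expR; case: hy => [->|hy]; first by rewrite mulN1r lerDr.
  have : y ^+ 2 <= 4.
    by rewrite -real_normK ?num_real//; have := normr_ge0 y; nra.
  by nra.
rewrite /gpow normrM (ger0_norm (expR_ge0 _)) normrX.
have h2 : `|y| ^+ a <= (1 + y ^+ 2) ^+ a.
  apply: lerXn2r; rewrite ?nnegrE ?addr_ge0// -[y ^+ 2]real_normK ?num_real//.
  by have := normr_ge0 y; nra.
have h3 := hC _ y2.
have e0 := expR_gt0 (- y ^+ 2).
apply: (@le_trans _ _ ((1 + y ^+ 2) ^+ a * (expR 4 * expR (- y ^+ 2)) *
   (1 + y ^+ 2))).
  apply: ler_wpM2r; first by rewrite addr_ge0.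
  by apply: ler_pM; rewrite ?expR_ge0 ?exprn_ge0.
rewrite mulrAC -exprSr.
apply: (@le_trans _ _ (C * expR (y ^+ 2) * (expR 4 * expR (- y ^+ 2)))).
  by apply: ler_wpM2r => //; rewrite mulr_ge0 ?expR_ge0.
rewrite expRN le_eqVlt; apply/orP; left; apply/eqP.
by field; rewrite gt_eqF// expR_gt0.
Qed.

(** For a = 0 the truncated predecessor [a.-1] is harmless, since its coefficient vanishes.
    Derivatives of [gpow] are again combinations of [gpow] and inherit its decay. *)
Definition dgpow tau a y := a%:R * gpow tau a.-1 y - 2 * tau * gpow tau a.+1 y.

Lemma is_derive_gpow tau a y : is_derive y 1 (gpow tau a) (dgpow tau a y).
Proof.
have h2 := @der_comp _ expR (fun z => - tau * z ^+ 2) y _ _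
  (is_derive_expR _) (der_scale (- tau) (der_X 2 y)).
apply: (is_derive_eq (der_mul (der_X a y) h2)).
rewrite /dgpow /gpow /= expr1 (exprS y a); ring.
Qed.

Definition ddgpow tau a y :=
  a%:R * dgpow tau a.-1 y - 2 * tau * dgpow tau a.+1 y.

Lemma is_derive_dgpow tau a y : is_derive y 1 (dgpow tau a) (ddgpow tau a y).
Proof.
have h1 := is_derive_gpow tau a.-1 y; have h2 := is_derive_gpow tau a.+1 y.
have := der_add (der_scale a%:R h1) (der_scale (- (2 * tau)) h2).
rewrite (_ : (fun z => _) = dgpow tau a); last first.
  by apply/funext => z; rewrite mulNr.
by rewrite mulNr.
Qed.

Lemma dgpow_bound a : exists C : R, 0 < C /\
  forall tau y, gdom tau y -> `|dgpow tau a y| <= C / (1 + y ^+ 2).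
Proof.
have [C [C0 hC]] := gpow_bound a.-1; have [D [D0 hD]] := gpow_bound a.+1.
exists (a%:R * C + 2 * D); split.
  by rewrite ltr_wpDl ?mulr_ge0// ?ltW// mulr_gt0.
move=> tau y g; have [/andP[t0 t1] _] := g.
rewrite mulrDl -!mulrA /dgpow; apply: le_trans (ler_normB _ _) _.
have := hC _ _ g; have := hD _ _ g.
move: (gpow tau a.-1 y) (gpow tau a.+1 y) => b c hc hb.
apply: lerD; first by rewrite normrM normr_nat ler_wpM2l.
rewrite !normrM (ger0_norm t0) normr_nat -mulrA ler_wpM2l//.
by have := normr_ge0 c; nra.
Qed.

Lemma ddgpow_bound a : exists C : R, 0 < C /\
  forall tau y, gdom tau y -> `|ddgpow tau a y| <= C / (1 + y ^+ 2).
Proof.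
have [C [C0 hC]] := dgpow_bound a.-1; have [D [D0 hD]] := dgpow_bound a.+1.
exists (a%:R * C + 2 * D); split.
  by rewrite ltr_wpDl ?mulr_ge0// ?ltW// mulr_gt0.
move=> tau y g; have [/andP[t0 t1] _] := g.
rewrite mulrDl -!mulrA /ddgpow; apply: le_trans (ler_normB _ _) _.
have := hC _ _ g; have := hD _ _ g.
move: (dgpow tau a.-1 y) (dgpow tau a.+1 y) => b c hc hb.
apply: lerD; first by rewrite normrM normr_nat ler_wpM2l.
rewrite !normrM (ger0_norm t0) normr_nat -mulrA ler_wpM2l//.
by have := normr_ge0 c; nra.
Qed.

Lemma is_derive_continuous_within (f df : R -> R) x y :
  (forall z, is_derive z 1 f (df z)) -> {within `[x, y], continuous f}.
Proof.
move=> h; apply: continuous_subspaceT => z; apply: differentiable_continuous.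
by apply/derivable1_diffP; have [] := h z.
Qed.

Lemma derive_bound_diff (f df : R -> R) (D x y : R) : x <= y ->
  (forall z, is_derive z 1 f (df z)) ->
  (forall z, x <= z <= y -> `|df z| <= D) -> `|f y - f x| <= D * (y - x).
Proof.
move=> xy hf hD.
have [|c] := MVT_segment xy (fun z _ => hf z).
  exact: is_derive_continuous_within.
rewrite in_itv/= => /hD hc ->; rewrite normrM (ger0_norm (x := y - x)) ?subr_ge0//.
by rewrite ler_wpM2r ?subr_ge0.
Qed.

(** The symmetric second difference is the increment over [0, e] of h r = f (x + r) + f (x - r). By
    the mean value theorem for df, the derivative df (x + r) - df (x - r) of h is at most 2 D e; the
    same theorem for h concludes. *)
Lemma derive_bound_diff2 (f df ddf : R -> R) (D x e : R) : 0 <= e ->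
  (forall z, is_derive z 1 f (df z)) ->
  (forall z, is_derive z 1 df (ddf z)) ->
  (forall z, x - e <= z <= x + e -> `|ddf z| <= D) ->
  `|f (x + e) + f (x - e) - 2 * f x| <= 2 * D * e ^+ 2.
Proof.
move=> e0 hf hdf hD.
have D0 : 0 <= D by apply: le_trans (hD x _); rewrite ?normr_ge0//; lra.
pose h r := f (x + r) + f (x - r).
have hh (r : R) : is_derive r 1 h
    (df (x + r) * (0 + 1) + df (x + -1 * r) * (0 + -1 * 1)).
  have h3 := @der_comp _ f (fun z => x + z) r _ _ (hf (x + r))
    (der_add (der_cst r x) (der_id r)).
  have h4 := @der_comp _ f (fun z => x + -1 * z) r _ _ (hf (x + -1 * r))
    (der_add (der_cst r x) (der_scale (-1) (der_id r))).
  have -> : h = fun r => f (x + r) + f (x + -1 * r).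
    by apply/funext => r'; rewrite mulN1r.
  by apply: der_add => //; apply: h3.
have hr r : 0 <= r <= e -> `|df (x + r) - df (x - r)| <= 2 * D * e.
  move=> /andP[r0 re].
  have xr : x - r <= x + r by lra.
  have H z : x - r <= z <= x + r -> `|ddf z| <= D.
    by move=> /andP[z1 z2]; apply: hD; apply/andP; split; lra.
  by apply: le_trans (derive_bound_diff xr hdf H) _; nra.
have hh' (r : R) : is_derive r 1 h (df (x + r) - df (x - r)).
  by apply: (is_derive_eq (hh r)); rewrite mulN1r; ring.
have := derive_bound_diff e0 hh' hr.
rewrite /h addr0 !subr0 => H; apply: le_trans (le_trans _ H) _.
  by rewrite [X in _ <= `|_ - X|](_ : _ = 2 * f x) //; ring.
by rewrite expr2 mulrA.
Qed.

(** With d = z - y, the number 2 z^2 + 2 d^2 - y^2 is the square of z + d, whence y^2 <= 2 z^2 + 2.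
    A bound at a shifted point can thus be stated at the center. *)
Lemma weight_shift y z : `|z - y| <= 1 -> (1 + z ^+ 2)^-1 <= 3 / (1 + y ^+ 2).
Proof.
move=> h; have hz := sqr_ge0 z; have hy := sqr_ge0 y.
rewrite -div1r ler_pdivrMr; last lra.
rewrite mulrAC ler_pdivlMr; last lra.
have w1 : (z - y) ^+ 2 <= 1.
  by rewrite -real_normK ?num_real// expr_le1.
have := sqr_ge0 (z + (z - y)); rewrite mul1r.
by move: w1; rewrite !expr2; nra.
Qed.

(** The Fejer factors. For n > 0 they make the kernel at time 0 nonnegative and vanish for |k| >= n,
    which removes the boundary terms of a summation by parts. *)
Definition tent n k : R := Num.max 0 (1 - `|k%:~R| / n%:R).

Definition kcoef n t a k : R :=
  tent n k * (k%:~R ^+ a * expR (- t * k%:~R ^+ 2)).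

(* The ordinal [i] of 'I_(2 n + 1) stands for the frequency i - n. *)
Definition kidx n (i : nat) : int := i%:Z - n%:Z.

(* The a-th derivative in [v] of the heat kernel at time [t] with Fejer summation
   factors: each derivative shifts the phase of the cosine by pi / 2. *)
Definition kern n t a v : R := \sum_(i < n.*2.+1)
  kcoef n t a (kidx n i) * cos ((kidx n i)%:~R * v + a%:R * (pi / 2)).

(** The effective bandwidth of the kernel: the heat factor cuts frequencies off at t^(-1/2), the
    Fejer factors at n, and the maximum with 1 accounts for the finite width of the torus. *)
Definition kscale n t : R := Num.max 1 (Num.min n%:R (Num.sqrt t)^-1).

Lemma sum_weight_half (N : R) n : 1 <= N ->
  \sum_(i < n.+1) (1 + (i%:R / N) ^+ 2)^-1 <= 3 * N.
Proof.
move=> N1; have N0 : 0 < N by lra.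
(* The new right-hand side telescopes: with u = n / N and e = 1 / N its increment is 2 / ((1 + u) (1
   + u + e)), which is at least the new term because (1 + w)^2 <= 2 (1 + w^2) for w = u + e. *)
suff : \sum_(i < n.+1) (1 + (i%:R / N) ^+ 2)^-1 <=
    1 + 2 * N - 2 * N / (1 + n%:R / N).
  have : 0 <= 2 * N / (1 + n%:R / N).
    by rewrite divr_ge0 ?addr_ge0 ?divr_ge0// ?mulr_ge0// ltW.
  lra.
elim: n => [|n IH].
  rewrite big_ord1 !mul0r expr0n/= !addr0 invr1 mulr1; lra.
rewrite big_ord_recr/=; apply: le_trans (lerD IH (lexx _)) _.
rewrite -[n.+1%:R]natr1 (mulrDl n%:R) mul1r; have : 0 <= n%:R / N :> R by rewrite divr_ge0// ltW.
move: (n%:R / N) => u u0; rewrite -addrA lerD2l.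
have e0 : 0 < N^-1 by rewrite invr_gt0.
have -> : 2 * N = 2 / (N^-1) by rewrite invrK.
move: (N^-1) e0 => e e0; rewrite -subr_ge0.
have -> : - (2 * e^-1 / (1 + (u + e))) -
  (- (2 * e^-1 / (1 + u)) + (1 + (u + e) ^+ 2)^-1) =
  (2 * (1 + (u + e) ^+ 2) - (1 + u) * (1 + (u + e))) /
  ((1 + u) * (1 + (u + e)) * (1 + (u + e) ^+ 2)).
  have h : 0 < 1 + (u + e) ^+ 2 by rewrite ltr_pwDl// sqr_ge0.
  field; rewrite ?invr_eq0; repeat (apply/andP; split) => //; apply: lt0r_neq0 => //; lra.
apply: divr_ge0; last by rewrite !mulr_ge0// ?addr_ge0 ?sqr_ge0//; lra.
have := sqr_ge0 (u + e - 1); nra.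
Qed.

End kernel.

(** * Summation by parts with Fejer factors *)

Section kernel_summation.
Variable R : realType.
Implicit Types (t tau y z v e : R) (n a : nat) (k : int).

Lemma sum_weight (N : R) n : 1 <= N ->
  \sum_(i < n.*2.+1) (1 + ((kidx n i)%:~R / N) ^+ 2)^-1 <= 6 * N.
Proof.
move=> N1; have N0 : 0 < N by lra.
have h := @sum_weight_half _ N n N1.
rewrite -addnn -addnS big_split_ord/=.
have -> : 6 * N = 3 * N + 3 * N by ring.
apply: lerD; last first.
  apply: le_trans h; rewrite le_eqVlt; apply/orP; left; apply/eqP.
  by apply: eq_bigr => i _; rewrite /kidx PoszD addrAC subrr add0r.
apply: le_trans h; rewrite big_ord_recl/= (reindex_inj rev_ord_inj)/=.
rewrite ler_wpDl ?invr_ge0 ?addr_ge0 ?sqr_ge0//.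
apply: ler_sum => i _; rewrite le_eqVlt; apply/orP; left; apply/eqP.
congr ((_ + _)^-1); rewrite -[RHS]sqrrN -mulNr; congr ((_ / _) ^+ 2).
rewrite /kidx /bump/= add1n -subzn// [_ - _ - _]addrAC subrr add0r.
by rewrite mulrNz.
Qed.

Lemma sum_kidx_shift n (g : int -> R) :
  \sum_(i < n.*2.+1) g (kidx n i + 1) =
  \sum_(i < n.*2.+1) g (kidx n i) + g (n%:Z + 1) - g (- n%:Z).
Proof.
rewrite big_ord_recr [in RHS]big_ord_recl/=.
have -> : kidx n n.*2 = n%:Z by rewrite /kidx -addnn PoszD addrK.
have -> : kidx n 0%N = - n%:Z by rewrite /kidx add0r.
have -> : \sum_(i < n.*2) g (kidx n (bump 0 i)) =
    \sum_(i < n.*2) g (kidx n i + 1).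
  by apply: eq_bigr => i _; rewrite /kidx /bump/=; congr g; lia.
by ring.
Qed.

(** Since 2 cos v cos (k v + al) is the sum of the two neighboring cosines, the factor 2 - 2 cos v
    acts as minus a second difference in k, which is shifted onto the coefficients. The boundary
    terms vanish with [m]. *)
Lemma kern_sum_by_parts n (m : int -> R) v (al : R) :
  (forall k, (n%:Z <= `|k|)%R -> m k = 0) ->
  (2 - 2 * cos v) *
    \sum_(i < n.*2.+1) m (kidx n i) * cos ((kidx n i)%:~R * v + al) =
  - \sum_(i < n.*2.+1) (m (kidx n i + 1) + m (kidx n i - 1) - 2 * m (kidx n i))
     * cos ((kidx n i)%:~R * v + al).
Proof.
move=> m0; pose c k := cos (k%:~R * v + al).
have cE k : 2 * cos v * c k = c (k + 1) + c (k - 1).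
  rewrite /c !intrD mulrNz.
  have -> : (k%:~R + 1%:~R) * v + al = (k%:~R * v + al) + v by ring.
  have -> : (k%:~R - 1%:~R) * v + al = (k%:~R * v + al) - v by ring.
  by move: (_ + al) => u; rewrite cosD cosB; ring.
have s1 : \sum_(i < n.*2.+1) m (kidx n i) * c (kidx n i + 1) =
    \sum_(i < n.*2.+1) m (kidx n i - 1) * c (kidx n i).
  have := sum_kidx_shift n (fun k => m (k - 1) * c k); rewrite addrK.
  rewrite (m0 n) ?mul0r ?addr0; last by lia.
  rewrite m0 ?mul0r ?subr0 => [<-|]; last by lia.
  by apply: eq_bigr => i _; rewrite addrK.
have s2 : \sum_(i < n.*2.+1) m (kidx n i) * c (kidx n i - 1) =
    \sum_(i < n.*2.+1) m (kidx n i + 1) * c (kidx n i).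
  have := sum_kidx_shift n (fun k => m k * c (k - 1)); rewrite addrK.
  rewrite (m0 (n%:Z + 1)) ?mul0r ?addr0; last by lia.
  rewrite m0 ?mul0r ?subr0 => [<-|]; last by lia.
  by apply: eq_bigr => i _; rewrite addrK.
rewrite mulrBl mulr_sumr mulr_sumr.
rewrite [X in _ - X](_ : _ = \sum_(i < n.*2.+1) m (kidx n i) * c (kidx n i + 1) +
   \sum_(i < n.*2.+1) m (kidx n i) * c (kidx n i - 1)); last first.
  rewrite -big_split/=; apply: eq_bigr => i _.
  by rewrite mulrCA cE; ring.
rewrite s1 s2 -sumrN -big_split/= -sumrB; apply: eq_bigr => i _.
rewrite -/(c _); ring.
Qed.

Lemma tent_ge0 n k : 0 <= tent R n k.
Proof. by rewrite /tent le_max lexx. Qed.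

Lemma tent_le1 n k : tent R n k <= 1.
Proof. by rewrite /tent ge_max ler01 gerBl divr_ge0. Qed.

Lemma tentN n k : tent R n (- k) = tent R n k.
Proof. by rewrite /tent rmorphN normrN. Qed.

Lemma tent_in n k : (0 < n)%N -> `|k| <= n%:Z -> tent R n k = 1 - `|k%:~R| / n%:R.
Proof.
move=> n0 kn; apply/max_idPr; rewrite subr_ge0 ler_pdivrMr ?ltr0n// mul1r.
by rewrite -intr_norm -[n%:R]/(n%:Z%:~R) ler_int.
Qed.

Lemma tent_out n k : (0 < n)%N -> n%:Z <= `|k| -> tent R n k = 0.
Proof.
move=> n0 kn; apply/max_idPl; rewrite subr_le0 ler_pdivlMr ?ltr0n// mul1r.
by rewrite -intr_norm -[n%:R]/(n%:Z%:~R) ler_int.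
Qed.

(** A discrete product rule. Away from 0, n and -n the tent is affine with slope 1/n in absolute
    value and at most 1, which gives the first two terms. At the three corners, extra values of [mu]
    divided by n are left over; the last term pays for them. *)
Lemma tent_diff2 n (mu : int -> R) (B : R) k : (0 < n)%N -> `|k| <= n%:Z ->
  (forall j, `|j| <= n%:Z -> `|mu j| <= B) ->
  `|tent R n (k + 1) * mu (k + 1) + tent R n (k - 1) * mu (k - 1)
     - 2 * (tent R n k * mu k)| <=
  `|mu (k + 1) + mu (k - 1) - 2 * mu k| + `|mu (k + 1) - mu (k - 1)| / n%:R
  + ((k == 0) || (k == n%:Z) || (k == - n%:Z))%:R * (2 * B / n%:R).
Proof.
move=> n0 kn hB.
have n0' : (0 : R) < n%:R by rewrite ltr0n.
have nV : (n%:R * n%:R^-1 : R) = 1 by rewrite divff// gt_eqF.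
have e0 : (0 : R) < n%:R^-1 by rewrite invr_gt0.
have B0 : 0 <= B by apply: le_trans (hB 0 _); rewrite ?normr_ge0//; lia.
have [->|k0] := eqVneq k 0.
  rewrite mul1r add0r sub0r tentN !tent_in//; try lia.
  rewrite normr0 mul0r subr0 mul1r normr1.
  rewrite [X in `|X|](_ : _ = (mu 1 + mu (- 1) - 2 * mu 0) -
     (mu 1 + mu (-1)) / n%:R); last by rewrite div1r; ring.
  apply: le_trans (ler_normB _ _) _; rewrite -[leRHS]addrA; apply: lerD => //.
  rewrite normrM (gtr0_norm e0) -[leLHS]add0r; apply: lerD.
    by rewrite mulr_ge0// ltW.
  rewrite ler_wpM2r ?(ltW e0)//; apply: le_trans (ler_normD _ _) _.
  by have -> : 2 * B = B + B by [ring]; apply: lerD; apply: hB; lia.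
have [kN|kN] := eqVneq k n%:Z.
  rewrite mul1r kN !(tent_out n0 (k := n%:Z + 1)) ?(tent_out n0 (k := n%:Z)); try lia.
  rewrite !mul0r mulr0 subr0 add0r normrM tent_in//; last lia.
  have -> : `|(n%:Z - 1)%:~R| = n%:R - 1 :> R.
    by rewrite ger0_norm ?rmorphB//= subr_ge0 (ler_nat _ 1).
  rewrite mulrBl nV div1r opprB addrC subrK (gtr0_norm e0) mulrC.
  apply: ler_wpDl; first by rewrite addr_ge0// mulr_ge0// ltW.
  rewrite ler_wpM2r ?(ltW e0)//.
  by have := hB (n%:Z - 1) ltac:(lia); lra.
have [kN'|kN'] := eqVneq k (- n%:Z).
  rewrite mul1r kN' !(tent_out n0 (k := - n%:Z - 1)) ?(tent_out n0 (k := - n%:Z)); try lia.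
  rewrite !mul0r mulr0 subr0 addr0 normrM.
  have -> : - n%:Z + 1 = - (n%:Z - 1) by lia.
  rewrite tentN tent_in//; last lia.
  have -> : `|(n%:Z - 1)%:~R| = n%:R - 1 :> R.
    by rewrite ger0_norm ?rmorphB//= subr_ge0 (ler_nat _ 1).
  rewrite mulrBl nV div1r opprB addrC subrK (gtr0_norm e0) mulrC.
  apply: ler_wpDl; first by rewrite addr_ge0// mulr_ge0// ltW.
  rewrite ler_wpM2r ?(ltW e0)//.
  by have := hB (- (n%:Z - 1)) ltac:(lia); lra.
rewrite mul0r addr0 !tent_in; try lia.
have tk : `|tent R n k| <= 1 by rewrite ger0_norm ?tent_ge0// tent_le1.
rewrite tent_in// in tk.
have [kp|kn'] := ltP 0 k.
  have -> : `|(k + 1)%:~R| = k%:~R + 1 :> R.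
    by rewrite ger0_norm ?rmorphD//= addr_ge0// ler0z; lia.
  have -> : `|(k - 1)%:~R| = k%:~R - 1 :> R.
    by rewrite ger0_norm ?rmorphB//= subr_ge0 (ler_int _ 1); lia.
  rewrite [X in `|X|](_ : _ = (1 - `|k%:~R| / n%:R) *
    (mu (k + 1) + mu (k - 1) - 2 * mu k) - (mu (k + 1) - mu (k - 1)) / n%:R).
    apply: le_trans (ler_normB _ _) _; rewrite !normrM (gtr0_norm e0) lerD2r.
    by rewrite ler_piMl.
  rewrite (gtr0_norm (x := k%:~R)) ?ltr0z//; ring.
have -> : `|(k + 1)%:~R| = - k%:~R - 1 :> R.
  by rewrite ler0_norm ?rmorphD/= ?opprD// -[1]/(1%:~R) -rmorphD lerz0; lia.
have -> : `|(k - 1)%:~R| = - k%:~R + 1 :> R.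
  rewrite ler0_norm; last by rewrite lerz0; lia.
  by rewrite intrB opprB addrC.
rewrite [X in `|X|](_ : _ = (1 - `|k%:~R| / n%:R) *
  (mu (k + 1) + mu (k - 1) - 2 * mu k) + (mu (k + 1) - mu (k - 1)) / n%:R).
  apply: le_trans (ler_normD _ _) _; rewrite !normrM (gtr0_norm e0) lerD2r.
  by rewrite ler_piMl.
rewrite (ler0_norm (x := k%:~R)) ?lerz0//; ring.
Qed.

End kernel_summation.

(** * Pointwise bounds for the kernel *)

Section kernel_estimate.
Variable R : realType.
Implicit Types (t tau y z v e : R) (n a : nat) (k : int).

Definition kmon t a k : R := k%:~R ^+ a * expR (- t * k%:~R ^+ 2).

Lemma kmon_gpow (N : R) t a k : N != 0 ->
  kmon t a k = N ^+ a * gpow (t * N ^+ 2) a (k%:~R / N).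
Proof.
move=> N0; rewrite /kmon /gpow mulrA -exprMn mulrC [N * _]mulrC mulfVK// mulrC.
by congr (_ * expR _); rewrite exprMn exprVn; field.
Qed.

Lemma sin_half v : 4 * sin (v / 2) ^+ 2 = 2 - 2 * cos v.
Proof.
have -> : cos v = cos (v / 2 + v / 2) by rewrite -splitr.
rewrite cosD; have := cos2Dsin2 (v / 2); rewrite -!expr2.
by move: (cos _ ^+ 2) (sin _ ^+ 2) => c s h; lra.
Qed.

Lemma kscale_ge1 n t : 1 <= kscale n t.
Proof. by rewrite le_max lexx. Qed.

Lemma kscale_large n t : 1 <= t -> kscale n t = 1.
Proof.
move=> t1; apply/max_idPl; rewrite ge_min; apply/orP; right.
rewrite invf_le1; first by rewrite -sqrtr1 ler_wsqrtr.
by rewrite sqrtr_gt0; lra.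
Qed.

Lemma kscale_small n t : (0 < n)%N -> 0 < t -> t < 1 ->
  [/\ kscale n t <= n%:R, t * kscale n t ^+ 2 <= 1 &
      t * kscale n t ^+ 2 = 1 \/ kscale n t = n%:R].
Proof.
move=> n0 t0 t1; have s0 : 0 < Num.sqrt t by rewrite sqrtr_gt0.
have sE : t = Num.sqrt t ^+ 2 by rewrite sqr_sqrtr// ltW.
have n1 : (1 : R) <= n%:R by rewrite ler1n.
have h : 1 <= Num.min n%:R (Num.sqrt t)^-1.
  rewrite le_min n1 invf_ge1//= -sqrtr1 ler_wsqrtr//; lra.
have -> : kscale n t = Num.min n%:R (Num.sqrt t)^-1 by apply/max_idPr.
split; first by rewrite ge_min lexx.
- rewrite {1}sE -exprMn expr_le1//.
  by rewrite mulrC -ler_pdivlMr// div1r ge_min lexx orbT.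
- case: (leP n%:R (Num.sqrt t)^-1) => hn; first by right.
  by left; rewrite {1}sE -exprMn divff ?expr1n// gt_eqF.
Qed.

Lemma kscale_le n t : 0 < t -> kscale n t <= 1 + (Num.sqrt t)^-1.
Proof.
move=> t0; have s0 : 0 < (Num.sqrt t)^-1 by rewrite invr_gt0 sqrtr_gt0.
rewrite ge_max ge_min; apply/andP; split; first lra.
by apply/orP; right; lra.
Qed.

Lemma kmon_bound a : exists C : R, 0 < C /\ forall n t k,
  (0 < n)%N -> 0 < t -> `|k| <= n%:Z ->
  `|kmon t a k| <= C * kscale n t ^+ a / (1 + (k%:~R / kscale n t) ^+ 2).
Proof.
have [C [C0 hC]] := @gpow_bound R a.
exists C; split=> // n t k n0 t0 kn.
(* For t >= 1 the scale is 1 and the Gaussian is dominated by the one at time 1. *)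
have [t1|t1] := leP 1 t.
  rewrite kscale_large// divr1 expr1n mulr1.
  have g1 : gdom 1 (k%:~R : R) by split; [rewrite ler01 lexx|left].
  apply: le_trans (hC _ _ g1); rewrite /kmon /gpow !normrM ler_wpM2l//.
  rewrite !(ger0_norm (expR_ge0 _)) ler_expR !mulNr lerN2.
  by rewrite ler_wpM2r ?sqr_ge0.
have [h1 h2 h3] := kscale_small n0 t0 t1.
have N1 := kscale_ge1 n t; move: (kscale n t) h1 h2 h3 N1 => N h1 h2 h3 N1.
have N0 : 0 < N by lra.
rewrite (@kmon_gpow N) ?gt_eqF// normrM normrX (gtr0_norm N0) [C * _]mulrC -mulrA.
apply: ler_wpM2l; first by rewrite exprn_ge0// ltW.
apply: hC; split.
  by rewrite h2 andbT mulr_ge0 ?sqr_ge0// ltW.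
case: h3 => [|h3]; [by left|right].
rewrite normrM normfV (gtr0_norm N0) ler_pdivrMr// h3.
rewrite -intr_norm; apply: (@le_trans _ _ (n%:Z%:~R)); first by rewrite ler_int.
by have : (1 : R) <= n%:R; [rewrite ler1n|rewrite -[n%:~R]/(n%:R); lra].
Qed.

(** A unit step in k is a step 1 / N in y = k / N, so each order of difference gains a factor 1 / N
    over the size N^a of [kmon]. [weight_shift] brings the intermediate points back to y. *)
Lemma kmon_diff_bound a : exists C : R, 0 < C /\ forall n t k,
  (0 < n)%N -> 0 < t -> t < 1 -> `|k| <= n%:Z ->
  let N := kscale n t in
  `|kmon t a (k + 1) - kmon t a (k - 1)| <=
     C * N ^+ a / N / (1 + (k%:~R / N) ^+ 2) /\
  `|kmon t a (k + 1) + kmon t a (k - 1) - 2 * kmon t a k| <=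
     C * N ^+ a / N ^+ 2 / (1 + (k%:~R / N) ^+ 2).
Proof.
have [C [C0 hC]] := @dgpow_bound R a; have [D [D0 hD]] := @ddgpow_bound R a.
exists (6 * C + 6 * D); split; first lra.
move=> n t k n0 t0 t1 kn /=.
have [h1 h2 h3] := kscale_small n0 t0 t1.
have N1 := kscale_ge1 n t; move: (kscale n t) h1 h2 h3 N1 => N h1 h2 h3 N1.
have N0 : 0 < N by lra.
have NV : N * N^-1 = 1 by rewrite divff// gt_eqF.
have e0 : 0 < N^-1 by rewrite invr_gt0.
have e1 : N^-1 <= 1 by rewrite invf_le1.
have Na : 0 <= N ^+ a by rewrite exprn_ge0// ltW.
rewrite !(@kmon_gpow N) ?gt_eqF// !intrD mulrNz.
have -> : (k%:~R + 1%:~R) / N = k%:~R / N + N^-1 by rewrite mulrDl mul1r.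
have -> : (k%:~R - 1%:~R) / N = k%:~R / N - N^-1 by rewrite mulrBl mul1r.
have hy : t * N ^+ 2 = 1 \/ `|k%:~R / N| <= 1.
  case: h3 => [|h3]; [by left|right].
  rewrite normrM normfV (gtr0_norm N0) ler_pdivrMr// h3 mul1r.
  by rewrite -intr_norm -[n%:R]/(n%:Z%:~R) ler_int.
have tau0 : 0 <= t * N ^+ 2 by rewrite mulr_ge0 ?sqr_ge0 ?ltW.
move: (t * N ^+ 2) (k%:~R / N) h2 hy tau0 => tau y tau1 hy tau0.
have hg z : y - N^-1 <= z <= y + N^-1 -> gdom tau z /\ `|z - y| <= 1.
  move=> /andP[z1 z2]; have zy : `|z - y| <= 1.
    by rewrite ler_norml; apply/andP; split; lra.
  split=> //; split; first by rewrite tau0 tau1.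
  case: hy => hy; [by left|right].
  have -> : z = (z - y) + y by ring.
  by apply: le_trans (ler_normD _ _) _; lra.
have w0 : 0 < 1 + y ^+ 2 by have := sqr_ge0 y; lra.
have hd z : y - N^-1 <= z <= y + N^-1 -> `|dgpow tau a z| <= 3 * C / (1 + y ^+ 2).
  move=> /hg[g zy]; apply: le_trans (hC _ _ g) _.
  by have := weight_shift zy; rewrite [3 * C]mulrC -mulrA ler_pM2l.
have hdd z : y - N^-1 <= z <= y + N^-1 -> `|ddgpow tau a z| <= 3 * D / (1 + y ^+ 2).
  move=> /hg[g zy]; apply: le_trans (hD _ _ g) _.
  by have := weight_shift zy; rewrite [3 * D]mulrC -mulrA ler_pM2l.
have wi : 0 < (1 + y ^+ 2)^-1 by rewrite invr_gt0.
split.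
  rewrite -mulrBr normrM (ger0_norm Na) [6 * C + _]addrC.
  have yy : y - N^-1 <= y + N^-1 by lra.
  have := derive_bound_diff yy (is_derive_gpow tau a) hd.
  have -> : y + N^-1 - (y - N^-1) = 2 * N^-1 by ring.
  move=> H; apply: le_trans (ler_wpM2l Na H) _.
  rewrite -subr_ge0 (_ : _ - _ = 6 * D * N ^+ a / N / (1 + y ^+ 2)); last by ring.
  by rewrite !mulr_ge0// ltW.
rewrite (_ : _ - _ = N ^+ a * (gpow tau a (y + N^-1) + gpow tau a (y - N^-1) -
   2 * gpow tau a y)); last by ring.
rewrite normrM (ger0_norm Na).
have := derive_bound_diff2 (ltW e0) (is_derive_gpow tau a)
  (is_derive_dgpow tau a) hdd.
move=> H; apply: le_trans (ler_wpM2l Na H) _.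
rewrite -exprVn -subr_ge0.
rewrite (_ : _ - _ = 6 * C * N ^+ a * N^-1 ^+ 2 / (1 + y ^+ 2)); last by ring.
by rewrite !mulr_ge0// ?exprn_ge0// ltW.
Qed.

Lemma count_kidx n : \sum_(i < n.*2.+1) ((kidx n i == 0) || (kidx n i == n%:Z) ||
   (kidx n i == - n%:Z))%:R <= 3 :> R.
Proof.
have hin j : (j < n.*2.+1)%N -> \sum_(i < n.*2.+1) (nat_of_ord i == j)%:R = 1 :> R.
  move=> jn; rewrite (bigD1 (Ordinal jn))//= eqxx big1 ?addr0// => i.
  by rewrite -val_eqE/= => /negPf ->.
have n1 : (n < n.*2.+1)%N by lia.
have n2 : (n.*2 < n.*2.+1)%N by lia.
have -> : 3 = \sum_(i < n.*2.+1) (((nat_of_ord i == n)%:R +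
   (nat_of_ord i == n.*2)%:R + (nat_of_ord i == 0%N)%:R) : R).
  by rewrite !big_split/= (hin n n1) (hin n.*2 n2) (hin 0%N isT); ring.
apply: ler_sum => i _; rewrite /kidx.
have -> : (i%:Z - n%:Z == 0) = (nat_of_ord i == n) by lia.
have -> : (i%:Z - n%:Z == n%:Z) = (nat_of_ord i == n.*2) by lia.
have -> : (i%:Z - n%:Z == - n%:Z) = (nat_of_ord i == 0%N) by lia.
move: (nat_of_ord i == n) (nat_of_ord i == n.*2) (nat_of_ord i == 0%N) => b1 b2 b3.
by case: b1; case: b2; case: b3 => /=; rewrite ?mulr0n ?mulr1n; lra.
Qed.

(* Both terms in the denominator are needed: the trivial bound gives the 1, and two
   summations by parts give N^2 sin^2. *)
Lemma kern_bound a : exists C : R, 0 < C /\ forall n t v,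
  (0 < n)%N -> 0 < t -> let N := kscale n t in
  `|kern n t a v| <= C * N ^+ a.+1 / (1 + N ^+ 2 * sin (v / 2) ^+ 2).
Proof.
have [C [C0 hC]] := kmon_bound a; have [D [D0 hD]] := kmon_diff_bound a.
exists (12 * C + 6 * C + 12 * D); split; first lra.
move=> n t v n0 t0 /=; have N1 := kscale_ge1 n t.
set N := kscale n t in N1 *.
have N0 : 0 < N by lra.
have NN : N ^+ a * N = N ^+ a.+1 by rewrite exprSr.
have Na : 0 < N ^+ a by rewrite exprn_gt0.
have kn (i : 'I_n.*2.+1) : `|kidx n i| <= n%:Z.
  by case: i => i /=; rewrite /kidx; lia.
have S0 : `|kern n t a v| <= 6 * C * N ^+ a.+1.
  apply: le_trans (ler_norm_sum _ _ _) _.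
  apply: (@le_trans _ _ (\sum_(i < n.*2.+1) (C * N ^+ a) *
     (1 + ((kidx n i)%:~R / N) ^+ 2)^-1)).
    apply: ler_sum => i _; rewrite !normrM -[leRHS]mulr1.
    apply: ler_pM => //; last by rewrite ler_norml cos_geN1 cos_le1.
    rewrite -[leRHS]mul1r; apply: ler_pM => //.
      by rewrite ger0_norm ?tent_ge0 ?tent_le1.
    by rewrite -normrM; apply: hC.
  rewrite -mulr_sumr; apply: le_trans (ler_wpM2l _ (sum_weight n N1)) _.
    by rewrite mulr_ge0// ltW.
  by rewrite -NN le_eqVlt; apply/orP; left; apply/eqP; ring.
suff S2 : N ^+ 2 * sin (v / 2) ^+ 2 * `|kern n t a v| <=
    (12 * C + 12 * D) * N ^+ a.+1.
  rewrite ler_pdivlMr; last by rewrite ltr_pwDl// mulr_ge0// sqr_ge0.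
  lra.
have k0 : 0 <= `|kern n t a v| by [].
have N1a : 0 <= N ^+ a.+1 by rewrite exprn_ge0// ltW.
(* For t >= 1 one has N = 1, and since sin^2 <= 1 the trivial bound is enough; summation by parts
   serves t < 1. *)
have [t1|t1] := leP 1 t.
  have -> : N = 1 by rewrite /N kscale_large.
  move: S0; rewrite /N kscale_large// expr1n expr1n !mulr1 mul1r => S0.
  have : sin (v / 2) ^+ 2 <= 1.
    by have := cos2Dsin2 (v / 2); have := sqr_ge0 (cos (v / 2)); lra.
  by move=> s1; apply: (@le_trans _ _ `|kern n t a v|); [rewrite ler_piMl|lra].
have [h1 h2 h3] := kscale_small n0 t0 t1.
have e1 : n%:R^-1 <= N^-1.
  by rewrite lef_pV2 ?posrE// ltr0n.
have e0 : 0 < N^-1 by rewrite invr_gt0.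
have NV : N * N^-1 = 1 by rewrite divff// gt_eqF.
have nV0 : 0 < n%:R^-1 :> R by rewrite invr_gt0 ltr0n.
have m0 k : n%:Z <= `|k| -> kcoef n t a k = 0.
  by move=> h; rewrite /kcoef tent_out// mul0r.
have hB j : `|j| <= n%:Z -> `|kmon t a j| <= C * N ^+ a.
  move=> jn; apply: le_trans (hC n t j n0 t0 jn) _; rewrite -/N.
  rewrite ler_pdivrMr; last by rewrite ltr_pwDl// sqr_ge0.
  apply: ler_peMr; first by rewrite mulr_ge0// ltW.
  by rewrite lerDl sqr_ge0.
(* Second differences of the coefficients: the smooth part is of size N^(a-2) times weights of total
   at most 6 N, and the corners give three terms of size N^a / n <= N^a / N. Both amount to N^(a-1),
   which the factor N^2 turns into N^(a+1). *)
have H : 4 * sin (v / 2) ^+ 2 * `|kern n t a v| <=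
   \sum_(i < n.*2.+1) (2 * D * N ^+ a / N ^+ 2 *
      (1 + ((kidx n i)%:~R / N) ^+ 2)^-1) +
   \sum_(i < n.*2.+1) ((kidx n i == 0) || (kidx n i == n%:Z) || (kidx n i == - n%:Z))%:R * (2 * (C * N ^+ a) / N).
  rewrite -[4 * _]ger0_norm; last by rewrite mulr_ge0// sqr_ge0.
  rewrite -normrM sin_half kern_sum_by_parts// normrN.
  apply: le_trans (ler_norm_sum _ _ _) _; rewrite -big_split/=.
  apply: ler_sum => i _; rewrite normrM -[leRHS]mulr1.
  apply: ler_pM => //; last by rewrite ler_norml cos_geN1 cos_le1.
  have := tent_diff2 n0 (kn i) hB; rewrite -!/(kmon _ _ _).
  have [d1 d2] := hD n t _ n0 t0 t1 (kn i); rewrite -/N in d1 d2.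
  move=> /le_trans; apply; apply: lerD; last first.
    rewrite ler_wpM2l// ler_wpM2l// !mulr_ge0// ltW//.
  have -> : 2 * D * N ^+ a / N ^+ 2 / (1 + ((kidx n i)%:~R / N) ^+ 2) =
    D * N ^+ a / N ^+ 2 / (1 + ((kidx n i)%:~R / N) ^+ 2) +
    D * N ^+ a / N / (1 + ((kidx n i)%:~R / N) ^+ 2) / N.
    rewrite expr2 invfM; ring.
  apply: lerD => //; apply: le_trans (ler_wpM2r _ d1) _; first exact: ltW.
  rewrite ler_wpM2l//; apply: divr_ge0; last by rewrite addr_ge0 ?sqr_ge0.
  by rewrite !mulr_ge0// ltW.
have C3 := count_kidx n.
rewrite -mulr_sumr -mulr_suml in H.
have H2 : 4 * sin (v / 2) ^+ 2 * `|kern n t a v| <=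
   2 * D * N ^+ a / N ^+ 2 * (6 * N) + 3 * (2 * (C * N ^+ a) / N).
  apply: le_trans H _; apply: lerD.
    by apply: ler_wpM2l (sum_weight n N1); rewrite !mulr_ge0 ?invr_ge0 ?exprn_ge0// ltW.
  by rewrite ler_wpM2r// !mulr_ge0// ltW.
have : N ^+ 2 * (4 * sin (v / 2) ^+ 2 * `|kern n t a v|) <=
   (12 * D + 6 * C) * N ^+ a.+1.
  apply: le_trans (ler_wpM2l (sqr_ge0 _) H2) _; rewrite -NN.
  by rewrite le_eqVlt; apply/orP; left; apply/eqP; field; rewrite gt_eqF.
have p1 : 0 <= C * N ^+ a.+1 by rewrite mulr_ge0// ltW.
have p2 : 0 <= D * N ^+ a.+1 by rewrite mulr_ge0// ltW.
by lra.
Qed.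

End kernel_estimate.

Ltac nneg := repeat first [ exact: ltW | assumption | apply: sqr_ge0
  | apply: expR_ge0 | apply: powR_ge0 | apply: normr_ge0 | apply: exprn_ge0
  | apply: mulr_ge0 | rewrite invr_ge0 | apply: addr_ge0 | by rewrite ?ler01 ?ler0n].

(** * Bessel potentials as Laplace integrals *)
Section bessel.
Variable R : realType.
Notation mu := (@lebesgue_measure R).
Implicit Types (c h v s b : R).

Lemma ge0_powR_le (x y r : R) : 0 <= r -> 0 <= x -> x <= y -> x `^ r <= y `^ r.
Proof.
by move=> r0 x0 xy; apply: ge0_ler_powR; rewrite ?nnegrE// (le_trans x0).
Qed.

(** Put t = exp v, r = t^(-1/2) and w = v - 2 ln de. Up to powers of 1 + t, which exp (-t) absorbs,
    the left-hand side is at most exp (ka v) min (1, (de r)^m). As de r = exp (-w / 2), this equals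
    de^(2 ka) exp (ka w) min (1, exp (-m w / 2)), which decays at rate ka for w < 0 and at rate m /
    2 - ka for w > 0. *)
Lemma bessel_dominated s b (m : nat) (ka : R) :
  0 <= b -> 2 * ka <= 2 * s - b ->
  let c := Num.min ka (m%:R / 2 - ka) in
  exists C : R, 0 < C /\ forall de v M : R, 0 < de -> 1 <= M ->
    M <= 1 + expR (- (v / 2)) ->
    expR (s * v) * expR (- expR v) * (M `^ b * Num.min 1 ((de * M) ^+ m)) <=
    C * (de `^ (2 * ka) * expR (- c * `|v - 2 * ln de|)).
Proof.
move=> b0 hka c.
(* The surplus of the exponent; exp (d v) is at most (1 + t)^d, hence absorbed as well. *)
pose d := s - b / 2 - ka.
have d0 : 0 <= d by rewrite /d; lra.
pose B1 := Num.bound b; pose B2 := Num.bound d.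
have hB1 : b <= B1%:R by apply: ltW; exact: archi_boundP.
have hB2 : d <= B2%:R by apply: ltW; exact: archi_boundP.
have [C [C0 hC]] := expR_poly_bound R (B2 + (B1 + m)).
exists (2 ^+ (B1 + m) * C); split; first by rewrite mulr_gt0// exprn_gt0.
move=> de v M de0 M1 hM.
set t := expR v; have t0 : 0 < t := expR_gt0 v.
set r := expR (- (v / 2)); have r0 : 0 < r := expR_gt0 _.
have rt : t * r ^+ 2 = 1.
  by rewrite /t /r expr2 -!expRD (_ : _ + _ = 0) ?expR0//; lra.
have M0 : 0 < M by lra.
(* Chosen so that [M <= r * E]: for t <= 1 because 1 + r <= 2 r, for t >= 1 because 1 + r <= 2 and r
   (1 + t) >= 1. *)
pose E := 2 * (1 + t).
have E1 : 1 <= E by rewrite /E; lra.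
have hME : M <= r * E.
  apply: le_trans hM _; rewrite -/r /E.
  have h1 : r <= 1 \/ 1 <= r by have [|/ltW] := leP r 1; [left|right].
  by case: h1 => h1; nra.
have E0 : 0 <= E by lra.
have hMb : M `^ b <= expR (- (b * v / 2)) * E ^+ B1.
  apply: (@le_trans _ _ ((r * E) `^ b)).
    by apply: ge0_powR_le => //; exact: ltW.
  rewrite powRM ?(ltW r0)//; apply: ler_pM; rewrite ?powR_ge0//.
    by rewrite /r -expRM le_eqVlt; apply/orP; left; apply/eqP; congr expR; lra.
  by rewrite -powR_mulrn//; apply: ler_powR.
have hmin : Num.min 1 ((de * M) ^+ m) <= E ^+ m * Num.min 1 ((de * r) ^+ m).
  rewrite minr_pMr ?exprn_ge0// mulr1 le_min !ge_min; apply/andP; split; apply/orP.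
    by left; rewrite exprn_ege1.
  right; rewrite -exprMn; apply: lerXn2r; rewrite ?nnegrE.
  - by rewrite mulr_ge0 ?ltW.
  - by nneg.
  by have := ler_wpM2l (ltW de0) hME; lra.
have min0 (x : R) : 0 <= x -> 0 <= Num.min 1 (x ^+ m).
  by move=> x0; rewrite le_min ler01 exprn_ge0.
have hlog : expR (s * v) * expR (- t) * expR (- (b * v / 2)) * E ^+ (B1 + m) <=
   2 ^+ (B1 + m) * C * expR (ka * v).
  have -> : expR (s * v) * expR (- t) * expR (- (b * v / 2)) =
     expR (ka * v) * expR (v * d) * expR (- t).
    by rewrite -!expRD; congr expR; rewrite /d; lra.
  rewrite /E exprMn.
  have hd : expR (v * d) <= (1 + t) ^+ B2.
    rewrite expRM -/t; apply: (@le_trans _ _ ((1 + t) `^ d)).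
      by apply: ge0_powR_le => //; lra.
    by rewrite -powR_mulrn; [apply: ler_powR => //; lra|lra].
  have h2 := hC t (ltW t0); rewrite exprD in h2.
  have t1 : 0 <= (1 + t) ^+ (B1 + m) by rewrite exprn_ge0//; lra.
  have h3 : expR (v * d) * (1 + t) ^+ (B1 + m) <= C * expR t.
    by apply: le_trans h2; rewrite ler_wpM2r.
  have h4 : expR (v * d) * (1 + t) ^+ (B1 + m) * expR (- t) <= C.
    by rewrite expRN ler_pdivrMr ?expR_gt0.
  have p1 : 0 <= 2 ^+ (B1 + m) * expR (ka * v) by rewrite mulr_ge0 ?exprn_ge0 ?expR_ge0.
  have := ler_wpM2l p1 h4.
  move=> h5; apply: le_trans (le_trans h5 _); last by rewrite mulrAC.
  by rewrite le_eqVlt; apply/orP; left; apply/eqP; ring.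
have hw : expR (ka * v) * Num.min 1 ((de * r) ^+ m) <=
   de `^ (2 * ka) * expR (- c * `|v - 2 * ln de|).
  have deE : de = expR (ln de) by rewrite lnK ?posrE.
  rewrite {1 2}deE -expRM; set l := ln de.
  have -> : (expR l * r) ^+ m = expR (- (m%:R / 2) * (v - 2 * l)).
    by rewrite /r -expRD -expRM_natl; congr expR; lra.
  have -> : ka * v = l * (2 * ka) + ka * (v - 2 * l) by ring.
  rewrite expRD -mulrA ler_pM2l ?expR_gt0//.
  move: (v - 2 * l) => w.
  have cm : c <= ka /\ c <= m%:R / 2 - ka by rewrite /c !ge_min !lexx orbT.
  rewrite minr_pMr ?expR_ge0// mulr1 -expRD ge_min !ler_expR.
  case: cm => c1 c2; case: (leP w 0) => w0.
    by apply/orP; left; rewrite (ler0_norm w0); nra.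
  by apply/orP; right; rewrite (gtr0_norm w0); nra.
have e1 := expR_gt0 (s * v); have e2 := expR_gt0 (- t).
apply: (@le_trans _ _ (expR (s * v) * expR (- t) *
   (expR (- (b * v / 2)) * E ^+ B1 * (E ^+ m * Num.min 1 ((de * r) ^+ m))))).
  apply: ler_wpM2l; first by rewrite mulr_ge0 ?ltW.
  by apply: ler_pM => //; rewrite ?powR_ge0// min0// mulr_ge0 ?ltW.
have dr0 : 0 <= Num.min 1 ((de * r) ^+ m) by rewrite min0// mulr_ge0 ?ltW.
have := ler_wpM2r dr0 hlog.
have h5 := ler_wpM2l (_ : 0 <= 2 ^+ (B1 + m) * C) hw.
move=> H; apply: le_trans (le_trans H _); last first.
  by rewrite -[leLHS]mulrA; apply: h5; rewrite mulr_ge0 ?exprn_ge0 ?(ltW C0).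
by rewrite exprD le_eqVlt; apply/orP; left; apply/eqP; ring.
Qed.

Lemma integral_translation (G : R -> R) h : continuous G -> (forall v, 0 <= G v) ->
  (\int[mu]_v (G (v + h))%:E = \int[mu]_v (G v)%:E)%E.
Proof.
move=> cG G0.
have dF (x : R) : is_derive x 1 (fun z : R => z + h) (1 + 0) :=
  der_add (der_id x) (der_cst x h).
have F'E : (fun z : R => z + h)^`()%classic = cst 1.
  apply/funext => x; rewrite derive1E.
  by have [_ ->] := dF x; rewrite addr0.
have Fy : (z + h) @[z --> +oo] --> +oo.
  apply/cvgryPge => A; near=> x.
  by rewrite -lerBlDr; near: x; apply: nbhs_pinfty_ge; rewrite num_real.
have FNy : (z + h) @[z --> -oo] --> -oo.
  apply/cvgrNyPle => A; near=> x.
  by rewrite -lerBrDr; near: x; apply: nbhs_ninfty_le; rewrite num_real.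
rewrite [RHS](increasing_ge0_integration_by_substitutionT _ _ _ _ _ FNy Fy)//.
- by apply: eq_integral => x _; rewrite F'E /= mulr1.
- by move=> x y xy; rewrite ltrD2r.
- by rewrite F'E; exact: cst_continuous.
- by rewrite F'E; apply: is_cvg_cst.
- by rewrite F'E; apply: is_cvg_cst.
Unshelve. all: by end_near. Qed.

Lemma integral_exp_norm c : 0 < c ->
  (\int[mu]_v (expR (- c * `|v|))%:E = (2 / c)%:E)%E.
Proof.
move=> c0.
have cts : continuous (fun v : R => expR (- c * `|v|)).
  move=> x; apply: continuous_comp; last exact: continuous_expR.
  by apply: continuousM; [exact: cst_continuous|exact: norm_continuous].
rewrite ge0_symfun_integralT//=; last by move=> x /=; rewrite normrN.
have -> : [set x : R | 0 <= x] = `[0%R, +oo[%classic.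
  by apply/seteqP; split => x /=; rewrite in_itv/= andbT.
have -> : (\int[mu]_(x in `[0%R, +oo[) (expR (- c * `|x|))%:E = (c^-1)%:E)%E.
  (* The integral over the half-line is read off from the total mass 1 of the exponential
     density. *)
  have := @integral_exponential_pdf R c c0.
  rewrite (_ : (\int[mu]_x (exponential_pdf c x)%:E)%E =
     (c%:E * \int[mu]_(x in `[0%R, +oo[) (expR (- c * `|x|))%:E)%E).
    move=> h; apply: (@can_inj _ _ (fun x => c%:E * x)%E (fun x => c^-1%:E * x)%E).
      by move=> x; rewrite muleA -EFinM mulVf ?gt_eqF// mul1e.
    by rewrite h -EFinM divff// gt_eqF.
  rewrite -ge0_integralZl//; last by rewrite lee_fin ltW.
    rewrite [RHS]integral_mkcond; apply: eq_integral => x _.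
    rewrite /exponential_pdf !patchE; case: ifPn => // /[!inE]/=.
    by rewrite in_itv/= andbT => x0; rewrite ger0_norm.
  by apply/measurable_EFinP/measurable_funTS; exact: continuous_measurable_fun.
by rewrite EFinM.
Qed.

End bessel.

Section Rintegral_sum.
Context d (T : measurableType d) (R : realType).
Variables (mu : {measure set T -> \bar R}) (D : set T) (mD : measurable D).

Lemma integrable_Rsum (I : Type) (r : seq I) (F : I -> T -> R) :
  (forall i, mu.-integrable D (EFin \o F i)) ->
  mu.-integrable D (EFin \o (fun x => \sum_(i <- r) F i x)).
Proof.
move=> h; rewrite (_ : EFin \o _ = fun x => (\sum_(i <- r) (F i x)%:E)%E).
  by apply: integrable_sum => // i _; exact: h.
by apply/funext => x /=; rewrite sumEFin.
Qed.

Lemma Rintegral_sum (I : Type) (r : seq I) (F : I -> T -> R) :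
  (forall i, mu.-integrable D (EFin \o F i)) ->
  \int[mu]_(x in D) (\sum_(i <- r) F i x) = \sum_(i <- r) \int[mu]_(x in D) F i x.
Proof.
move=> h; elim: r => [|i r IH].
  rewrite big_nil (@eq_Rintegral _ _ _ mu D (cst 0)) ?Rintegral_cst ?mul0r//.
  by move=> x _; rewrite big_nil.
rewrite big_cons -IH -RintegralD//; last exact: integrable_Rsum.
by apply: eq_Rintegral => x _; rewrite big_cons.
Qed.

Lemma integrable_RZl (k : R) (F : T -> R) : mu.-integrable D (EFin \o F) ->
  mu.-integrable D (EFin \o (fun x => k * F x)).
Proof.
move=> h; rewrite (_ : EFin \o _ = (fun x => k%:E * (F x)%:E)%E).
  exact: integrableZl.
by apply/funext => x /=; rewrite EFinM.
Qed.

End Rintegral_sum.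

Section bessel_potential.
Variable R : realType.
Notation mu := (@lebesgue_measure R).
Implicit Types (c h v s b : R).

Lemma continuous_exp_norm c h : continuous (fun v : R => expR (- c * `|v - h|)).
Proof.
move=> x; apply: continuous_comp; last exact: continuous_expR.
apply: continuousM; first exact: cst_continuous.
apply: (@continuous_comp _ _ _ (fun v : R => v - h) Num.norm); last exact: norm_continuous.
by apply: continuousB => //; exact: cst_continuous.
Qed.

Lemma integrable_exp_norm c h : 0 < c ->
  mu.-integrable setT (EFin \o (fun v => expR (- c * `|v - h|))) /\
  \int[mu]_v expR (- c * `|v - h|) = 2 / c.
Proof.
move=> c0.
have H : (\int[mu]_v (expR (- c * `|v - h|))%:E = (2 / c)%:E)%E.
  rewrite -(integral_exp_norm c0).
  apply: (integral_translation (G := fun v => expR (- c * `|v|)) (- h)).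
    move=> x; have := @continuous_exp_norm c 0 x.
    by under eq_fun do rewrite subr0.
  by move=> v; exact: expR_ge0.
split; last by rewrite /Rintegral H.
apply/integrableP; split.
  by apply/measurable_EFinP; exact: (continuous_measurable_fun (@continuous_exp_norm c h)).
under eq_integral do rewrite /= ger0_norm ?expR_ge0//.
by rewrite H ltry.
Qed.

(* The integrand of the Gamma integral after the substitution t = exp v. *)
Definition laplace s a v : R := expR (s * v) * expR (- (a * expR v)).

Lemma continuous_laplace s a : continuous (laplace s a).
Proof.
rewrite /laplace => x.
apply: (@continuousM _ R^o (fun v => expR (s * v)) (fun v => expR (- (a * expR v)))).
  apply: continuous_comp; last exact: continuous_expR.
  by apply: continuousM; [exact: cst_continuous|exact: cvg_id].
apply: continuous_comp; last exact: continuous_expR.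
apply: continuousN; apply: continuousM; first exact: cst_continuous.
exact: continuous_expR.
Qed.

Lemma laplace_scale s a v : 0 < a -> laplace s a v = a `^ (- s) * laplace s 1 (v + ln a).
Proof.
move=> a0; rewrite /laplace mul1r [in RHS]expRD lnK ?posrE// [a * _]mulrC mulrA.
congr (_ * _); rewrite -[X in X `^ _](lnK (x := a)) ?posrE// -expRM -expRD.
by congr expR; ring.
Qed.

(** The dominating function is the case b = 0, ka = s, de = M = 1 of [bessel_dominated]; an integer
    m' > 2 s makes its decay rate positive. *)
Lemma integrable_laplace s a : 0 < s -> 1 <= a ->
  mu.-integrable setT (EFin \o laplace s a).
Proof.
move=> s0 a1;
pose m' := (Num.bound (2 * s)).+1.
have [C [C0 hC]] := @bessel_dominated R s 0 m' s (lexx _) ltac:(lra).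
have hm' : 0 < Num.min s (m'%:R / 2 - s).
  rewrite lt_min s0 /= subr_gt0 ltr_pdivlMr// mulrC.
  by rewrite /m'; apply: lt_le_trans (archi_boundP _) _; [lra|rewrite ler_nat].
have [i1 _] := integrable_exp_norm 0 hm'.
apply: (le_integrable measurableT _ _ (integrable_RZl measurableT C i1)).
  by apply/measurable_EFinP; exact: (continuous_measurable_fun (@continuous_laplace s a)).
move=> v _; rewrite /= lee_fin (ger0_norm (x := laplace _ _ _)) ?(ger0_norm (x := C * _)).
- have := hC 1 v 1 ltr01 (lexx _); rewrite lerDl expR_ge0 => /(_ isT).
  rewrite powRr0 !mul1r expr1n minxx mulr1 powR1 mul1r ln1 mulr0.
  apply: le_trans; rewrite /laplace ler_pM2l ?expR_gt0// ler_expR lerN2.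
  by rewrite ler_peMl// expR_ge0.
- by rewrite mulr_ge0 ?expR_ge0// ltW.
- by rewrite /laplace mulr_ge0 ?expR_ge0.
Qed.

(** [Ga] is Gamma (s). By [laplace_scale], the parameter a amounts to the factor a^(-s) and a
    translation of v by ln a. *)
Lemma laplace_power s : 0 < s -> exists Ga : R, 0 < Ga /\
  forall a, 1 <= a -> \int[mu]_v laplace s a v = a `^ (- s) * Ga.
Proof.
move=> s0; exists (\int[mu]_v laplace s 1 v); split.
  have i1 := integrable_laplace s0 (lexx 1).
  (* A minorant of the integrand supported on [0, 1]; it shows that [Ga] is positive. *)
  pose g v : R := expR (- expR 1) * \1_(`[0, 1]%classic) v.
  have ig : mu.-integrable setT (EFin \o g).
    apply: integrable_RZl => //; apply: integrable_indic_itv.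
  have H : \int[mu]_v g v = expR (- expR 1).
    rewrite /g RintegralZl//; last exact: integrable_indic_itv.
    rewrite /Rintegral integral_indic// setIT.
    have h1 : mu `[0%R, 1%R]%classic = 1%E.
      by rewrite lebesgue_measure_itv/= lte01 oppr0 adde0.
    by rewrite -[RHS]mulr1; congr (_ * _); exact: (congr1 fine h1).
  apply: (@lt_le_trans _ _ (expR (- expR 1))); first exact: expR_gt0.
  rewrite -H; apply: le_Rintegral => // v _; rewrite /g indicE.
  case: (boolP (v \in _)) => [|_]; last by rewrite mulr0 /laplace mulr_ge0 ?expR_ge0.
  rewrite inE/= in_itv/= => /andP[v0 v1]; rewrite mulr1 /laplace mul1r.
  apply: (@le_trans _ _ (expR (- expR v))); first by rewrite ler_expR lerN2 ler_expR.
  by rewrite ler_peMl ?expR_ge0// -expR0 ler_expR mulr_ge0// ltW.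
move=> a a1; have a0 : 0 < a by lra.
rewrite (@eq_Rintegral _ _ _ mu setT (fun v => a `^ (- s) * laplace s 1 (v + ln a))); last first.
  by move=> v _; rewrite -laplace_scale.
have E : (\int[mu]_v (laplace s 1 (v + ln a))%:E = \int[mu]_v (laplace s 1 v)%:E)%E.
  apply: integral_translation; first exact: continuous_laplace.
  by move=> v; rewrite /laplace mulr_ge0 ?expR_ge0.
have il : mu.-integrable setT (EFin \o (fun v => laplace s 1 (v + ln a))).
  apply/integrableP; split.
    apply/measurable_EFinP; apply: continuous_measurable_fun => x.
    apply: (@continuous_comp _ _ _ (fun v : R => v + ln a)).
      by apply: cvgD; [exact: cvg_id|exact: cvg_cst].
    exact: continuous_laplace.
  have /integrableP[_] := integrable_laplace s0 (lexx 1).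
  apply: le_lt_trans; rewrite le_eqVlt; apply/orP; left; apply/eqP.
  have h0 v : 0 <= laplace s 1 v by rewrite /laplace mulr_ge0 ?expR_ge0.
  under eq_integral => v _ do rewrite /= (ger0_norm (h0 _)).
  under [RHS]eq_integral => v _ do rewrite /= (ger0_norm (h0 _)).
  exact: E.
apply: (eq_trans (RintegralZl (a `^ (- s)) measurableT il)).
by apply: (congr1 (fun z => _ * z)); exact: (congr1 fine E).
Qed.

(** With a_i = 1 + |k|^2 the sum in the hypothesis is a heat flow at time t, and the sum in the
    conclusion is its superposition over all times. In the application [s] is half the Sobolev
    exponent and [b] is q/p. The scale M may depend on t, so the dominating function is found
    separately for each v. *)
Lemma bessel_sum_bound s b (m : nat) (ka : R) : 0 <= b -> 0 < ka ->
  2 * ka < m%:R -> 2 * ka <= 2 * s - b ->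
  exists C : R, 0 < C /\
  forall (I : finType) (c a : I -> R) (A de : R), 0 <= A -> 0 < de ->
    (forall i, 1 <= a i) ->
    (forall t, 0 < t -> exists M, [/\ 1 <= M, M <= 1 + (Num.sqrt t)^-1 &
       `|\sum_i c i * expR (- t * (a i - 1))| <=
          A * (M `^ b * Num.min 1 ((de * M) ^+ m))]) ->
    `|\sum_i c i * a i `^ (- s)| <= C * A * de `^ (2 * ka).
Proof.
move=> b0 ka0 hm hs; have s0 : 0 < s by lra.
have [Ga [Ga0 hGa]] := laplace_power s0.
have [C [C0 hC]] := bessel_dominated m b0 hs.
set cc := Num.min _ _ in hC.
have cc0 : 0 < cc by rewrite lt_min ka0/=; lra.
exists (C * (2 / cc) / Ga); split; first by apply: divr_gt0 => //; apply: mulr_gt0 => //; apply: divr_gt0.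
move=> I c a A de A0 de0 a1 hS.
have [ig Eg] := integrable_exp_norm (2 * ln de) cc0.
have il i : mu.-integrable setT (EFin \o (fun v => c i * laplace s (a i) v)).
  by apply: integrable_RZl => //; exact: integrable_laplace.
have E : \int[mu]_v (\sum_i c i * laplace s (a i) v) =
    (\sum_i c i * a i `^ (- s)) * Ga.
  rewrite Rintegral_sum// mulr_suml; apply: eq_bigr => i _.
  apply: (eq_trans (RintegralZl (c i) measurableT (integrable_laplace s0 (a1 i)))).
  by rewrite (hGa _ (a1 i)) mulrA.
have isum := integrable_Rsum measurableT (index_enum I) il.
have := le_normr_Rintegral measurableT isum.
rewrite E normrM (gtr0_norm Ga0) -ler_pdivlMr//.
move=> /le_trans; apply.
have -> : C * (2 / cc) / Ga * A * de `^ (2 * ka) =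
   (C * A * de `^ (2 * ka)) * (2 / cc) / Ga by ring.
rewrite ler_pM2r ?invr_gt0//.
have hz := RintegralZl (C * A * de `^ (2 * ka)) measurableT ig.
rewrite -Eg -hz; apply: le_Rintegral => //.
- have := integrable_abse isum; apply: eq_integrable => //.
- exact: integrable_RZl.
move=> v _.
have [M [M1 hM hb]] := hS (expR v) (expR_gt0 v).
have sq : (Num.sqrt (expR v))^-1 = expR (- (v / 2)).
  rewrite (_ : expR v = expR (v / 2) ^+ 2).
    by rewrite sqrtr_sqr ger0_norm ?expR_ge0// expRN.
  by rewrite -expRM_natl; congr expR; lra.
rewrite sq in hM; have := hC de v M de0 M1 hM.
have -> : \sum_i c i * laplace s (a i) v = expR (s * v) * expR (- expR v) *
   \sum_i c i * expR (- expR v * (a i - 1)).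
  rewrite mulr_sumr; apply: eq_bigr => i _; rewrite /laplace.
  have -> : expR (- (a i * expR v)) = expR (- expR v) * expR (- expR v * (a i - 1)).
    by rewrite -expRD; congr expR; ring.
  by ring.
rewrite normrM ger0_norm ?mulr_ge0 ?expR_ge0// => H.
have p0 : 0 <= expR (s * v) * expR (- expR v) by rewrite mulr_ge0 ?expR_ge0.
apply: le_trans (ler_wpM2l p0 hb) _.
rewrite mulrCA; apply: le_trans (ler_wpM2l A0 H) _.
by rewrite le_eqVlt; apply/orP; left; apply/eqP; ring.
Qed.

End bessel_potential.

(** * Integration over the torus *)
Section torus_integral.
Variable R : realType.
Local Notation RT := (measurableTypeR R).
Notation mu := (@lebesgue_measure R).

Definition cellT q : set (q.-tuple RT) := @torow R q @^-1` cell.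

Lemma cellTE q (u : q.-tuple RT) :
  cellT u <-> forall i, tnth u i \in `[- pi, pi].
Proof.
rewrite /cellT /cell /box /torow /=.
by split=> h i; have := h i; rewrite !mxE sub0r add0r.
Qed.

Lemma measurable_cellT q : measurable (@cellT q).
Proof.
rewrite (_ : @cellT q = \bigcap_(i in [set: 'I_q])
    ((fun u : q.-tuple RT => tnth u i) @^-1` `[- pi, pi])).
  apply: fin_bigcap_measurable; first exact: finite_finset.
  move=> i _; rewrite -[X in measurable X]setTI.
  by apply: measurable_tnth => //; exact: measurable_itv.
apply/seteqP; split=> u; first by move=> /cellTE h i _; exact: h.
by move=> h; apply/cellTE => i; exact: h.
Qed.

Lemma tnth_tcons0 q (x : RT) (u : q.-tuple RT) : tnth (tcons (x, u)) ord0 = x.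
Proof. by []. Qed.

Lemma tnth_tconsS q (x : RT) (u : q.-tuple RT) i :
  tnth (tcons (x, u)) (lift ord0 i) = tnth u i.
Proof. by rewrite /tcons !(tnth_nth x). Qed.

Lemma cellT_cons q (x : RT) (u : q.-tuple RT) :
  cellT (tcons (x, u)) <-> x \in `[- pi, pi] /\ cellT u.
Proof.
rewrite !cellTE; split=> [h|[hx h] i].
  split; first exact: (h ord0).
  by move=> i; have := h (lift ord0 i); rewrite tnth_tconsS.
by case: (unliftP ord0 i) => [j ->|->]; rewrite ?tnth_tconsS.
Qed.

(** [lebesgueq q.+1] is the image of a product measure under [tcons], so Tonelli's theorem peels off
    the first coordinate. This is the induction step for the integrals over the cell that follow. *)
Lemma integral_cellS q (f : q.+1.-tuple RT -> \bar R) :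
  measurable_fun setT f -> (forall u, 0 <= f u)%E ->
  (\int[lebesgueq q.+1]_(u in @cellT q.+1) f u =
   \int[mu]_(x in `[(- pi)%R, pi]) \int[lebesgueq q]_(u in @cellT q) f (tcons (x, u)))%E.
Proof.
move=> mf f0; rewrite [LHS]integral_mkcond.
have mg : measurable_fun setT (f \_ (@cellT q.+1)).
  apply/(measurable_restrictT _ _).1; first exact: measurable_cellT.
  exact: measurable_funTS.
have g0 u : (0 <= (f \_ (@cellT q.+1)) u)%E by apply: erestrict_ge0.
transitivity (\int[(mu \x lebesgueq q)%E]_z ((f \_ (@cellT q.+1)) \o @tcons R q) z)%E.
  by rewrite (ge0_integral_pushforward (@measurable_tcons R q)).
have mgc : measurable_fun setT ((f \_ (@cellT q.+1)) \o @tcons R q).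
  by apply: measurableT_comp; [exact: mg|exact: measurable_tcons].
rewrite (fubini_tonelli1 _ mgc); last by move=> z; exact: g0.
rewrite [RHS]integral_mkcond; apply: eq_integral => x _.
rewrite /fubini_F patchE; case: ifPn => xI.
  rewrite [RHS]integral_mkcond; apply: eq_integral => u _.
  rewrite /= !patchE; congr (if _ then _ else _).
  apply/idP/idP; rewrite !inE cellT_cons; first by case.
  by move=> h; split=> //; move: xI; rewrite inE.
rewrite (eq_integral (fun=> 0%E)) ?integral0// => u _.
rewrite /= patchE ifF//; apply/negP; rewrite inE cellT_cons => -[xI' _].
by move/negP: xI; apply; rewrite inE.
Qed.

Lemma lebesgue_pipi (r : R) : (\int[mu]_(x in `[(- pi)%R, pi]) r%:E = (2 * pi * r)%:E)%E.
Proof.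
rewrite integral_cst//= lebesgue_measure_itv/= lte_fin.
rewrite ifT; last by have := pi_gt0 R; lra.
by rewrite -EFinB -EFinM; congr EFin; ring.
Qed.

Lemma integral_prod_cell q (w : 'I_q -> R -> R) (c : 'I_q -> R) :
  (forall i, measurable_fun setT (w i)) -> (forall i x, 0 <= w i x) ->
  (forall i, \int[mu]_(x in `[(- pi)%R, pi]) (w i x)%:E = (c i)%:E)%E ->
  (\int[lebesgueq q]_(u in @cellT q) (\prod_i w i (tnth u i))%:E = (\prod_i c i)%:E)%E.
Proof.
elim: q w c => [|q IH] w c mw w0 hc.
  rewrite big_ord0 /= integral_dirac; last 2 first.
    exact: measurable_cellT.
    by under eq_fun do rewrite big_ord0; exact: measurable_cst.
  rewrite big_ord0 mule1 diracE mem_set//.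
  by apply/cellTE => -[].
have mprod n (w' : 'I_n -> R -> R) : (forall i, measurable_fun setT (w' i)) ->
    measurable_fun setT (fun u : n.-tuple RT => \prod_i w' i (tnth u i)).
  move=> mw'; apply: measurable_prod => i _.
  exact: (measurableT_comp (mw' i) (measurable_tnth i)).
rewrite integral_cellS; last 2 first.
  by apply/measurable_EFinP; exact: mprod.
  by move=> u; rewrite lee_fin prodr_ge0.
rewrite big_ord_recl; set cc := \prod_(_ < q) _.
transitivity (\int[mu]_(x in `[(- pi)%R, pi]) (cc%:E * (w ord0 x)%:E))%E.
  apply: eq_integral => x _.
  under eq_integral => u _.
    rewrite big_ord_recl tnth_tcons0 EFinM.
    under eq_bigr do rewrite tnth_tconsS.
    over.
  have mF : measurable_fun (@cellT q)
      (fun u => (\prod_(i < q) w (lift ord0 i) (tnth u i))%:E).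
    by apply/measurable_EFinP/measurable_funTS; exact: (mprod _ (fun i => w (lift ord0 i))).
  have F0 (u : q.-tuple RT) : @cellT q u ->
      (0 <= (\prod_(i < q) w (lift ord0 i) (tnth u i))%:E)%E.
    by move=> _; rewrite lee_fin prodr_ge0.
  have wx0 : (0 <= (w ord0 x)%:E)%E by rewrite lee_fin.
  rewrite /= (ge0_integralZl _ (@measurable_cellT q) mF F0 wx0).
  by rewrite (IH (fun i => w (lift ord0 i)) (fun i => c (lift ord0 i)))// muleC.
have cc0 : (0 <= cc%:E)%E.
  rewrite lee_fin; apply: prodr_ge0 => i _; rewrite -lee_fin -hc.
  by apply: integral_ge0 => x _; rewrite lee_fin.
have mw0 : measurable_fun `[(- pi)%R, pi] (fun x => (w ord0 x)%:E).
  by apply/measurable_EFinP/measurable_funTS; exact: mw.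
have w00 (x : R) : `[(- pi)%R, pi]%classic x -> (0 <= (w ord0 x)%:E)%E.
  by move=> _; rewrite lee_fin.
rewrite [RHS]EFinM -hc muleC.
by apply: ge0_integralZl => //.
Qed.

End torus_integral.

(** * Trigonometric integrals over one period *)

Section one_dim_integrals.
Variable R : realType.
Notation mu := (@lebesgue_measure R).
Implicit Types (x y v u N : R) (k : int) (n : nat).

Lemma is_derive_cont (f df : R -> R) : (forall z : R, is_derive z 1 f (df z)) ->
  continuous f.
Proof.
move=> h z; apply: differentiable_continuous.
by apply/derivable1_diffP; have [] := h z.
Qed.

Lemma FTC2_is_derive (F f df : R -> R) (a b : R) : a < b ->
  (forall z : R, is_derive z 1 F (f z)) -> (forall z : R, is_derive z 1 f (df z)) ->
  (\int[mu]_(z in `[a, b]) (f z)%:E = (F b - F a)%:E)%E.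
Proof.
move=> ab hF hf; rewrite EFinB.
apply: continuous_FTC2 => //.
- exact: is_derive_continuous_within.
- split.
  + by move=> z _; have [] := hF z.
  + by apply: cvg_at_right_filter; exact: (is_derive_cont hF).
  + by apply: cvg_at_left_filter; exact: (is_derive_cont hF).
- by move=> z _; rewrite derive1E; have [_ ->] := hF z.
Qed.

Lemma sin_nat_pi n : sin (n%:R * pi) = 0 :> R.
Proof.
elim: n => [|n IH]; first by rewrite mul0r sin0.
by rewrite -natr1 mulrDl mul1r sinDpi IH oppr0.
Qed.

Lemma sin_int_pi k : sin (k%:~R * pi) = 0 :> R.
Proof.
case: k => n; first exact: sin_nat_pi.
by rewrite NegzE mulrNz mulNr sinN (sin_nat_pi n.+1) oppr0.
Qed.

Lemma cos2_int_pi k : cos (k%:~R * pi) ^+ 2 = 1 :> R.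
Proof.
by have := cos2Dsin2 (k%:~R * pi : R); rewrite sin_int_pi expr0n/= addr0.
Qed.

Lemma sin2_shift v k : sin (v + k%:~R * pi) ^+ 2 = sin v ^+ 2.
Proof.
by rewrite sinD sin_int_pi mulr0 addr0 exprMn cos2_int_pi mulr1.
Qed.

Lemma cos_2pi_int v k : cos (v + 2 * pi * k%:~R) = cos v.
Proof.
have -> : v + 2 * pi * k%:~R = (v + k%:~R * pi) + k%:~R * pi by ring.
move: (cos2_int_pi k) (sin_int_pi k); move: (k%:~R * pi) => y cy sy.
by rewrite cosD cosD sy !mulr0 !subr0 -mulrA -expr2 cy mulr1.
Qed.

Lemma derive_sin_affine (d be x : R) :
  is_derive x 1 (fun z : R => sin (d * z + be)) (d * cos (d * x + be)).
Proof.
have h := @der_comp _ sin (fun z : R => d * z + be) x _ _ (is_derive_sin _)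
  (der_add (der_scale d (der_id x)) (der_cst x be)).
by apply: (is_derive_eq h); ring.
Qed.

Lemma derive_cos_affine (d be x : R) :
  is_derive x 1 (fun z : R => cos (d * z + be)) (- d * sin (d * x + be)).
Proof.
have h := @der_comp _ cos (fun z : R => d * z + be) x _ _ (is_derive_cos _)
  (der_add (der_scale d (der_id x)) (der_cst x be)).
by apply: (is_derive_eq h); ring.
Qed.

(** The form A + B cos is the one that the induction on the dimension in [integral_cell_cos] leaves
    for the last integration. *)
Lemma integral_cos k (A B be : R) :
  (\int[mu]_(x in `[(- pi)%R, pi]) (A + B * cos (k%:~R * x + be))%:E =
   (2 * pi * A + 2 * pi * B * cos be * (k == 0)%:R)%:E)%E.
Proof.
have pi0 := pi_gt0 R; have pp : - pi < pi :> R by lra.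
have [->|k0] := eqVneq k 0.
  under eq_integral do rewrite mul0r add0r.
  by rewrite lebesgue_pipi; congr EFin; rewrite mulr1; ring.
have k0' : k%:~R != 0 :> R by rewrite intr_eq0.
have hF (z : R) : is_derive z 1 (fun x => A * x + B / k%:~R * sin (k%:~R * x + be))
    (A + B * cos (k%:~R * z + be)).
  have h := der_add (der_scale A (der_id z))
    (der_scale (B / k%:~R) (derive_sin_affine k%:~R be z)).
  by apply: (is_derive_eq h); field.
have hf (z : R) : is_derive z 1 (fun x => A + B * cos (k%:~R * x + be))
    (0 + B * (- k%:~R * sin (k%:~R * z + be))).
  exact: (der_add (der_cst z A) (der_scale B (derive_cos_affine k%:~R be z))).
rewrite (FTC2_is_derive pp hF hf) mulr0 addr0; congr EFin.
have -> : k%:~R * - pi = - (k%:~R * pi) :> R by ring.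
rewrite !sinD sinN cosN sin_int_pi; ring.
Qed.

(** For |z| <= pi / 4 one has cos (2 z) >= 0, hence cos^2 z >= 1/2. The mean value theorem then
    gives sin^2 (v / 4) >= (v / 4)^2 / 2, and the double angle formula passes to v / 2. *)
Lemma sin2_ge v : `|v| <= pi -> v ^+ 2 / 16 <= sin (v / 2) ^+ 2.
Proof.
move=> hv; have pi0 := pi_gt0 R.
have hc (z : R) : `|z| <= pi / 4 -> 2^-1 <= cos z ^+ 2.
  rewrite ler_norml => /andP[z1 z2].
  have : 0 <= cos (z + z) by apply: cos_ge0_pihalf; apply/andP; split; lra.
  have := cos2Dsin2 z; rewrite cosD -!expr2.
  by move: (cos z ^+ 2) (sin z ^+ 2) => c s; lra.
have h4 : `|v / 4| <= pi / 4.
  by rewrite normrM (gtr0_norm (x := 4^-1)) ?invr_gt0// ler_pM2r ?invr_gt0.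
have hs : v ^+ 2 / 32 <= sin (v / 4) ^+ 2.
  wlog v0 : v hv h4 / 0 <= v.
    move=> H; have [|v0] := leP 0 v; first exact: H.
    have := H (- v); rewrite normrN mulNr normrN sqrrN sinN sqrrN; apply=> //; lra.
  have v4 : 0 <= v / 4 by lra.
  have [|c] := MVT_segment v4 (fun z _ => is_derive_sin z).
    by apply: (@is_derive_continuous_within _ _ cos) => z; exact: is_derive_sin.
  rewrite in_itv/= sin0 !subr0 => /andP[c0 cv] ->; rewrite exprMn.
  have : 2^-1 <= cos c ^+ 2.
    apply: hc; rewrite ger0_norm//; apply: le_trans cv _.
    by rewrite ger0_norm// in h4.
  have : 0 <= (v / 4) ^+ 2 by exact: sqr_ge0.
  have -> : (v / 4) ^+ 2 = v ^+ 2 / 16 by field.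
  by move: (v ^+ 2) (cos c ^+ 2) => a b; nra.
have -> : v / 2 = v / 4 + v / 4 by field.
rewrite sinD (_ : sin (v / 4) * cos (v / 4) + cos (v / 4) * sin (v / 4) =
  2 * sin (v / 4) * cos (v / 4)); last by ring.
have := hc _ h4; rewrite !exprMn; move: hs.
have : 0 <= v ^+ 2 by exact: sqr_ge0.
by move: (v ^+ 2) (cos _ ^+ 2) (sin _ ^+ 2) => a b c; nra.
Qed.

(** The majorant of the kernel in [kern_bound], up to the factor C N^a: a periodic peak of height N,
    with an integral bounded independently of N. *)
Definition bump N x u : R := N / (1 + N ^+ 2 * sin ((x - u) / 2) ^+ 2).

Lemma bump_ge0 N x u : 0 <= N -> 0 <= bump N x u.
Proof.
move=> N0; apply: divr_ge0 => //; apply: addr_ge0 => //.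
by apply: mulr_ge0; exact: sqr_ge0.
Qed.

Lemma bump_le N x u : 0 <= N -> bump N x u <= N.
Proof.
move=> N0; have h : 0 <= N ^+ 2 * sin ((x - u) / 2) ^+ 2.
  by rewrite mulr_ge0 ?sqr_ge0.
rewrite ler_pdivrMr; last lra.
by rewrite ler_peMr// lerDl.
Qed.

Lemma bump_shift N x u k : bump N (x + 2 * pi * k%:~R) u = bump N x u.
Proof.
rewrite /bump; have -> : (x + 2 * pi * k%:~R - u) / 2 = (x - u) / 2 + k%:~R * pi.
  by field.
by rewrite sin2_shift.
Qed.

Lemma measurable_bump N x : measurable_fun setT (bump N x).
Proof.
apply: continuous_measurable_fun => u; apply: differentiable_continuous.
apply/derivable1_diffP.
have d1 := der_comp (der_X 2 _) (derive_sin_affine (- 2^-1) (x / 2) u).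
have d2 := der_add (der_cst u 1) (der_scale (N ^+ 2) d1).
have nz : 1 + N ^+ 2 * sin (- 2^-1 * u + x / 2) ^+ 2 != 0.
  by rewrite gt_eqF// ltr_pwDl// mulr_ge0 ?sqr_ge0.
have [d3 _] := der_scale N (@is_deriveV _
  (fun z => 1 + N ^+ 2 * sin (- 2^-1 * z + x / 2) ^+ 2) u _ _ nz d2).
rewrite (_ : bump N x = fun u => N / (1 + N ^+ 2 * sin (- 2^-1 * u + x / 2) ^+ 2))//.
apply/funext => z; rewrite /bump; have -> // : (x - z) / 2 = - 2^-1 * z + x / 2.
by field.
Qed.

(** After reduction of x to [-pi, pi], one of the shifts of x - u by -2 pi, 0 or 2 pi lies in
    [-pi, pi], where [sin2_ge] bounds the peak by N / (1 + (N w / 4)^2). The primitive of this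
    function is a multiple of atan, of total variation at most 4 pi; three shifts give 12 pi. *)
Lemma integral_bump_le N x : 0 < N ->
  (\int[mu]_(u in `[(- pi)%R, pi]) (bump N x u)%:E <= (12 * pi)%:E)%E.
Proof.
move=> N0; have pi0 := pi_gt0 R; have pp : - pi < pi :> R by lra.
wlog xpi : x / - pi <= x <= pi.
  move=> H; pose k := Num.floor ((x + pi) / (2 * pi)).
  have := H (x + 2 * pi * (- k)%:~R).
  under eq_integral do rewrite bump_shift.
  apply; have p2 : 0 < 2 * pi :> R by lra.
  have := Num.Theory.floor_le ((x + pi) / (2 * pi)).
  have := Num.Theory.floorD1_gt ((x + pi) / (2 * pi)); rewrite -/k.
  rewrite ltr_pdivrMr// ler_pdivlMr// mulrNz intrD => h1 h2.
  by apply/andP; split; lra.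
pose g (j : 'I_3) u := N / (1 + (N / 4 * (x - u - 2 * pi * ((j : nat)%:R - 1))) ^+ 2).
pose G (j : 'I_3) u := - 4 * atan (N / 4 * (x - u - 2 * pi * ((j : nat)%:R - 1))).
have dl j (u : R) : is_derive u 1 (fun u => N / 4 * (x - u - 2 * pi * ((j : nat)%:R - 1)))
   (- (N / 4)).
  have h := der_scale (N / 4) (der_add (der_add (der_cst u x) (der_scale (-1) (der_id u)))
     (der_cst u (- (2 * pi * (j%:R - 1))))).
  have -> : (fun u0 : R => N / 4 * (x - u0 - 2 * pi * (j%:R - 1))) =
    (fun z : R => N / 4 * (x + -1 * z + - (2 * pi * (j%:R - 1)))).
    by apply/funext => z; rewrite mulN1r.
  by apply: (is_derive_eq h); ring.
have dg0 (z : R) : 1 + z ^+ 2 != 0 by rewrite gt_eqF// ltr_pwDl// sqr_ge0.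
have dG (j : 'I_3) (u : R) : is_derive u 1 (G j) (g j u).
  have h := der_scale (-4) (@der_comp _ (@atan R) _ u _ _ (is_derive1_atan _) (dl j u)).
  by apply: (is_derive_eq h); rewrite /g; move: ((1 + _)^-1) => w; field.
have dg (j : 'I_3) (u : R) : is_derive u 1 (g j) (N *
   (- (1 + (N / 4 * (x - u - 2 * pi * ((j : nat)%:R - 1))) ^+ 2) ^- 2 *:
   (0 + 2 * (N / 4 * (x - u - 2 * pi * ((j : nat)%:R - 1))) ^+ 1 * - (N / 4)))).
  apply: der_scale.
  apply: (@is_deriveV _ (fun u => 1 + (N / 4 * (x - u - 2 * pi * ((j : nat)%:R - 1))) ^+ 2)) => //.
  exact: (der_add (der_cst u 1)
    (@der_comp _ (fun z => z ^+ 2) _ u _ _ (der_X 2 _) (dl j u))).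
have ig (j : 'I_3) : (\int[mu]_(u in `[(- pi)%R, pi]) (g j u)%:E <= (4 * pi)%:E)%E.
  rewrite (FTC2_is_derive pp (dG j) (dg j)) lee_fin /G.
  set a := atan _; set b := atan _.
  have : - (pi / 2) < a := atan_gtNpi2 _.
  have : a < pi / 2 := atan_ltpi2 _.
  have : - (pi / 2) < b := atan_gtNpi2 _.
  have : b < pi / 2 := atan_ltpi2 _.
  lra.
have mg j : measurable_fun setT (g j).
  by apply: continuous_measurable_fun; exact: (is_derive_cont (dg j)).
have g0 j u : 0 <= g j u by rewrite divr_ge0 ?addr_ge0 ?sqr_ge0// ltW.
apply: (@le_trans _ _ (\int[mu]_(u in `[(- pi)%R, pi]) (\sum_(j < 3) (g j u)%:E))%E).
  have b0 (u : R) : `[(- pi)%R, pi]%classic u -> (0 <= (bump N x u)%:E)%E.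
    by move=> _; rewrite lee_fin bump_ge0// ltW.
  have mb : measurable_fun `[(- pi)%R, pi] (fun u => (bump N x u)%:E).
    by apply/measurable_EFinP/measurable_funTS; exact: measurable_bump.
  have ms : measurable_fun `[(- pi)%R, pi] (fun u => \sum_(j < 3) (g j u)%:E)%E.
    by apply: emeasurable_sum => j; apply/measurable_EFinP/measurable_funTS; exact: mg.
  apply: ge0_le_integral => //.
  move=> u /=; rewrite in_itv/= => /andP[u1 u2]; rewrite sumEFin lee_fin.
  have key (j : 'I_3) : `|x - u - 2 * pi * ((j : nat)%:R - 1)| <= pi ->
      bump N x u <= g j u.
    have pos1 (a : R) : 0 < 1 + a ^+ 2 by rewrite ltr_pwDl// sqr_ge0.
    move=> hj; rewrite /bump /g ler_pM2l// lef_pV2 ?posrE; last 2 first.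
    - by rewrite -exprMn.
    - exact: pos1.
    rewrite lerD2l exprMn; have := sin2_ge hj.
    have -> : sin ((x - u - 2 * pi * ((j : nat)%:R - 1)) / 2) ^+ 2 = sin ((x - u) / 2) ^+ 2.
      rewrite -(sin2_shift ((x - u) / 2) (- ((j : nat)%:Z - 1))); congr (sin _ ^+ 2).
      by rewrite mulrNz intrB; field.
    have -> : (N / 4) ^+ 2 = N ^+ 2 / 16 by field.
    have : 0 < N ^+ 2 by rewrite exprn_gt0.
    by move: (N ^+ 2) ((x - u - _) ^+ 2) (sin _ ^+ 2) => a b c; nra.
  rewrite !big_ord_recr big_ord0/= add0r.
  case/andP: xpi => x1 x2.
  have [h|h] := ltP (x - u) (- pi).
    have hk := key ord0; apply: le_trans (hk _) _.
      by rewrite /= ler_norml; apply/andP; split; lra.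
    rewrite -addrA (_ : widen_ord _ _ = ord0) ?lerDl ?addr_ge0//; exact: val_inj.
  have [h'|h'] := leP (x - u) pi.
    have hk := key (Ordinal (isT : (1 < 3)%N)); apply: le_trans (hk _) _.
      by rewrite /= ler_norml; apply/andP; split; lra.
    rewrite addrAC (_ : widen_ord _ (ord_max : 'I_2) = Ordinal (isT : (1 < 3)%N)); last exact: val_inj.
    by rewrite lerDr addr_ge0.
  have hk := key ord_max; apply: le_trans (hk _) _.
    by rewrite /= ler_norml; apply/andP; split; lra.
  by rewrite lerDr addr_ge0.
rewrite ge0_integral_sum//; last 2 first.
- by move=> j; apply/measurable_EFinP/measurable_funTS; exact: mg.
- by move=> j u _; rewrite lee_fin.
apply: (@le_trans _ _ (\sum_(j < 3) (4 * pi)%:E)%E); first exact: lee_sum.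
by rewrite !big_ord_recr big_ord0/= add0e -!EFinD lee_fin; lra.
Qed.

End one_dim_integrals.

(** * The Fejer kernel *)

Section fejer.
Variable R : realType.
Notation mu := (@lebesgue_measure R).
Implicit Types (x y v u N : R) (k : int) (n : nat).

Definition fejer n v : R :=
  \sum_(i < n.*2.+1) tent R n (kidx n i) * cos ((kidx n i)%:~R * v).

Lemma tent_diff2E n k : (0 < n)%N -> `|k| <= n%:Z ->
  tent R n (k + 1) + tent R n (k - 1) - 2 * tent R n k =
  ((k == n%:Z)%:R + (k == - n%:Z)%:R - 2 * (k == 0)%:R) / n%:R.
Proof.
move=> n0 kn; have n0' : n%:R != 0 :> R by rewrite pnatr_eq0 -lt0n.
have [->|k0] := eqVneq k 0.
  have -> : (0 == n%:Z) = false by lia.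
  have -> : (0 == - n%:Z) = false by lia.
  rewrite add0r sub0r tentN !tent_in//; try lia.
  rewrite normr0 normr1 ?mulr0n ?mulr1n. by field.
have [->|kN] := eqVneq k n%:Z.
  have -> : (n%:Z == - n%:Z) = false by lia.
  rewrite !(tent_out R n0 (k := n%:Z + 1)) ?(tent_out R n0 (k := n%:Z)); try lia.
  rewrite tent_in//; last lia.
  have -> : `|(n%:Z - 1)%:~R| = n%:R - 1 :> R.
    by rewrite ger0_norm ?rmorphB//= subr_ge0 (ler_nat _ 1).
  by rewrite ?mulr0n ?mulr1n; field.
have [->|kN'] := eqVneq k (- n%:Z).
  rewrite !(tent_out R n0 (k := - n%:Z - 1)) ?(tent_out R n0 (k := - n%:Z)); try lia.
  have -> : - n%:Z + 1 = - (n%:Z - 1) by lia.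
  rewrite tentN tent_in//; last lia.
  have -> : `|(n%:Z - 1)%:~R| = n%:R - 1 :> R.
    by rewrite ger0_norm ?rmorphB//= subr_ge0 (ler_nat _ 1).
  by rewrite ?mulr0n ?mulr1n; field.
rewrite !tent_in; try lia.
have [kp|kn'] := ltP 0 k.
  rewrite !ger0_norm ?ler0z//; try lia.
  by rewrite intrD intrB ?mulr0n ?mulr1n; field.
rewrite !ler0_norm ?lerz0//; try lia.
by rewrite intrD intrB ?mulr0n ?mulr1n; field.
Qed.

(** By [tent_diff2E] the second differences of the tent are point masses at 0, n and -n. Summation
    by parts therefore leaves three cosines, which is the closed form of the Fejer kernel. *)
Lemma fejer_sin2E n v : (0 < n)%N ->
  4 * sin (v / 2) ^+ 2 * fejer n v = (2 - 2 * cos (n%:R * v)) / n%:R.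
Proof.
move=> n0; rewrite sin_half.
have := @kern_sum_by_parts R n (tent R n) v 0 (@tent_out R n ^~ n0).
rewrite /fejer; under eq_bigr do rewrite addr0.
move=> ->.
have kn (i : 'I_n.*2.+1) : `|kidx n i| <= n%:Z.
  by case: i => i /=; rewrite /kidx; lia.
have hin j (c : 'I_n.*2.+1 -> R) (jn : (j < n.*2.+1)%N) :
    \sum_(i < n.*2.+1) (nat_of_ord i == j)%:R * c i = c (Ordinal jn).
  rewrite (bigD1 (Ordinal jn))//= eqxx mul1r big1 ?addr0// => i.
  by rewrite -val_eqE/= => /negPf ->; rewrite mul0r.
have n1 : (n < n.*2.+1)%N by lia.
have n2 : (n.*2 < n.*2.+1)%N by lia.
pose c (i : 'I_n.*2.+1) := cos ((kidx n i)%:~R * v).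
transitivity (- ((\sum_(i < n.*2.+1) (nat_of_ord i == n.*2)%:R * c i +
   \sum_(i < n.*2.+1) (nat_of_ord i == 0%N)%:R * c i -
   2 * \sum_(i < n.*2.+1) (nat_of_ord i == n)%:R * c i) / n%:R)).
  congr (- _); rewrite mulr_sumr -big_split/= -sumrB mulr_suml.
  apply: eq_bigr => i _; rewrite addr0 tent_diff2E// /c /kidx.
  have -> : (i%:Z - n%:Z == 0) = (nat_of_ord i == n) by lia.
  have -> : (i%:Z - n%:Z == n%:Z) = (nat_of_ord i == n.*2) by lia.
  have -> : (i%:Z - n%:Z == - n%:Z) = (nat_of_ord i == 0%N) by lia.
  ring.
rewrite (hin _ _ n2) (hin _ _ (ltn0Sn _)) (hin _ _ n1) /c /kidx/=.
rewrite subrr mul0r cos0 sub0r -addnn PoszD addrK mulrNz mulNr cosN.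
by rewrite -[n%:Z%:~R]/(n%:R); ring.
Qed.

Lemma cos1_mul n v : cos v = 1 -> cos (n%:R * v) = 1.
Proof.
move=> h; have s0 : sin v = 0.
  have /eqP : sin v ^+ 2 = 0 by have := cos2Dsin2 v; rewrite h expr1n; lra.
  by rewrite expf_eq0/= => /eqP.
elim: n => [|n IH]; first by rewrite mul0r cos0.
by rewrite -natr1 mulrDl mul1r cosD IH h s0; ring.
Qed.

Lemma fejer_ge0 n v : (0 < n)%N -> 0 <= fejer n v.
Proof.
move=> n0; have n0' : 0 < n%:R :> R by rewrite ltr0n.
(* Where cos v = 1 the closed form reads 0 = 0; there all cosines of the sum are 1 and the terms are
   nonnegative one by one. *)
have [h|h] := eqVneq (cos v) 1.
  apply: sumr_ge0 => i _; rewrite mulr_ge0 ?tent_ge0//.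
  case: (kidx n i) => j.
    by rewrite (cos1_mul j h).
  by rewrite NegzE mulrNz mulNr cosN (cos1_mul j.+1 h).
have c1 : cos v < 1 by rewrite lt_neqAle h cos_le1.
have := fejer_sin2E v n0; rewrite sin_half => E.
have p : 0 < 2 - 2 * cos v by lra.
rewrite -(pmulr_rge0 _ p) E divr_ge0//.
Qed.

Lemma fejer_sin2_le n v : (0 < n)%N -> fejer n v * sin (v / 2) ^+ 2 <= n%:R^-1.
Proof.
move=> n0; have := fejer_sin2E v n0; have := cos_geN1 (n%:R * v).
have : 0 < n%:R^-1 :> R by rewrite invr_gt0 ltr0n.
by move: (cos (n%:R * v)) (n%:R^-1) => c w; nra.
Qed.

Lemma fejer_cont n : continuous (fejer n).
Proof.
pose df v := \sum_(i < n.*2.+1) tent R n (kidx n i) *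
   (- (kidx n i)%:~R * sin ((kidx n i)%:~R * v + 0)).
apply: (@is_derive_cont _ _ df) => v.
have H (r : seq 'I_n.*2.+1) : is_derive (v : R) 1
  (fun v => \sum_(i <- r) tent R n (kidx n i) * cos ((kidx n i)%:~R * v))
  (\sum_(i <- r) tent R n (kidx n i) * (- (kidx n i)%:~R * sin ((kidx n i)%:~R * v + 0))).
  elim: r => [|i r IH].
    rewrite big_nil; under eq_fun do rewrite big_nil.
    exact: der_cst.
  rewrite big_cons; under eq_fun do rewrite big_cons.
  apply: (der_add _ IH); apply: der_scale.
  have := derive_cos_affine (kidx n i)%:~R 0 v.
  by under eq_fun do rewrite addr0.
exact: H.
Qed.

Lemma integral_fejer n x : (0 < n)%N ->
  (\int[mu]_(u in `[(- pi)%R, pi]) (fejer n (x - u))%:E = (2 * pi)%:E)%E.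
Proof.
move=> n0.
have pi0 := pi_gt0 R; have pp : - pi < pi :> R by lra.
have E u : fejer n (x - u) = \sum_(i < n.*2.+1)
   (0 + tent R n (kidx n i) * cos ((- kidx n i)%:~R * u + (kidx n i)%:~R * x)).
  apply: eq_bigr => i _; rewrite add0r; congr (_ * cos _).
  by rewrite mulrNz; ring.
under eq_integral => u _ do rewrite E -sumEFin.
rewrite integral_sum//; last first.
  move=> i; have cts : continuous (fun u : R => 0 + tent R n (kidx n i) *
      cos ((- kidx n i)%:~R * u + (kidx n i)%:~R * x)).
    exact: (is_derive_cont (fun z =>
      der_add (der_cst z 0) (der_scale _ (derive_cos_affine _ _ z)))).
  apply: continuous_compact_integrable; first exact: segment_compact.
  exact: continuous_subspaceT.
under eq_bigr => i _ do rewrite integral_cos.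
rewrite sumEFin; congr EFin.
have n1 : (n < n.*2.+1)%N by lia.
rewrite (bigD1 (Ordinal n1))//= big1 ?addr0.
  have -> : kidx n n = 0 by rewrite /kidx subrr.
  have t0 : tent R n 0 = 1.
    by rewrite tent_in// normr0 ?mul0r ?subr0.
  by rewrite oppr0 eqxx mul0r cos0 t0; by rewrite mulr0 add0r !mulr1.
move=> i; rewrite -val_eqE/= => hi.
have -> : (- kidx n i == 0) = false by rewrite /kidx; lia.
by rewrite !mulr0 addr0.
Qed.

End fejer.

Section multidim.
Variable R : realType.
Local Notation RT := (measurableTypeR R).
Notation mu := (@lebesgue_measure R).

Definition theta q (k : 'I_q -> int) (u : 'I_q -> R) : R := \sum_i (k i)%:~R * u i.

Lemma measurable_theta q (k : 'I_q -> int) (be : R) :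
  measurable_fun setT (fun u : q.-tuple RT => theta k (tnth u) + be).
Proof.
apply: measurable_funD => //; apply: measurable_sum => i.
by apply: measurable_funM => //; exact: measurable_tnth.
Qed.

Lemma measurable_cos_theta q (k : 'I_q -> int) (be : R) :
  measurable_fun setT (fun u : q.-tuple RT => cos (theta k (tnth u) + be)).
Proof.
apply: (measurableT_comp (f := @cos R)); last exact: measurable_theta.
by apply: continuous_measurable_fun; exact: continuous_cos.
Qed.

(* The constant 1 makes the integrand nonnegative, so that Tonelli's theorem applies. *)
Lemma integral_cell_cos q (k : 'I_q -> int) (be : R) :
  (\int[lebesgueq q]_(u in @cellT R q) (1 + cos (theta k (tnth u) + be))%:E =
   ((2 * pi) ^+ q * (1 + cos be * (\prod_i ((k i == 0)%:R : R))))%:E)%E.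
Proof.
elim: q k be => [|q IH] k be.
  rewrite /= integral_dirac; last 2 first.
  - exact: measurable_cellT.
  - apply/measurable_EFinP/measurable_funTS/measurable_funD => //.
    exact: measurable_cos_theta.
  rewrite /theta !big_ord0 add0r expr0 mul1r mulr1 diracE mem_set ?mul1e//.
  by apply/cellTE => -[].
rewrite integral_cellS; last 2 first.
- apply/measurable_EFinP/measurable_funD => //; exact: measurable_cos_theta.
- by move=> u; rewrite lee_fin; have := cos_geN1 (theta k (tnth u) + be); lra.
pose k' i := k (lift ord0 i).
transitivity (\int[mu]_(x in `[(- pi)%R, pi])
   ((2 * pi) ^+ q + ((2 * pi) ^+ q * \prod_i ((k' i == 0)%:R)) *
     cos ((k ord0)%:~R * x + be))%:E)%E.
  apply: eq_integral => x _.
  have tE (u : q.-tuple RT) : theta k (tnth (tcons (x, u))) + be =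
      theta k' (tnth u) + ((k ord0)%:~R * x + be).
    rewrite /theta big_ord_recl tnth_tcons0.
    under eq_bigr do rewrite tnth_tconsS.
    by ring.
  under eq_integral => u _ do rewrite tE.
  rewrite IH; congr EFin; ring.
rewrite integral_cos big_ord_recl; congr EFin; rewrite exprS; ring.
Qed.

Lemma lebesgueq_cell q : lebesgueq q (@cellT R q) = ((2 * pi) ^+ q)%:E.
Proof.
have -> : (2 * pi) ^+ q = \prod_(i < q) (2 * pi) :> R by rewrite prodr_const card_ord.
rewrite -(@integral_prod_cell R q (fun _ _ => 1) (fun _ => 2 * pi))//.
  under eq_integral do rewrite big1//.
  by rewrite integral_cst ?mul1e//; exact: measurable_cellT.
by move=> i; rewrite lebesgue_pipi mulr1.
Qed.

End multidim.

(** * Convolution with product kernels *)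
Section product_expansion.
Variable R : realType.
Implicit Types (x y v u N t : R) (k : int) (n a : nat).

Definition cis y : complex R := Complex (cos y) (sin y).

Lemma cisD y v : cis (y + v) = cis y * cis v.
Proof. by rewrite /cis cosD sinD; congr Complex; ring. Qed.

(* By hypothesis each factor equals the complex number \sum_j c i j * cis (ph i j). *)
Lemma prod_sum_cos (I J : finType) (c ph : I -> J -> R) :
  (forall i, \sum_j c i j * sin (ph i j) = 0) ->
  \prod_i \sum_j c i j * cos (ph i j) =
  \sum_(f : {ffun I -> J}) (\prod_i c i (f i)) * cos (\sum_i ph i (f i)).
Proof.
move=> h; pose rc : {rmorphism R -> complex R} := real_complex R.
have E : \prod_i \sum_j (rc (c i j) * cis (ph i j)) =
   rc (\prod_i \sum_j c i j * cos (ph i j)).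
  rewrite rmorph_prod; apply: eq_bigr => i _.
  transitivity (\sum_j (rc (c i j * cos (ph i j)) + Complex 0 (c i j * sin (ph i j)))).
    apply: eq_bigr => j _; rewrite /rc /cis /real_complex_def.
    by simpc.
  rewrite big_split/= -rmorph_sum [X in _ + X](_ : _ = 0) ?addr0//.
  have : forall s : seq J, \sum_(j <- s) Complex 0 (c i j * sin (ph i j)) =
     Complex 0 (\sum_(j <- s) c i j * sin (ph i j)).
    elim=> [|j s IH]; first by rewrite !big_nil.
    by rewrite !big_cons IH; simpc.
  by move=> ->; rewrite h.
have := congr1 (@complex.Re R) E.
rewrite bigA_distr_bigA/= => <-.
have ReS (s : seq {ffun I -> J}) (F : {ffun I -> J} -> complex R) :
   complex.Re (\sum_(f <- s) F f) = \sum_(f <- s) complex.Re (F f).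
  elim: s => [|f s IH]; first by rewrite !big_nil.
  by rewrite !big_cons -IH; case: (F f) => ? ?; case: (\sum_(_ <- _) _).
rewrite ReS; apply: eq_bigr => f _.
rewrite big_split/= -rmorph_prod.
have -> : \prod_i cis (ph i (f i)) = cis (\sum_i ph i (f i)).
  elim/big_rec2: _ => [|i z w _ ->]; last by rewrite cisD.
  by rewrite /cis cos0 sin0.
by rewrite /rc /cis; simpc.
Qed.

Lemma cos_nat_pi n : cos (n%:R * pi) = (-1) ^+ n :> R.
Proof.
elim: n => [|n IH]; first by rewrite mul0r cos0 expr0.
by rewrite -natr1 mulrDl mul1r cosDpi IH exprS mulN1r.
Qed.

Lemma kidx_rev n (i : 'I_n.*2.+1) : kidx n (rev_ord i) = - kidx n i.
Proof. by have := ltn_ord i; rewrite /kidx /=; lia. Qed.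

(** Replacing k by -k multiplies the coefficient by (-1)^a and the sine by -(-1)^a, so the sum is
    its own opposite. This is the hypothesis of [prod_sum_cos] for [kern]. *)
Lemma kern_sin n t a v :
  \sum_(i < n.*2.+1) kcoef n t a (kidx n i) *
    sin ((kidx n i)%:~R * v + a%:R * (pi / 2)) = 0.
Proof.
set S := LHS.
suff : S = - S by lra.
rewrite {1}/S (reindex_inj rev_ord_inj) -sumrN; apply: eq_bigr => i _.
rewrite kidx_rev; move: (kidx n i) => k.
have -> : (- k)%:~R * v + a%:R * (pi / 2) = a%:R * pi - (k%:~R * v + a%:R * (pi / 2)).
  by rewrite mulrNz; field.
rewrite sinB sin_nat_pi cos_nat_pi mul0r sub0r /kcoef tentN mulrNz.
rewrite sqrrN (exprNn k%:~R).
have : ((-1) ^+ a) * ((-1) ^+ a) = 1 :> R by rewrite -expr2 sqrr_sign.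
move: ((-1) ^+ a) => s hs.
transitivity (- (s * s) * (tent R n k * (k%:~R ^+ a * expR (- t * k%:~R ^+ 2)) *
  sin (k%:~R * v + a%:R * (pi / 2)))); first by ring.
by rewrite hs mulN1r.
Qed.

Definition kvec q n (f : {ffun 'I_q -> 'I_n.*2.+1}) (i : 'I_q) : int := kidx n (f i).

Definition kweight q n t (a : 'I_q -> nat) (k : 'I_q -> int) : R :=
  \prod_i kcoef n t (a i) (k i).

Lemma prod_kern q n t (a : 'I_q -> nat) (v : 'I_q -> R) :
  \prod_i kern n t (a i) (v i) =
  \sum_(f : {ffun 'I_q -> 'I_n.*2.+1}) kweight n t a (kvec f) *
     cos (\sum_i ((kvec f i)%:~R * v i + (a i)%:R * (pi / 2))).
Proof.
rewrite /kern (@prod_sum_cos 'I_q 'I_n.*2.+1 (fun i j => kcoef n t (a i) (kidx n j))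
  (fun i j => (kidx n j)%:~R * v i + (a i)%:R * (pi / 2)))//.
by move=> i; exact: kern_sin.
Qed.

Lemma kern00 n v : kern n 0 0 v = fejer n v.
Proof.
apply: eq_bigr => i _; rewrite /kcoef expr0 oppr0 !mul0r expR0 addr0.
by rewrite !mulr1.
Qed.

End product_expansion.

Section cosint.
Variables (R : realType) (q : nat).
Local Notation RT := (measurableTypeR R).
Implicit Types (Phi : q.-tuple RT -> R) (k : 'I_q -> int).

(* For [be] equal to 0 and pi / 2, these are the real and imaginary parts of a
   Fourier coefficient of [Phi], up to a sign and the factor (2 pi)^q. *)
Definition cosint Phi k (be : R) : R :=
  \int[lebesgueq q]_(u in @cellT R q) (Phi u * cos (theta k (tnth u) + be)).

Definition cell_integrable Phi := (lebesgueq q).-integrable (@cellT R q) (EFin \o Phi).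

Lemma cell_integrable_mul Phi (h : q.-tuple RT -> R) (B : R) : cell_integrable Phi ->
  measurable_fun setT h -> (forall u, `|h u| <= B) ->
  cell_integrable (fun u => Phi u * h u).
Proof.
move=> iP mh hB.
have := @integrableMl _ _ _ (lebesgueq q) (@cellT R q) (@measurable_cellT R q)
  (EFin \o Phi) h iP (measurable_funTS mh).
rewrite /cell_integrable (_ : EFin \o (fun u => (Phi u * h u)%R) = (EFin \o Phi) \* (EFin \o h))%E; last first.
  by apply/funext => u /=; rewrite EFinM.
apply; exists B; split; first exact: num_real.
by move=> M BM u _; apply: le_trans (hB u) (ltW BM).
Qed.

Lemma cell_integrable_cos Phi k (be : R) : cell_integrable Phi ->
  cell_integrable (fun u => Phi u * cos (theta k (tnth u) + be)).
Proof.
move=> iP; apply: (@cell_integrable_mul _ _ 1) => //.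
  exact: measurable_cos_theta.
by move=> u; rewrite ler_norml cos_geN1 cos_le1.
Qed.

Lemma cosint_phase Phi k (be : R) : cell_integrable Phi ->
  cosint Phi k be = cos be * cosint Phi k 0 + sin be * cosint Phi k (pi / 2).
Proof.
move=> iP; have mc := @measurable_cellT R q.
have i0 := cell_integrable_cos k 0 iP; have i1 := cell_integrable_cos k (pi / 2) iP.
rewrite /cosint -!RintegralZl// -RintegralD//; last 2 first.
- exact: (integrable_RZl mc _ i0).
- exact: (integrable_RZl mc _ i1).
apply: eq_Rintegral => u _; rewrite addr0 cosDpihalf cosD; ring.
Qed.

Lemma cosint_sum Phi (J : finType) (c be : J -> R) (k : J -> 'I_q -> int) :
  cell_integrable Phi ->
  \sum_j c j * cosint Phi (k j) (be j) =
  \int[lebesgueq q]_(u in @cellT R q)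
     (Phi u * \sum_j c j * cos (theta (k j) (tnth u) + be j)).
Proof.
move=> iP; have mc := @measurable_cellT R q.
have ij j := cell_integrable_cos (k j) (be j) iP.
transitivity (\sum_j \int[lebesgueq q]_(u in @cellT R q)
    (c j * (Phi u * cos (theta (k j) (tnth u) + be j)))).
  by apply: eq_bigr => j _; rewrite /cosint (RintegralZl _ mc (ij j)).
rewrite -Rintegral_sum//; last by move=> j; exact: (integrable_RZl mc _ (ij j)).
apply: eq_Rintegral => u _; rewrite mulr_sumr; apply: eq_bigr => j _; ring.
Qed.

(** The convolution theorem in real form: the product of kernels is expanded into cosines of x - u,
    which is where the negated frequencies come from. It turns finite sums of Fourier data into
    integrals that the pointwise kernel bounds control. *)
Lemma conv_kern Phi n (t : R) (a : 'I_q -> nat) (x : 'I_q -> R) :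
  cell_integrable Phi ->
  \sum_(f : {ffun 'I_q -> 'I_n.*2.+1}) kweight n t a (kvec f) *
    cosint Phi (fun i => - kvec f i)
      (\sum_i ((kvec f i)%:~R * x i + (a i)%:R * (pi / 2))) =
  \int[lebesgueq q]_(u in @cellT R q)
     (Phi u * \prod_i kern n t (a i) (x i - tnth u i)).
Proof.
move=> iP; rewrite cosint_sum//; apply: eq_Rintegral => u _; congr (_ * _).
rewrite prod_kern; apply: eq_bigr => f _; congr (_ * cos _).
rewrite /theta -big_split/=; apply: eq_bigr => i _.
by rewrite mulrNz; ring.
Qed.

End cosint.

(** * Integrals of L^p functions against products of peaks *)

Section Lp_bounds.
Variables (R : realType) (q : nat).
Local Notation RT := (measurableTypeR R).
Local Notation lam := (lebesgueq q).
Local Notation cT := (@cellT R q).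
Implicit Types (h : q.-tuple RT -> R) (p : \bar R) (B N r : R).

Lemma integral_prod_bump_le N (x : 'I_q -> R) : 0 < N ->
  (\int[lam]_(u in cT) (\prod_i bump N (x i) (tnth u i))%:E <= ((12 * pi) ^+ q)%:E)%E.
Proof.
move=> N0; have hle i := integral_bump_le (x i) N0.
have h0 i : (0 <= \int[lebesgue_measure]_(u in `[(- pi)%R, pi]) (bump N (x i) u)%:E)%E.
  by apply: integral_ge0 => u _; rewrite lee_fin bump_ge0// ltW.
rewrite (@integral_prod_cell R q (fun i => bump N (x i)) (fun i => fine
   (\int[lebesgue_measure]_(u in `[(- pi)%R, pi]) (bump N (x i) u)%:E)%E)).
- rewrite lee_fin -[X in _ ^+ X](card_ord q) -prodr_const; apply: ler_prod => i _.
  rewrite fine_ge0//= -lee_fin fineK ?hle// ge0_fin_numE//.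
  by apply: le_lt_trans (hle i) _; rewrite ltry.
- by move=> i; exact: measurable_bump.
- by move=> i u; apply: bump_ge0; exact: ltW.
- move=> i; rewrite fineK// ge0_fin_numE//.
  by apply: le_lt_trans (hle i) _; rewrite ltry.
Qed.

Lemma measurable_prod_bump N (x : 'I_q -> R) :
  measurable_fun setT (fun u : q.-tuple RT => \prod_i bump N (x i) (tnth u i)).
Proof.
apply: measurable_prod => i _.
exact: (measurableT_comp (measurable_bump N (x i)) (measurable_tnth i)).
Qed.

Lemma Lnorm_finP r h B : 1 <= r -> 0 <= B -> measurable_fun setT h ->
  (forall u, 0 <= h u) ->
  (Lnorm lam r%:E ((EFin \o h) \_ cT) <= B%:E)%E ->
  (\int[lam]_(u in cT) ((h u) `^ r)%:E <= (B `^ r)%:E)%E.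
Proof.
move=> r1 B0 mh h0.
have r0 : 0 < r by lra.
have E : (\int[lam]_u (`|((EFin \o h) \_ cT) u| `^ r) =
  \int[lam]_(u in cT) ((h u) `^ r)%:E)%E.
  rewrite [RHS]integral_mkcond; apply: eq_integral => u _; rewrite !patchE.
  case: ifPn => _; first by rewrite /= ger0_norm// poweR_EFin.
  by rewrite /= normr0 powR0// gt_eqF.
rewrite -E -poweR_Lnorm ?gt_eqF// -poweR_EFin => H.
apply: gt0_ler_poweR; [exact: ltW| | |exact: H].
  by rewrite in_itv/= leey andbT Lnorm_ge0.
by rewrite in_itv/= leey andbT lee_fin.
Qed.

(* Applied to z = h / (N^(q/p) B), this replaces Hoelder's inequality. *)
Lemma le_add1_powR r (z : R) : 1 <= r -> 0 <= z -> z <= 1 + z `^ r.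
Proof.
move=> r1 z0; have [z1|z1] := leP z 1; first by have := powR_ge0 z r; lra.
apply: (@le_trans _ _ (z `^ r)); last by rewrite lerDr.
by rewrite -{1}(powRr1 z0); apply: ler_powR => //; exact: ltW.
Qed.

(** For finite r put b = N^(q/r) B and use h <= b (1 + (h / b)^r). Against the product w of peaks,
    the first term contributes b times the mass (12 pi)^q; since w <= N^q, the second contributes at
    most b N^q b^(-r) B^r = b. For p = +oo the essential bound is integrated directly. *)
Lemma Lp_bump_bound p h B N (x : 'I_q -> R) : (1 <= p)%E -> 0 < B -> 1 <= N ->
  measurable_fun setT h -> (forall u, 0 <= h u) ->
  (Lnorm lam p ((EFin \o h) \_ cT) <= B%:E)%E ->
  (\int[lam]_(u in cT) (h u * \prod_i bump N (x i) (tnth u i))%:E <=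
     (((12 * pi) ^+ q + 1) * N `^ qdivp q p * B)%:E)%E.
Proof.
move=> p1 B0 N1 mh h0 hL; have N0 : 0 < N by lra.
have mc := @measurable_cellT R q.
pose w (u : q.-tuple RT) := \prod_i bump N (x i) (tnth u i).
have w0 u : 0 <= w u by apply: prodr_ge0 => i _; apply: bump_ge0; exact: ltW.
have wN u : w u <= N ^+ q.
  rewrite -[X in _ ^+ X](card_ord q) -prodr_const; apply: ler_prod => i _.
  by rewrite bump_ge0 ?bump_le// ltW.
have mw : measurable_fun setT w by exact: measurable_prod_bump.
have iw := integral_prod_bump_le x N0.
have pi0 := pi_gt0 R.
have c0 : 0 <= (12 * pi) ^+ q :> R by rewrite exprn_ge0// mulr_ge0// ltW.
have hw0 u : cT u -> (0 <= (h u * w u)%:E)%E by move=> _; rewrite lee_fin mulr_ge0.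
have mhw : measurable_fun cT (fun u => (h u * w u)%:E).
  by apply/measurable_EFinP/measurable_funTS/measurable_funM.
have mw' : measurable_fun cT (fun u => (w u)%:E).
  by apply/measurable_EFinP/measurable_funTS.
have hw0' u : cT u -> (0 <= (w u)%:E)%E by move=> _; rewrite lee_fin.
case: p p1 hL => [r| |]//.
- rewrite lee_fin => r1 hL; have r0 : 0 < r by lra.
  have hI := Lnorm_finP r1 (ltW B0) mh h0 hL.
  have -> : qdivp q r%:E = q%:R / r :> R.
    by rewrite /qdivp fine_invr.
  pose b := N `^ (q%:R / r) * B.
  have Np : 0 < N `^ (q%:R / r) by rewrite powR_gt0.
  have b0 : 0 < b by rewrite mulr_gt0.
  have br : N ^+ q * (b^-1 `^ r * B `^ r) = 1.
    rewrite /b -powRM ?invr_ge0 ?ltW// invfM -mulrA mulVf ?gt_eqF// mulr1.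
    rewrite -powRN -powRrM -mulNr mulfVK ?gt_eqF// powRN powR_mulrn ?ltW//.
    by rewrite divff// gt_eqF// exprn_gt0.
  have mhr : measurable_fun cT (fun u => ((h u) `^ r)%:E).
    apply/measurable_EFinP/measurable_funTS.
    by apply: (measurableT_comp (f := fun z : R => z `^ r)) => //; exact: measurable_powR.
  apply: (@le_trans _ _ (\int[lam]_(u in cT) (b%:E * (w u)%:E +
      (b * N ^+ q * b^-1 `^ r)%:E * ((h u) `^ r)%:E))%E).
    apply: ge0_le_integral => //.
    + by apply: emeasurable_funD; apply: emeasurable_funM.
    + move=> u _; rewrite -!EFinM -EFinD lee_fin.
      have hb := le_add1_powR r1 (mulr_ge0 (h0 u) (ltW (_ : 0 < b^-1))).
      have {}hb : h u <= b * (1 + (h u * b^-1) `^ r).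
        rewrite -ler_pdivrMl// mulrC; apply: hb; by rewrite invr_gt0.
      apply: (le_trans (ler_wpM2r (w0 u) hb)).
      have bi0 : 0 <= b^-1 by rewrite invr_ge0 ltW.
      rewrite (powRM _ (h0 u) bi0).
      have p0 : 0 <= b * (h u `^ r * b^-1 `^ r).
        by apply: mulr_ge0; [exact: ltW|rewrite mulr_ge0 ?powR_ge0].
      by have := ler_wpM2l p0 (wN u); lra.
  have d0 : (0 <= (b * N ^+ q * b^-1 `^ r)%:E)%E.
    by rewrite lee_fin; repeat apply: mulr_ge0; rewrite ?powR_ge0 ?exprn_ge0//; exact: ltW.
  have b0' : (0 <= b%:E)%E by rewrite lee_fin ltW.
  have hr0 u : cT u -> (0 <= ((h u) `^ r)%:E)%E by move=> _; rewrite lee_fin powR_ge0.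
  have mbw : measurable_fun cT (fun u => b%:E * (w u)%:E)%E by exact: emeasurable_funM.
  have mbh : measurable_fun cT
      (fun u => (b * N ^+ q * b^-1 `^ r)%:E * ((h u) `^ r)%:E)%E.
    exact: emeasurable_funM.
  rewrite (ge0_integralD _ mc _ mbw _ mbh); last 2 first.
  + by move=> u cu; apply: mule_ge0 => //; exact: hw0'.
  + by move=> u cu; apply: mule_ge0 => //; exact: hr0.
  rewrite (ge0_integralZl _ mc mw' hw0' b0') (ge0_integralZl _ mc mhr hr0 d0).
  apply: (@le_trans _ _ (b%:E * ((12 * pi) ^+ q)%:E +
     (b * N ^+ q * b^-1 `^ r)%:E * (B `^ r)%:E)%E).
    by apply: leeD; apply: lee_wpmul2l.
  rewrite -!EFinM -EFinD lee_fin -[_ * _ * B]mulrA -/b.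
  have -> : b * N ^+ q * b^-1 `^ r * B `^ r = b * (N ^+ q * (b^-1 `^ r * B `^ r)) by ring.
  by rewrite br; lra.
- move=> _ hL; rewrite /qdivp invey /= mulr0 powRr0 mulr1.
  (* The norm is an essential supremum only if the space has positive measure; in the other case the
     whole space is negligible and the claim holds trivially. *)
  have ae : \forall u \ae lam, ((abse \o ((EFin \o h) \_ cT)) u <= B%:E)%E.
    move: hL; rewrite unlock; case: ifPn => [_ /ess_supP//|].
    rewrite -leNgt => m0 _; exists setT; split => //.
    by apply/eqP; rewrite -measure_le0.
  have B0' : (0 <= B%:E)%E by rewrite lee_fin ltW.
  have mBw : measurable_fun cT (fun u => B%:E * (w u)%:E)%E by exact: emeasurable_funM.
  have hBw0 u : cT u -> (0 <= B%:E * (w u)%:E)%E.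
    by move=> cu; apply: mule_ge0 => //; exact: hw0'.
  apply: (@le_trans _ _ (\int[lam]_(u in cT) (B%:E * (w u)%:E))%E).
    apply: ae_ge0_le_integral => //.
    apply: filterS ae => u /= hu cu; rewrite -EFinM lee_fin.
    apply: ler_wpM2r; first exact: w0.
    by move: hu; rewrite patchE mem_set// /= lee_fin ger0_norm.
  rewrite (ge0_integralZl _ mc mw' hw0' B0').
  apply: (@le_trans _ _ (B%:E * ((12 * pi) ^+ q)%:E)%E).
    by apply: lee_wpmul2l.
  by rewrite -EFinM lee_fin; nra.
Qed.

End Lp_bounds.

(** * Fourier coefficients of complex functions in real form *)

Section fourier_relation.
Variables (R : realType) (q : nat).
Local Notation RT := (measurableTypeR R).
Local Notation C := (complex R).
Local Notation point := 'rV[R]_q.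
Local Notation normc := ComplexField.Normc.normc.
Local Notation lam := (lebesgueq q).
Local Notation cT := (@cellT R q).
Implicit Types (f g phi : point -> C) (p : \bar R) (s : R) (k : 'I_q -> int).

Definition ReT f (u : q.-tuple RT) : R := complex.Re (f (torow u)).
Definition ImT f (u : q.-tuple RT) : R := complex.Im (f (torow u)).

Lemma Re_le_normc (z : C) : `|complex.Re z| <= normc z.
Proof.
case: z => a b /=; rewrite -sqrtr_sqr ler_wsqrtr// lerDl sqr_ge0 //.
Qed.

Lemma Im_le_normc (z : C) : `|complex.Im z| <= normc z.
Proof.
case: z => a b /=; rewrite -sqrtr_sqr ler_wsqrtr// lerDr sqr_ge0 //.
Qed.

Lemma normc_le_ReIm (z : C) : normc z <= `|complex.Re z| + `|complex.Im z|.
Proof.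
case: z => a b /=.
rewrite -[leRHS]ger0_norm ?addr_ge0// -sqrtr_sqr ler_wsqrtr//.
rewrite -(real_normK (num_real a)) -(real_normK (num_real b)).
by have := normr_ge0 a; have := normr_ge0 b; nra.
Qed.

Lemma measurable_normc p f : Lp p f ->
  measurable_fun setT (fun u : q.-tuple RT => normc (f (torow u))).
Proof.
move=> [_ mR mI _].
rewrite (_ : (fun u : q.-tuple RT => normc (f (torow u))) =
  fun u => Num.sqrt (complex.Re (f (torow u)) ^+ 2 + complex.Im (f (torow u)) ^+ 2)).
  apply: (measurableT_comp (f := @Num.sqrt R)).
    by apply: continuous_measurable_fun; exact: sqrt_continuous.
  by apply: measurable_funD; apply: measurable_funX.
by apply/funext => u; case: (f _).
Qed.

Lemma LpnormE p f : Lpnorm p f =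
  Lnorm lam p ((EFin \o (fun u : q.-tuple RT => normc (f (torow u)))) \_ cT).
Proof. by []. Qed.

(** [Lp_bump_bound] with N = 1 and center 0: each peak is then at least 1/2, so 2^q times their
    product is at least 1. The bound is the norm plus 1 in order to be positive. *)
Lemma Lp_integrable p f (F : q.-tuple RT -> R) : (1 <= p)%E -> Lp p f ->
  measurable_fun setT F -> (forall u, `|F u| <= normc (f (torow u))) ->
  cell_integrable F.
Proof.
move=> p1 Lf mF Fh; have mh := measurable_normc Lf; have [_ _ _ fin] := Lf.
have mc := @measurable_cellT R q.
set h := fun u : q.-tuple RT => normc (f (torow u)) in mh.
have h0 u : 0 <= h u by apply: le_trans (Fh u).
have n0 : (0 <= Lpnorm p f)%E by rewrite LpnormE Lnorm_ge0.
have fn : Lpnorm p f \is a fin_num by rewrite ge0_fin_numE.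
have B0 : 0 < fine (Lpnorm p f) + 1 by rewrite ltr_wpDl// fine_ge0.
have hL : (Lnorm lam p ((EFin \o h) \_ cT) <= (fine (Lpnorm p f) + 1)%:E)%E.
  by rewrite -LpnormE EFinD fineK// leeDl.
have H := Lp_bump_bound (fun _ : 'I_q => 0) p1 B0 (lexx 1) mh h0 hL.
have hw0 u : (0 <= (h u * \prod_(i < q) bump 1 0 (tnth u i))%:E)%E.
  by rewrite lee_fin mulr_ge0// prodr_ge0// => i _; exact: bump_ge0.
have p2 : (0 <= (2 ^+ q : R)%:E)%E by rewrite lee_fin exprn_ge0.
have mhw : measurable_fun cT
    (fun u => (h u * \prod_(i < q) bump 1 0 (tnth u i))%:E).
  apply/measurable_EFinP/measurable_funTS/measurable_funM => //.
  exact: (measurable_prod_bump 1 (fun _ => 0)).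
apply/integrableP; split; first by apply/measurable_EFinP/measurable_funTS.
apply: (@le_lt_trans _ _ (\int[lam]_(u in cT) ((2 ^+ q)%:E *
  (h u * \prod_(i < q) bump 1 0 (tnth u i))%:E))%E).
  have m1 : measurable_fun cT (fun u => `|(EFin \o F) u|)%E.
    by apply: measurableT_comp => //; apply/measurable_EFinP/measurable_funTS.
  have m2 : measurable_fun cT (fun u => (2 ^+ q)%:E *
      (h u * \prod_(i < q) bump 1 0 (tnth u i))%:E)%E.
    exact: emeasurable_funM.
  apply: ge0_le_integral => //.
  move=> u _; rewrite -EFinM lee_fin mulrCA.
  apply: le_trans (Fh u) _; rewrite -[leLHS]mulr1; apply: ler_wpM2l; first exact: h0.
  rewrite -[X in _ ^+ X](card_ord q) -prodr_const -big_split/=.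
  apply: (@le_trans _ _ (\prod_(i < q) 1)); first by rewrite big1.
  apply: ler_prod => i _; rewrite ler01/= /bump expr1n !mul1r.
  have := cos2Dsin2 ((0 - tnth u i) / 2 : R); have := sqr_ge0 (cos ((0 - tnth u i) / 2 : R)).
  have := sqr_ge0 (sin ((0 - tnth u i) / 2 : R)).
  move: (sin _ ^+ 2) (cos _ ^+ 2) => a b a0 b0 ab.
  by rewrite ler_pdivlMr; lra.
rewrite (ge0_integralZl _ mc mhw (fun u _ => hw0 u) p2).
apply: le_lt_trans (_ : (_ <= (2 ^+ q)%:E * (((12 * pi) ^+ q + 1) *
   1 `^ qdivp q p * (fine (Lpnorm p f) + 1))%:E)%E) _.
  exact: lee_wpmul2l.
by rewrite -EFinM ltry.
Qed.

Lemma integrable_ReT p f : (1 <= p)%E -> Lp p f -> cell_integrable (ReT f).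
Proof.
move=> p1 Lf; apply: (Lp_integrable p1 Lf); last by move=> u; exact: Re_le_normc.
by case: Lf.
Qed.

Lemma integrable_ImT p f : (1 <= p)%E -> Lp p f -> cell_integrable (ImT f).
Proof.
move=> p1 Lf; apply: (Lp_integrable p1 Lf); last by move=> u; exact: Im_le_normc.
by case: Lf.
Qed.

Lemma cosintN0 (Phi : q.-tuple RT -> R) k :
  cosint Phi (fun i => - k i) 0 = cosint Phi k 0.
Proof.
apply: eq_Rintegral => u _; congr (_ * _); rewrite !addr0 -cosN; congr cos.
by rewrite /theta -sumrN; apply: eq_bigr => i _; rewrite mulrNz; ring.
Qed.

Lemma cosintN1 (Phi : q.-tuple RT -> R) k : cell_integrable Phi ->
  cosint Phi (fun i => - k i) (pi / 2) = - cosint Phi k (pi / 2).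
Proof.
move=> iP; rewrite -mulN1r /cosint -RintegralZl//; last 2 first.
- exact: measurable_cellT.
- exact: cell_integrable_cos.
apply: eq_Rintegral => u _; rewrite !cosDpihalf.
have -> : theta (fun i => - k i) (tnth u) = - theta k (tnth u).
  by rewrite /theta -sumrN; apply: eq_bigr => i _; rewrite mulrNz; ring.
by rewrite sinN; ring.
Qed.

Lemma fourierE p f (k : 'rV[int]_q) : (1 <= p)%E -> Lp p f ->
  let k' := fun i => - k 0 i in
  fourier f k = Complex ((2 * pi) ^- q * (cosint (ReT f) k' 0 + cosint (ImT f) k' (pi / 2)))
                  ((2 * pi) ^- q * (cosint (ImT f) k' 0 - cosint (ReT f) k' (pi / 2))).
Proof.
move=> p1 Lf k'; have iR := integrable_ReT p1 Lf; have iI := integrable_ImT p1 Lf.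
have mc := @measurable_cellT R q.
have iR0 := cell_integrable_cos k' 0 iR; have iR1 := cell_integrable_cos k' (pi / 2) iR.
have iI0 := cell_integrable_cos k' 0 iI; have iI1 := cell_integrable_cos k' (pi / 2) iI.
have eE (u : q.-tuple RT) : expi (- k) (torow u) =
    Complex (cos (theta k' (tnth u))) (sin (theta k' (tnth u))).
  rewrite /expi (_ : \sum_i _ = theta k' (tnth u))//.
  by apply: eq_bigr => i _; rewrite !mxE.
rewrite /fourier /integral_cell.
have -> : \int[lam]_(u in torow @^-1` cell) complex.Re (f (torow u) * expi (- k) (torow u)) =
    cosint (ReT f) k' 0 + cosint (ImT f) k' (pi / 2).
  rewrite /cosint -RintegralD//; apply: eq_Rintegral => u _.
  rewrite eE cosDpihalf addr0 /ReT /ImT; case: (f _) => a b /=; ring.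
have -> : \int[lam]_(u in torow @^-1` cell) complex.Im (f (torow u) * expi (- k) (torow u)) =
    cosint (ImT f) k' 0 - cosint (ReT f) k' (pi / 2).
  rewrite /cosint -RintegralB//; apply: eq_Rintegral => u _.
  rewrite eE cosDpihalf addr0 /ReT /ImT; case: (f _) => a b /=; ring.
by simpc.
Qed.

Definition bweight s k : R := (\sum_i (k i)%:~R ^+ 2 + 1) `^ (s / 2).

Lemma weightE s (k : 'rV[int]_q) : weight s k = Complex (bweight s (fun i => k 0 i)) 0.
Proof.
rewrite /weight /bweight /enorm sqr_sqrtr; last by apply: sumr_ge0 => i _; exact: sqr_ge0.
by congr (Complex (_ `^ _) 0); congr (_ + _); apply: eq_bigr => i _; rewrite mxE.
Qed.

Lemma bweightN s k : bweight s (fun i => - k i) = bweight s k.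
Proof.
by congr ((_ + _) `^ _); apply: eq_bigr => i _; rewrite mulrNz sqrrN.
Qed.

(** A complex relation at one frequency mixes the two parts of f. The relation at -k has the same
    weight, while the cosine integrals are even and the sine integrals odd in k; sums and
    differences of the two relations separate the four real identities, and [cosint_phase] gives
    every phase. *)
Lemma cosint_sderiv p s f g k : (1 <= p)%E -> Lp p f -> Lp p g ->
  (forall k : 'rV[int]_q, fourier g k = weight s k * fourier f k) ->
  forall be, cosint (ReT g) k be = bweight s k * cosint (ReT f) k be /\
             cosint (ImT g) k be = bweight s k * cosint (ImT f) k be.
Proof.
move=> p1 Lf Lg H be.
have iRf := integrable_ReT p1 Lf; have iIf := integrable_ImT p1 Lf.
have iRg := integrable_ReT p1 Lg; have iIg := integrable_ImT p1 Lg.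
have c0 : (2 * pi) ^- q != 0 :> R.
  by rewrite invr_eq0 expf_neq0// mulf_neq0// gt_eqF// pi_gt0.
have eqs k' : let w := bweight s k' in
    cosint (ReT g) k' 0 + cosint (ImT g) k' (pi / 2) =
      w * (cosint (ReT f) k' 0 + cosint (ImT f) k' (pi / 2)) /\
    cosint (ImT g) k' 0 - cosint (ReT g) k' (pi / 2) =
      w * (cosint (ImT f) k' 0 - cosint (ReT f) k' (pi / 2)).
  have kE : k' = fun i => - (\row_i (- k' i) : 'rV[int]_q) 0 i.
    by apply/funext => i; rewrite mxE opprK.
  have := H (\row_i (- k' i)); rewrite (fourierE _ p1 Lf) (fourierE _ p1 Lg) weightE.
  rewrite -kE (_ : bweight s _ = bweight s k'); last first.
    by rewrite -[RHS]bweightN; congr bweight; apply/funext => i; rewrite mxE.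
  simpc => -[h1 h2]; split; apply: (mulfI c0); rewrite ?h1 ?h2; ring.
have [e1 e2] := eqs k; have [e3 e4] := eqs (fun i => - k i).
move: e3 e4; rewrite bweightN !cosintN0 !cosintN1// => e3 e4.
rewrite !(cosint_phase k be)//.
have r0 : cosint (ReT g) k 0 = bweight s k * cosint (ReT f) k 0 by lra.
have i1 : cosint (ImT g) k (pi / 2) = bweight s k * cosint (ImT f) k (pi / 2) by lra.
have i0 : cosint (ImT g) k 0 = bweight s k * cosint (ImT f) k 0 by lra.
have r1 : cosint (ReT g) k (pi / 2) = bweight s k * cosint (ReT f) k (pi / 2) by lra.
by rewrite r0 i1 i0 r1; split; ring.
Qed.

End fourier_relation.

(** * Lagrange interpolation along a coordinate line *)
Section lagrange.
Variable R : realType.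
Implicit Types (c r de D : R) (G : nat -> R -> R).

Lemma derive_bound_abs (f df : R -> R) (D x y : R) :
  (forall z : R, is_derive z 1 f (df z)) ->
  (forall z, `|z - x| <= `|y - x| -> `|df z| <= D) -> `|f y - f x| <= D * `|y - x|.
Proof.
move=> hf hD; have [xy|yx] := leP x y.
  rewrite (ger0_norm (x := y - x)) ?subr_ge0//.
  apply: (derive_bound_diff xy hf) => z /andP[z1 z2]; apply: hD.
  by rewrite !ger0_norm ?subr_ge0//; lra.
rewrite distrC (distrC y x) (ger0_norm (x := x - y)) ?subr_ge0 ?(ltW yx)//.
apply: (derive_bound_diff (ltW yx) hf) => z /andP[z1 z2]; apply: hD.
by rewrite !ler0_norm ?subr_le0 ?(ltW yx)//; lra.
Qed.

(** By induction on m: the derivative of the remainder is the remainder of order m for the shifted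
    family of derivatives, and the mean value theorem adds one factor |r - c|. The factorial in the
    sharp bound is given up. *)
Lemma taylor_bound m G D c : (forall j (r : R), is_derive r 1 (G j) (G j.+1 r)) ->
  (forall r, `|G m r| <= D) ->
  forall r, `|G 0%N r - \sum_(j < m) G j c * ((r - c) ^+ j / j`!%:R)| <= D * `|r - c| ^+ m.
Proof.
elim: m G => [|m IH] G hG hD r.
  by rewrite big_ord0 subr0 expr0 mulr1.
pose H z := G 0%N z - \sum_(j < m.+1) G j c * ((z - c) ^+ j / j`!%:R).
pose dH z := G 1%N z - \sum_(j < m) G j.+1 c * ((z - c) ^+ j / j`!%:R).
have dHE (z : R) : is_derive z 1 H (dH z).
  have dz : is_derive z 1 (fun z : R => z - c) (1 + 0) :=
    der_add (der_id z) (der_cst z (- c)).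
  have S (k : nat) : is_derive z 1
      (fun z : R => \sum_(j < k) G j.+1 c * ((z - c) ^+ j.+1 / j.+1`!%:R))
      (\sum_(j < k) G j.+1 c * ((z - c) ^+ j / j`!%:R)).
    elim: k => [|k IHk].
      by rewrite big_ord0; under eq_fun do rewrite big_ord0; exact: der_cst.
    rewrite big_ord_recr; under eq_fun do rewrite big_ord_recr/=.
    apply: (der_add IHk); apply: der_scale.
    have h := der_mul (@der_comp _ (fun z => z ^+ k.+1) _ z _ _ (der_X k.+1 _) dz)
      (der_cst z (k.+1`!%:R^-1)).
    apply: (is_derive_eq h); rewrite factS natrM addr0 mulr0 add0r mulr1 /=.
    have k1 : k.+1%:R != 0 :> R by rewrite pnatr_eq0.
    have k2 : k`!%:R != 0 :> R by rewrite pnatr_eq0 -lt0n fact_gt0.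
    move: (k.+1%:R) (k`!%:R) k1 k2 => a b k1 k2.
    by field; rewrite k1 k2.
  have h := der_add (der_add (hG 0%N z) (der_cst z (-1 * G 0%N c)))
    (der_scale (-1) (S m)).
  rewrite (_ : (fun z => _) = H) in h; first by apply: (is_derive_eq h); rewrite addr0 mulN1r.
  apply/funext => w; rewrite /H big_ord_recl/= fact0 expr0 divr1 mulr1.
  by rewrite !mulN1r; ring.
have H0 : H c = 0.
  rewrite /H big_ord_recl/= subrr expr0 fact0 divr1 mulr1 big1 ?addr0 ?subrr// => i _.
  by rewrite exprS !mul0r mulr0.
have D0 : 0 <= D by apply: le_trans (hD 0).
have IHz z := IH (fun j => G j.+1) (fun j => hG j.+1) hD z.
have := @derive_bound_abs H dH (D * `|r - c| ^+ m) c r dHE.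
rewrite H0 subr0 exprSr mulrA; apply=> z hz.
apply: le_trans (IHz z) _; apply: ler_wpM2l => //.
by apply: lerXn2r; rewrite ?nnegrE.
Qed.

(** Induction along Horner's scheme. The radius is 2 because arguments range over a box of twice the
    size, measured in units of de. *)
Lemma poly_lipschitz (p : {poly R}) : exists K : R, 0 <= K /\
  forall a b, `|a| <= 2 -> `|b| <= 2 -> `|p.[a]| <= K /\ `|p.[a] - p.[b]| <= K * `|a - b|.
Proof.
elim/poly_ind: p => [|p c [K [K0 hK]]].
  by exists 0; split=> // a b _ _; rewrite !horner0 subrr normr0 mul0r.
exists (3 * K + `|c|); split; first by rewrite addr_ge0 ?mulr_ge0.
move=> a b ha hb; have [h1 h2] := hK a b ha hb; rewrite !hornerE.
have pa := normr_ge0 p.[a]; have na := normr_ge0 a; have nb := normr_ge0 b.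
split.
  by apply: le_trans (ler_normD _ _) _; rewrite lerD2r normrM; nra.
rewrite (_ : _ - _ = p.[a] * (a - b) + (p.[a] - p.[b]) * b); last by ring.
apply: le_trans (ler_normD _ _) _; rewrite !normrM.
have nab := normr_ge0 (a - b); have nc := normr_ge0 c.
have q1 : `|p.[a]| * `|a - b| <= K * `|a - b| by apply: ler_wpM2r.
have q2 : `|p.[a] - p.[b]| * `|b| <= K * `|a - b| * 2 by apply: ler_pM.
have q3 : 0 <= `|c| * `|a - b| by apply: mulr_ge0.
by lra.
Qed.

(** The first node is 0, so the base point itself is a node; for m = 1 the interpolant is the
    constant value there. All nodes lie in [0, 1], hence inside the undoubled box. *)
Definition lnode m (j : 'I_m) : R := j%:R / m%:R.

Lemma lnode_inj m : (0 < m)%N -> injective (@lnode m).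
Proof.
move=> m0 i j /(mulIf (_ : m%:R^-1 != 0)).
rewrite invr_eq0 pnatr_eq0 -lt0n m0 => /(_ isT)/eqP.
by rewrite eqr_nat => /eqP /val_inj.
Qed.

Lemma lnode_itv m (j : 'I_m) : 0 <= lnode j <= 1.
Proof.
have m0 : (0 < m)%N by case: j => j /= /(leq_ltn_trans (leq0n _)).
rewrite /lnode divr_ge0//= ler_pdivrMr ?ltr0n// mul1r ler_nat.
exact: ltnW.
Qed.

Definition lpoly m (j : 'I_m) : {poly R} :=
  \prod_(i < m | i != j) ((lnode j - lnode i)^-1 *: ('X - (lnode i)%:P)).

Lemma lpolyE m (j i : 'I_m) : (0 < m)%N -> (lpoly j).[lnode i] = (i == j)%:R.
Proof.
move=> m0; rewrite /lpoly horner_prod; have [->|ij] := eqVneq i j.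
  rewrite big1// => k kj; rewrite !hornerE mulVf// subr_eq0.
  by apply: contra kj => /eqP/(lnode_inj m0)->.
by rewrite (bigD1 i)//= !hornerE subrr mulr0 mul0r.
Qed.

Lemma size_lpoly m (j : 'I_m) : (size (lpoly j) <= m)%N.
Proof.
rewrite /lpoly.
have H (s : seq 'I_m) : (size (\prod_(i <- s | i != j)
    ((lnode j - lnode i)^-1 *: ('X - (lnode i)%:P)))%R <=
    (count (fun i => i != j) s).+1)%N.
  elim: s => [|i s IH]; first by rewrite big_nil size_poly1.
  rewrite big_cons /=; case: ifPn => // ij; rewrite add1n.
  apply: leq_trans (size_polyMleq _ _) _.
  have h : (size ((lnode j - lnode i)^-1 *: ('X - (lnode i)%:P)) <= 2)%N.
    by apply: leq_trans (size_scale_leq _ _) _; rewrite size_XsubC.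
  apply: (@leq_trans (2 + (count (fun i => i != j) s).+1).-1)%N => //.
  by rewrite -!subn1 leq_sub2r// leq_add.
apply: leq_trans (H _) _.
have m0 : (0 < m)%N by case: j {H} => j /= /(leq_ltn_trans (leq0n _)).
have -> : count (fun i => i != j) (index_enum 'I_m) = #|predC1 j|.
  by rewrite cardE /enum_mem size_filter.
by rewrite cardC1 card_ord prednK.
Qed.

(** The difference of the two sides is a polynomial of degree less than m that vanishes at the m
    distinct nodes. *)
Lemma lagrange_exact m l (z : R) : (l < m)%N ->
  \sum_(j < m) (lpoly j).[z] * lnode j ^+ l = z ^+ l.
Proof.
move=> lm; have m0 : (0 < m)%N by exact: leq_ltn_trans lm.
pose P : {poly R} := \sum_(j < m) (lnode j ^+ l) *: lpoly j - 'X^l.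
suff P0 : P = 0.
  have := congr1 (fun p => p.[z]) P0.
  rewrite /P hornerD hornerN horner_sum hornerXn horner0 => /eqP.
  rewrite subr_eq0 => /eqP <-; apply: eq_bigr => j _.
  by rewrite hornerZ mulrC.
apply: (@roots_geq_poly_eq0 _ _ [seq lnode j | j <- enum 'I_m]).
- apply/allP => w /mapP[i _ ->]; apply/rootP.
  rewrite /P hornerD hornerN horner_sum hornerXn (bigD1 i)//=.
  rewrite hornerZ lpolyE// eqxx mulr1 big1 ?addr0 ?subrr// => j ji.
  by rewrite hornerZ lpolyE// eq_sym (negPf ji) mulr0.
- by rewrite map_inj_uniq ?enum_uniq//; exact: lnode_inj.
- rewrite size_map size_enum_ord; apply: leq_trans (size_polyD _ _) _.
  rewrite size_polyN size_polyXn geq_max lm andbT.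
  apply: leq_trans (size_sum _ _ _) _; apply/bigmax_leqP => j _.
  by apply: leq_trans (size_scale_leq _ _) _; exact: size_lpoly.
Qed.

Lemma lpoly_lipschitz m : exists K : R, 0 <= K /\ forall (j : 'I_m) a b,
  `|a| <= 2 -> `|b| <= 2 ->
  `|(lpoly j).[a]| <= K /\ `|(lpoly j).[a] - (lpoly j).[b]| <= K * `|a - b|.
Proof.
have [f hf] := choice (fun j : 'I_m => poly_lipschitz (lpoly j)).
exists (\sum_j f j); split; first by apply: sumr_ge0 => j _; have [] := hf j.
move=> j a b ha hb; have [h1 h2] := (hf j).2 a b ha hb.
have hj : f j <= \sum_j f j.
  by rewrite (bigD1 j)//= lerDl; apply: sumr_ge0 => i _; have [] := hf i.
split; first exact: le_trans hj.
by apply: le_trans h2 _; apply: ler_wpM2r.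
Qed.

(** Interpolation reproduces the Taylor polynomial of degree below m, so the error only sees the
    Taylor remainder: once at r, and once at each of the m nodes with a weight at most K. *)
Lemma lagrange_bound m K : (0 < m)%N -> 0 <= K ->
  (forall (j : 'I_m) a, `|a| <= 2 -> `|(lpoly j).[a]| <= K) ->
  forall G D c de r, 0 < de ->
  (forall j (r : R), is_derive r 1 (G j) (G j.+1 r)) ->
  (forall r, `|G m r| <= D) -> `|r - c| <= 2 * de ->
  `|G 0%N r - \sum_(j < m) (lpoly j).[(r - c) / de] * G 0%N (c + de * lnode j)| <=
    (1 + m%:R * K) * (2 * de) ^+ m * D.
Proof.
move=> m0 K0 hK G D c de r de0 hG hD hr.
have D0 : 0 <= D by apply: le_trans (hD 0).
pose T z := \sum_(j < m) G j c * ((z - c) ^+ j / j`!%:R).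
have hT z : `|z - c| <= 2 * de -> `|G 0%N z - T z| <= D * (2 * de) ^+ m.
  move=> hz; apply: le_trans (taylor_bound c hG hD z) _.
  apply: ler_wpM2l => //; apply: lerXn2r; rewrite ?nnegrE//.
  by rewrite mulr_ge0// ltW.
have TE : T r = \sum_(j < m) (lpoly j).[(r - c) / de] * T (c + de * lnode j).
  rewrite /T; under [RHS]eq_bigr do rewrite mulr_sumr.
  rewrite exchange_big/=; apply: eq_bigr => l _.
  have := lagrange_exact ((r - c) / de) (ltn_ord l) => E.
  have -> : (r - c) ^+ l = de ^+ l * ((r - c) / de) ^+ l.
    by rewrite -exprMn mulrC mulfVK// gt_eqF.
  rewrite -E mulr_sumr mulr_suml mulr_sumr; apply: eq_bigr => j _.
  have -> : c + de * lnode j - c = de * lnode j by ring.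
  have -> : (de * lnode j) ^+ l = de ^+ l * lnode j ^+ l by exact: exprMn.
  by ring.
have -> : G 0%N r - \sum_(j < m) (lpoly j).[(r - c) / de] * G 0%N (c + de * lnode j) =
  (G 0%N r - T r) - \sum_(j < m) (lpoly j).[(r - c) / de] *
     (G 0%N (c + de * lnode j) - T (c + de * lnode j)).
  under [in RHS]eq_bigr do rewrite mulrBr.
  by rewrite sumrB -TE; ring.
apply: le_trans (ler_normB _ _) _.
have -> : (1 + m%:R * K) * (2 * de) ^+ m * D =
  D * (2 * de) ^+ m + \sum_(j < m) K * (D * (2 * de) ^+ m).
  by rewrite sumr_const card_ord -mulr_natl; ring.
apply: lerD; first exact: hT.
apply: le_trans (ler_norm_sum _ _ _) _; apply: ler_sum => j _.
rewrite normrM; apply: ler_pM => //.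
  by apply: hK; rewrite normrM normfV (gtr0_norm de0) ler_pdivrMr.
apply: hT; have /andP[t0 t1] := lnode_itv j.
by rewrite addrC addKr ger0_norm ?mulr_ge0// ?ltW//; nra.
Qed.

End lagrange.

(** * Pointwise convergence of Fejer means *)

Section korovkin.
Variables (R : realType) (q : nat).
Local Notation RT := (measurableTypeR R).
Local Notation point := 'rV[R]_q.
Local Notation lam := (lebesgueq q).
Local Notation cT := (@cellT R q).
Implicit Types (F : point -> R) (x : point).

Lemma cell_integrable_bounded (h : q.-tuple RT -> R) (B : R) :
  measurable_fun setT h -> (forall u, `|h u| <= B) -> cell_integrable h.
Proof.
move=> mh hB; apply: measurable_bounded_integrable.
- exact: measurable_cellT.
- exact: (eq_ind_r (fun z => (z < +oo)%E) (ltry _) (@lebesgueq_cell R q)).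
- exact: measurable_funTS.
- exists B; split; first exact: num_real.
  by move=> M BM u _; apply: le_trans (hB u) (ltW BM).
Qed.

Lemma Rintegral_prod_cell (w : 'I_q -> R -> R) (c : 'I_q -> R) :
  (forall i, measurable_fun setT (w i)) -> (forall i u, 0 <= w i u) ->
  (forall i, \int[@lebesgue_measure R]_(u in `[(- pi)%R, pi]) (w i u)%:E = (c i)%:E)%E ->
  \int[lam]_(u in cT) (\prod_i w i (tnth u i)) = \prod_i c i.
Proof. by move=> mw w0 hc; rewrite /Rintegral (integral_prod_cell mw w0 hc). Qed.

Lemma measurable_fejer n (y : R) : measurable_fun setT (fun u : R => fejer n (y - u)).
Proof.
apply: (measurableT_comp (f := @fejer R n)).
  by apply: continuous_measurable_fun; exact: fejer_cont.
by apply: measurable_funB.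
Qed.

Lemma fejer_bound n (v : R) : `|fejer n v| <= n.*2.+1%:R.
Proof.
apply: le_trans (ler_norm_sum _ _ _) _.
rewrite -[leRHS]mulr1 mulr_natl -[X in _ *+ X]card_ord -sumr_const.
apply: ler_sum => i _; rewrite normrM -[leRHS]mul1r; apply: ler_pM => //.
  by rewrite ger0_norm ?tent_ge0 ?tent_le1.
by rewrite ler_norml cos_geN1 cos_le1.
Qed.

Lemma measurable_prod_fejer n x :
  measurable_fun setT (fun u : q.-tuple RT => \prod_i fejer n (x 0 i - tnth u i)).
Proof.
apply: measurable_prod => i _.
exact: (measurableT_comp (measurable_fejer n (x 0 i)) (measurable_tnth i)).
Qed.

Lemma prod_fejer_bound n x (u : q.-tuple RT) :
  `|\prod_i fejer n (x 0 i - tnth u i)| <= n.*2.+1%:R ^+ q.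
Proof.
rewrite normr_prod -[X in _ ^+ X](card_ord q) -prodr_const.
by apply: ler_prod => i _; rewrite normr_ge0 fejer_bound.
Qed.

Lemma measurable_sin2 (y : R) : measurable_fun setT (fun u : R => sin ((y - u) / 2) ^+ 2).
Proof.
apply: measurable_funX; apply: (measurableT_comp (f := @sin R)).
  by apply: continuous_measurable_fun; exact: continuous_sin.
by apply: measurable_funM => //; apply: measurable_funB.
Qed.

Lemma sin2_le1 (v : R) : sin v ^+ 2 <= 1.
Proof. by have := cos2Dsin2 v; have := sqr_ge0 (cos v); lra. Qed.

(** Only coordinate j carries the factor sin^2; by [fejer_sin2_le] its integral is at most 2 pi / n,
    while each other coordinate contributes exactly 2 pi. *)
Lemma integral_fejer_sin2 n x j : (0 < n)%N ->
  \int[lam]_(u in cT) ((\prod_i fejer n (x 0 i - tnth u i)) *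
     sin ((x 0 j - tnth u j) / 2) ^+ 2) <= (2 * pi) ^+ q / n%:R.
Proof.
move=> n0; have pi0 := pi_gt0 R.
pose w i u : R := fejer n (x 0 i - u) * (if i == j then sin ((x 0 j - u) / 2) ^+ 2 else 1).
have w0 i u : 0 <= w i u.
  by apply: mulr_ge0; [exact: fejer_ge0|case: ifP => // _; exact: sqr_ge0].
have mw i : measurable_fun setT (w i).
  apply: measurable_funM; first exact: measurable_fejer.
  by case: (i == j); [exact: measurable_sin2|exact: measurable_cst].
pose I := (\int[@lebesgue_measure R]_(u in `[(- pi)%R, pi]) (w j u)%:E)%E.
have I0 : (0 <= I)%E by apply: integral_ge0 => u _; rewrite lee_fin.
have Ile : (I <= (2 * pi / n%:R)%:E)%E.
  rewrite -lebesgue_pipi.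
  have mwj : measurable_fun `[(- pi)%R, pi] (fun u => (w j u)%:E).
    by apply/measurable_EFinP/measurable_funTS; exact: mw.
  apply: ge0_le_integral => //; first by move=> u _; rewrite lee_fin.
  by move=> u _; rewrite lee_fin /w eqxx fejer_sin2_le.
pose c i : R := if i == j then fine I else 2 * pi.
have hc i : (\int[@lebesgue_measure R]_(u in `[(- pi)%R, pi]) (w i u)%:E = (c i)%:E)%E.
  rewrite /c; have [->|ij] := eqVneq i j.
    by rewrite fineK// ge0_fin_numE// (le_lt_trans Ile)// ltry.
  rewrite -(integral_fejer (x 0 i) n0); apply: eq_integral => u _.
  by rewrite /w (negPf ij) mulr1.
rewrite (@eq_Rintegral _ _ _ lam cT (fun u => \prod_i w i (tnth u i))); last first.
  move=> u _; rewrite /w big_split/=; congr (_ * _).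
  by rewrite (bigD1 j)//= eqxx big1 ?mulr1// => i /negPf ->.
rewrite (Rintegral_prod_cell mw w0 hc) (bigD1 j)//= /c eqxx.
rewrite (eq_bigr (fun _ => 2 * pi)); last by move=> i /negPf ->.
rewrite prodr_const cardC1 card_ord.
have -> : (2 * pi) ^+ q / n%:R = 2 * pi / n%:R * (2 * pi) ^+ q.-1 :> R.
  have qE : q = q.-1.+1 by rewrite prednK// (leq_ltn_trans _ (ltn_ord j)).
  by rewrite {1}qE exprS; ring.
apply: ler_wpM2r; first by rewrite exprn_ge0// mulr_ge0// ltW.
by rewrite -lee_fin fineK// ge0_fin_numE// (le_lt_trans Ile)// ltry.
Qed.

Lemma mod_2pi (y : R) : exists k : int, `|y - 2 * pi * k%:~R| <= pi.
Proof.
have p2 : 0 < 2 * pi :> R by rewrite mulr_gt0// pi_gt0.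
exists (Num.floor ((y + pi) / (2 * pi))).
have := Num.Theory.floor_le ((y + pi) / (2 * pi)).
have := Num.Theory.floorD1_gt ((y + pi) / (2 * pi)).
rewrite ltr_pdivrMr// ler_pdivlMr// intrD => h1 h2.
by rewrite ler_norml; apply/andP; split; lra.
Qed.

(** Korovkin's test function. Either some translate of u by periods is within d of x and continuity
    applies, or some coordinate is at distance at least d modulo 2 pi; then its sin^2 is at least
    d^2 / 16 by [sin2_ge], and C is chosen so that this pays for 2 Mb. *)
Lemma korovkin_modulus F x (Mb : R) :
  (forall e, 0 < e -> exists2 d, 0 < d & forall y : point,
     (forall i, `|y 0 i - x 0 i| < d) -> `|F y - F x| < e) ->
  (forall y (k : 'rV[int]_q), F (y + (2 * pi) *: intvec k) = F y) ->
  (forall y, `|F y| <= Mb) ->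
  forall e, 0 < e -> exists2 C, 0 <= C & forall u : q.-tuple RT,
     `|F (torow u) - F x| <= e + C * \sum_i sin ((x 0 i - tnth u i) / 2) ^+ 2.
Proof.
move=> cF pF bF e e0; have [d d0 hd] := cF e e0.
have M0 : 0 <= Mb by apply: le_trans (bF x).
have d2 : 0 < d ^+ 2 by rewrite exprn_gt0.
exists (2 * Mb * 16 / d ^+ 2); first by rewrite divr_ge0 ?mulr_ge0// ltW.
move=> u.
have s0 : 0 <= \sum_i sin ((x 0 i - tnth u i) / 2) ^+ 2.
  by apply: sumr_ge0 => i _; exact: sqr_ge0.
have [k hk] := choice (fun i => mod_2pi (x 0 i - tnth u i)).
pose kk : 'rV[int]_q := \row_i k i.
have [near|/existsNP[i /negP]] := pselect (forall i,
    `|(torow u + (2 * pi) *: intvec kk) 0 i - x 0 i| < d).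
  rewrite -(pF _ kk); apply: le_trans (ltW (hd _ near)) _.
  by rewrite lerDl mulr_ge0// divr_ge0 ?mulr_ge0// ltW.
rewrite -leNgt !mxE => far.
have hfar : d ^+ 2 / 16 <= sin ((x 0 i - tnth u i) / 2) ^+ 2.
  have := sin2_ge (hk i).
  have -> : (x 0 i - tnth u i - 2 * pi * (k i)%:~R) / 2 =
    (x 0 i - tnth u i) / 2 + (- k i)%:~R * pi by rewrite mulrNz; field.
  rewrite sin2_shift; apply: le_trans; rewrite ler_pM2r ?invr_gt0//.
  rewrite -(real_normK (num_real (_ - _ - _))).
  apply: lerXn2r; rewrite ?nnegrE ?(ltW d0)//.
  by rewrite -normrN; apply: le_trans far _; rewrite le_eqVlt; apply/orP; left;
     apply/eqP; congr `|_|; ring.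
have hs : d ^+ 2 / 16 <= \sum_i sin ((x 0 i - tnth u i) / 2) ^+ 2.
  apply: le_trans hfar _; rewrite (bigD1 i)//= lerDl.
  by apply: sumr_ge0 => j _; exact: sqr_ge0.
apply: (@le_trans _ _ (2 * Mb)).
  apply: le_trans (ler_normB _ _) _.
  by have := bF (torow u); have := bF x; lra.
apply: (@le_trans _ _ (2 * Mb * 16 / d ^+ 2 * (d ^+ 2 / 16))).
  by rewrite le_eqVlt; apply/orP; left; apply/eqP; field; rewrite gt_eqF.
apply: (@le_trans _ _ (2 * Mb * 16 / d ^+ 2 * \sum_i sin ((x 0 i - tnth u i) / 2) ^+ 2)).
  by apply: ler_wpM2l => //; rewrite divr_ge0 ?mulr_ge0// ltW.
by rewrite lerDr ltW.
Qed.

(** [korovkin_modulus] is integrated against the nonnegative kernel of mass (2 pi)^q. The constant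
    part contributes e / 2, the test functions at most A / n. *)
Lemma fejer_approx F x (Mb : R) :
  (forall e, 0 < e -> exists2 d, 0 < d & forall y : point,
     (forall i, `|y 0 i - x 0 i| < d) -> `|F y - F x| < e) ->
  (forall y (k : 'rV[int]_q), F (y + (2 * pi) *: intvec k) = F y) ->
  (forall y, `|F y| <= Mb) ->
  measurable_fun setT (fun u : q.-tuple RT => F (torow u)) ->
  forall e, 0 < e -> exists n0, forall n, (n0 < n)%N ->
   `|\int[lam]_(u in cT) (F (torow u) * \prod_i fejer n (x 0 i - tnth u i))
      - (2 * pi) ^+ q * F x| <= e.
Proof.
move=> cF pF bF mF e e0; have pi0 := pi_gt0 R.
have P0 : 0 < (2 * pi) ^+ q :> R by rewrite exprn_gt0// mulr_gt0.
have mc := @measurable_cellT R q.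
pose e1 := e / (2 * (2 * pi) ^+ q).
have e10 : 0 < e1 by rewrite divr_gt0// mulr_gt0.
have [C C0 hC] := korovkin_modulus cF pF bF e10.
pose A := C * q%:R * (2 * pi) ^+ q.
have A0 : 0 <= A by rewrite !mulr_ge0// ltW.
exists (Num.bound (2 * A / e)) => n hn; have n0 : (0 < n)%N by apply: leq_ltn_trans hn.
have n0' : 0 < n%:R :> R by rewrite ltr0n.
pose K (u : q.-tuple RT) := \prod_i fejer n (x 0 i - tnth u i).
have K0 u : 0 <= K u by apply: prodr_ge0 => i _; exact: fejer_ge0.
have mK : measurable_fun setT K by exact: measurable_prod_fejer.
have iK : cell_integrable K.
  by apply: (cell_integrable_bounded mK) => u; exact: prod_fejer_bound.
have IK : \int[lam]_(u in cT) K u = (2 * pi) ^+ q.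
  rewrite (@Rintegral_prod_cell (fun i u => fejer n (x 0 i - u)) (fun _ => 2 * pi)).
  - by rewrite prodr_const card_ord.
  - by move=> i; exact: measurable_fejer.
  - by move=> i u; exact: fejer_ge0.
  - by move=> i; exact: integral_fejer.
have KB u : `|K u| <= n.*2.+1%:R ^+ q by exact: prod_fejer_bound.
have iF : cell_integrable (fun u => F (torow u)).
  by apply: (cell_integrable_bounded mF) => u; exact: bF.
have iFK : cell_integrable (fun u => F (torow u) * K u).
  exact: (cell_integrable_mul iF mK KB).
have iFxK : cell_integrable (fun u => F x * K u) by exact: integrable_RZl.
have iKF : cell_integrable (fun u => K u * F x).
  by apply: eq_integrable iFxK => // u _ /=; rewrite mulrC.
rewrite -IK -(RintegralZr _ mc iK) -(RintegralB mc iFK iKF).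
have iS j : cell_integrable (fun u => K u * sin ((x 0 j - tnth u j) / 2) ^+ 2).
  apply: (@cell_integrable_mul _ _ _ _ 1) => //.
    exact: (measurableT_comp (measurable_sin2 (x 0 j)) (measurable_tnth j)).
  by move=> u; rewrite ger0_norm ?sqr_ge0// sin2_le1.
have iU : cell_integrable (fun u => e1 * K u + C *
    \sum_j K u * sin ((x 0 j - tnth u j) / 2) ^+ 2).
  have i1 := integrable_RZl mc e1 iK.
  have i2 := integrable_RZl mc C (integrable_Rsum mc (index_enum 'I_q) iS).
  by have := integrableD mc i1 i2; apply: eq_integrable.
have iD : cell_integrable (fun u => F (torow u) * K u - K u * F x).
  by have := integrableB mc iFK iKF; apply: eq_integrable.
apply: le_trans (le_normr_Rintegral mc iD) _.
apply: (@le_trans _ _ (\int[lam]_(u in cT) (e1 * K u + C *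
    \sum_j K u * sin ((x 0 j - tnth u j) / 2) ^+ 2))).
  apply: le_Rintegral => //.
    by have := integrable_abse iD; apply: eq_integrable.
  move=> u _; rewrite [K u * F x]mulrC -mulrBl normrM (ger0_norm (K0 u)).
  apply: le_trans (ler_wpM2r (K0 u) (hC u)) _.
  rewrite -mulr_sumr le_eqVlt; apply/orP; left; apply/eqP; ring.
have i1 := integrable_RZl mc e1 iK.
have iSS := integrable_Rsum mc (index_enum 'I_q) iS.
have i2 := integrable_RZl mc C iSS.
rewrite RintegralD// (RintegralZl _ mc iK) (RintegralZl _ mc iSS) IK Rintegral_sum//.
have -> : e1 * (2 * pi) ^+ q = e / 2 by rewrite /e1; field; rewrite gt_eqF.
have -> : e = e / 2 + e / 2 by rewrite -splitr.
rewrite -{1}splitr lerD2l.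
apply: (@le_trans _ _ (C * \sum_(j < q) (2 * pi) ^+ q / n%:R)).
  by apply: ler_wpM2l => //; apply: ler_sum => j _; exact: integral_fejer_sin2.
rewrite sumr_const card_ord -[_ *+ q]mulr_natl.
have -> : C * (q%:R * ((2 * pi) ^+ q / n%:R)) = A / n%:R by rewrite /A; ring.
rewrite ler_pdivrMr//.
have h : 2 * A / e < n%:R.
  apply: lt_trans (archi_boundP _) _; first by rewrite divr_ge0 ?mulr_ge0// ltW.
  by rewrite ltr_nat.
by rewrite ltr_pdivrMr// in h; lra.
Qed.

End korovkin.

(** * Interpolation error of a Bessel potential *)

Section interpolation_error.
Variables (R : realType) (q : nat).
Local Notation RT := (measurableTypeR R).
Local Notation point := 'rV[R]_q.
Local Notation lam := (lebesgueq q).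
Local Notation cT := (@cellT R q).
Implicit Types (F : point -> R) (x y : point) (Phi h : q.-tuple RT -> R).

Definition upd x (i : 'I_q) (r : R) : point := \row_l (if l == i then r else x 0 l).

Lemma upd_id x i : upd x i (x 0 i) = x.
Proof. by apply/rowP => l; rewrite mxE; case: eqP => // ->. Qed.

Lemma qdivp_ge0 (p : \bar R) : (1 <= p)%E -> 0 <= qdivp q p.
Proof.
case: p => [r| |]//; rewrite /qdivp.
  by rewrite lee_fin fine_invr => r1; rewrite mulr_ge0// invr_ge0; lra.
by rewrite invey mulr0.
Qed.

Definition degs (i : 'I_q) (a : nat) (l : 'I_q) : nat := if l == i then a else 0%N.

(** The sum is a convolution with a product of kernels, differentiated a times in coordinate i only,
    so the powers of N combine to N^a times a product of peaks. The sum Ca + C0 serves as one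
    constant for both kinds of factor. *)
Lemma conv_bound a : exists2 D : R, 0 < D & forall p Phi h B i n t x, (1 <= p)%E ->
  0 < B -> cell_integrable Phi -> measurable_fun setT h -> (forall u, `|Phi u| <= h u) ->
  (Lnorm lam p ((EFin \o h) \_ cT) <= B%:E)%E -> (0 < n)%N -> 0 < t ->
  let N := kscale n t in
  `|\sum_(f : {ffun 'I_q -> 'I_n.*2.+1}) kweight n t (degs i a) (kvec f) *
    cosint Phi (fun l => - kvec f l)
      (\sum_l ((kvec f l)%:~R * x 0 l + (degs i a l)%:R * (pi / 2)))| <=
  D * N ^+ a * N `^ qdivp q p * B.
Proof.
have [Ca [Ca0 hCa]] := @kern_bound R a; have [C0 [C00 hC0]] := @kern_bound R 0.
have pi0 := pi_gt0 R.
have D0 : 0 < Ca + C0 by lra.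
have E0 : 0 < (12 * pi) ^+ q + 1 :> R.
  by rewrite ltr_wpDl// exprn_ge0// mulr_ge0// ltW.
exists ((Ca + C0) ^+ q * ((12 * pi) ^+ q + 1)); first by rewrite mulr_gt0 ?exprn_gt0.
move=> p Phi h B i n t x p1 B0 iP mh hP hL n0 t0 /=; set N := kscale n t.
have N1 : 1 <= N := kscale_ge1 n t; have N0 : 0 < N by lra.
have mc := @measurable_cellT R q.
have h0 u : 0 <= h u by apply: le_trans (hP u).
rewrite (conv_kern n t (degs i a) (fun l => x 0 l) iP).
have kb (l : 'I_q) (v : R) : `|kern n t (degs i a l) v| <=
    (Ca + C0) * N ^+ (degs i a l) * (N / (1 + N ^+ 2 * sin (v / 2) ^+ 2)).
  have q0 : 0 < (1 + N ^+ 2 * sin (v / 2) ^+ 2)^-1.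
    by rewrite invr_gt0 ltr_pwDl// mulr_ge0// sqr_ge0.
  have base b (Cb : R) : Cb <= Ca + C0 ->
      `|kern n t b v| <= Cb * N ^+ b.+1 / (1 + N ^+ 2 * sin (v / 2) ^+ 2) ->
      `|kern n t b v| <= (Ca + C0) * N ^+ b * (N / (1 + N ^+ 2 * sin (v / 2) ^+ 2)).
    move=> hb /le_trans; apply.
    have q1 : 0 <= N ^+ b * N * (1 + N ^+ 2 * sin (v / 2) ^+ 2)^-1.
      by apply: mulr_ge0; [rewrite mulr_ge0 ?exprn_ge0 ?ltW|exact: ltW].
    by rewrite exprSr; have := ler_wpM2r q1 hb; rewrite !mulrA.
  rewrite /degs; case: (l == i).
    by apply: (base _ Ca); [lra|exact: hCa].
  by apply: (base _ C0); [lra|exact: hC0].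
have Na : \prod_(l < q) ((Ca + C0) * N ^+ (degs i a l)) = (Ca + C0) ^+ q * N ^+ a.
  rewrite big_split/= prodr_const card_ord; congr (_ * _).
  rewrite (bigD1 i)//= /degs eqxx big1 ?mulr1// => l /negPf ->.
  by rewrite expr0.
have pk u : `|\prod_l kern n t (degs i a l) (x 0 l - tnth u l)| <=
    (Ca + C0) ^+ q * N ^+ a * \prod_l bump N (x 0 l) (tnth u l).
  rewrite normr_prod -Na -big_split/=; apply: ler_prod => l _.
  by rewrite normr_ge0/= kb.
(* Measurability is read off from the expansion of the product into finitely many cosines. *)
have mk : measurable_fun setT
    (fun u : q.-tuple RT => \prod_l kern n t (degs i a l) (x 0 l - tnth u l)).
  rewrite (_ : (fun u => _) = fun u : q.-tuple RT =>
     \sum_(f : {ffun 'I_q -> 'I_n.*2.+1}) kweight n t (degs i a) (kvec f) *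
     cos (theta (fun l => - kvec f l) (tnth u) + \sum_l ((kvec f l)%:~R * x 0 l +
        (degs i a l)%:R * (pi / 2)))).
    apply: measurable_sum => f; apply: measurable_funM => //.
    exact: measurable_cos_theta.
  apply/funext => u; rewrite prod_kern; apply: eq_bigr => f _; congr (_ * cos _).
  rewrite /theta -big_split/=; apply: eq_bigr => l _.
  by rewrite mulrNz; ring.
set E := (Ca + C0) ^+ q * N ^+ a in pk *.
have Ea : 0 <= E by rewrite mulr_ge0 ?exprn_ge0// ltW.
have ik : cell_integrable (fun u => Phi u *
    \prod_l kern n t (degs i a l) (x 0 l - tnth u l)).
  apply: (cell_integrable_mul iP mk (B := E * N ^+ q)) => u.
  apply: le_trans (pk u) _; apply: ler_wpM2l => //.
  rewrite -[X in _ ^+ X](card_ord q) -prodr_const; apply: ler_prod => l _.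
  by rewrite bump_ge0 ?bump_le// ltW.
have H := Lp_bump_bound (fun l => x 0 l) p1 B0 N1 mh h0 hL.
rewrite -lee_fin EFin_normr_Rintegral//.
apply: le_trans (le_abse_integral _ _ _) _ => //.
  by apply/measurable_EFinP; case/integrableP: ik => /measurable_EFinP.
have mhb : measurable_fun cT (fun u => (h u * \prod_l bump N (x 0 l) (tnth u l))%:E).
  apply/measurable_EFinP/measurable_funTS/measurable_funM => //.
  exact: (measurable_prod_bump N (fun l => x 0 l)).
have hb0 u : cT u -> (0 <= (h u * \prod_l bump N (x 0 l) (tnth u l))%:E)%E.
  by move=> _; rewrite lee_fin mulr_ge0// prodr_ge0// => l _; rewrite bump_ge0// ltW.
have Ea' : (0 <= E%:E)%E by rewrite lee_fin.
apply: (@le_trans _ _ (\int[lam]_(u in cT) (E%:E *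
    (h u * \prod_l bump N (x 0 l) (tnth u l))%:E))%E).
  have m1 : measurable_fun cT (fun u => `|(Phi u *
      \prod_l kern n t (degs i a l) (x 0 l - tnth u l))%:E|)%E.
    by apply: measurableT_comp => //; case/integrableP: ik.
  have m2 : measurable_fun cT (fun u => E%:E *
      (h u * \prod_l bump N (x 0 l) (tnth u l))%:E)%E by exact: emeasurable_funM.
  apply: ge0_le_integral => //.
  move=> u _; rewrite -EFinM /= lee_fin normrM mulrCA.
  by apply: ler_pM.
rewrite (ge0_integralZl _ mc mhb hb0 Ea').
apply: le_trans (lee_wpmul2l Ea' H) _.
rewrite -EFinM lee_fin /E le_eqVlt; apply/orP; left; apply/eqP; ring.
Qed.

Lemma kweight_degs n t i a (k : 'I_q -> int) :
  kweight n t (degs i a) k = (k i)%:~R ^+ a * kweight n t (fun=> 0%N) k :> R.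
Proof.
rewrite /kweight (bigD1 i)//= [in RHS](bigD1 i)//= /degs eqxx.
rewrite mulrA; congr (_ * _); last by apply: eq_bigr => l /negPf ->.
by rewrite /kcoef expr0; ring.
Qed.

Lemma degs_phase i a (k : 'I_q -> int) (x : 'I_q -> R) :
  \sum_l ((k l)%:~R * x l + (degs i a l)%:R * (pi / 2)) =
  \sum_l (k l)%:~R * x l + a%:R * (pi / 2).
Proof.
rewrite big_split/=; congr (_ + _); rewrite (bigD1 i)//= /degs eqxx big1 ?addr0//.
by move=> l /negPf ->; rewrite mul0r.
Qed.

Lemma derive_cosint Phi (k : 'I_q -> int) (d be r : R) : cell_integrable Phi ->
  is_derive r 1 (fun r : R => cosint Phi k (d * r + be))
    (d * cosint Phi k (d * r + be + pi / 2)).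
Proof.
move=> iP.
rewrite (_ : (fun r => _) = fun r => cosint Phi k 0 * cos (d * r + be) +
   cosint Phi k (pi / 2) * sin (d * r + be)); last first.
  by apply/funext => z; rewrite cosint_phase//; ring.
have h := der_add (der_scale (cosint Phi k 0) (derive_cos_affine d be r))
  (der_scale (cosint Phi k (pi / 2)) (derive_sin_affine d be r)).
apply: (is_derive_eq h).
by rewrite (cosint_phase k (_ + pi / 2))// cosDpihalf sinDpihalf; ring.
Qed.

(** Separates the Fejer factors from the heat factor, which depends on k only through |k|^2, as
    [bessel_sum_bound] requires. *)
Lemma kweight0 n t (k : 'I_q -> int) : kweight n t (fun=> 0%N) k =
  kweight n 0 (fun=> 0%N) k * expR (- t * (\sum_l (k l)%:~R ^+ 2)) :> R.
Proof.
rewrite /kweight mulr_sumr expR_sum -big_split/=; apply: eq_bigr => l _.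
by rewrite /kcoef !expr0 oppr0 !mul0r expR0; ring.
Qed.

(** Here [Phi] is one part of f^(s) and [F] the same part of f. The error is first bounded for the
    Fejer means of [F], uniformly in n: through [bessel_sum_bound] it reduces to the interpolation
    error of the heat flow of [Phi], which is estimated in two ways, one for each argument of the
    minimum. *)
Lemma interp_error_real (p : \bar R) (s ka : R) (m : nat) : (1 <= p)%E -> (0 < m)%N ->
  0 < ka -> 2 * ka < m%:R -> 2 * ka <= s - qdivp q p ->
  exists2 C : R, 0 < C & forall F Phi h B (Mb : R),
    (forall x e, 0 < e -> exists2 d, 0 < d & forall y : point,
       (forall i, `|y 0 i - x 0 i| < d) -> `|F y - F x| < e) ->
    (forall y (k : 'rV[int]_q), F (y + (2 * pi) *: intvec k) = F y) ->
    (forall y, `|F y| <= Mb) ->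
    measurable_fun setT (fun u : q.-tuple RT => F (torow u)) ->
    0 < B -> cell_integrable Phi -> measurable_fun setT h ->
    (forall u, `|Phi u| <= h u) ->
    (Lnorm lam p ((EFin \o h) \_ cT) <= B%:E)%E ->
    (forall k be, cosint Phi k be = bweight s k * cosint (fun u => F (torow u)) k be) ->
    forall x i c de, 0 < de -> `|x 0 i - c| <= 2 * de ->
    `|F x - \sum_(j < m) (lpoly R j).[(x 0 i - c) / de] * F (upd x i (c + de * lnode R j))|
      <= C * B * de `^ (2 * ka).
Proof.
move=> p1 m0 ka0 km ks; have b0 := qdivp_ge0 p1; have pi0 := pi_gt0 R.
have [Dm Dm0 hDm] := conv_bound m; have [D0 D00 hD0] := conv_bound 0.
have [K [K0 hK]] := lpoly_lipschitz R m.
have hK1 (j : 'I_m) (a : R) : `|a| <= 2 -> `|(lpoly R j).[a]| <= K.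
  by move=> ha; have [] := hK j a a ha ha.
have ks' : 2 * ka <= 2 * (s / 2) - qdivp q p by lra.
have [Cb [Cb0 hCb]] := bessel_sum_bound b0 ka0 km ks'.
pose K1 := 1 + m%:R * K; have K10 : 0 < K1 by rewrite ltr_pwDl// mulr_ge0.
pose P : R := (2 * pi) ^+ q; have P0 : 0 < P by rewrite exprn_gt0// mulr_gt0.
pose A0 := K1 * 2 ^+ m * (Dm + D0).
have A00 : 0 < A0 by rewrite /A0; apply: mulr_gt0; [rewrite mulr_gt0// exprn_gt0|lra].
exists (Cb * A0 / P); first by apply: divr_gt0 => //; exact: mulr_gt0.
move=> F Phi h B Mb cF pF bF mF B0 iP mh hP hL hw x i c de de0 hx.
pose pt (j : 'I_m) := upd x i (c + de * lnode R j).
pose Lj (j : 'I_m) := (lpoly R j).[(x 0 i - c) / de].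
have hL1 j : `|Lj j| <= K.
  by apply: hK1; rewrite normrM normfV (gtr0_norm de0) ler_pdivrMr.
have iF : cell_integrable (fun u => F (torow u)).
  by apply: (cell_integrable_bounded mF) => u; exact: bF.
(* (2 pi)^q times the Fejer mean of [F]. By [SE] it is a finite sum of Fourier data of [Phi] divided
   by the Bessel weight. *)
pose S n (y : point) := \int[lam]_(u in cT) (F (torow u) * \prod_l fejer n (y 0 l - tnth u l)).
have SE n y : S n y = \sum_(f : {ffun 'I_q -> 'I_n.*2.+1})
    kweight n 0 (fun=> 0%N) (kvec f) *
    ((\sum_l (kvec f l)%:~R ^+ 2 + 1) `^ (- (s / 2)) *
    cosint Phi (fun l => - kvec f l) (\sum_l (kvec f l)%:~R * y 0 l)).
  have := conv_kern n 0 (fun=> 0%N) (fun l => y 0 l) iF.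
  rewrite (@eq_Rintegral _ _ _ lam cT
     (fun u => F (torow u) * \prod_l fejer n (y 0 l - tnth u l))); last first.
    by move=> u _; congr (_ * _); apply: eq_bigr => l _; rewrite kern00.
  rewrite -/(S n y) => <-; apply: eq_bigr => f _; congr (_ * _).
  rewrite hw bweightN /bweight [RHS]mulrA -powRD; last first.
    by apply/implyP => _; rewrite gt_eqF// ltr_wpDl// sumr_ge0// => l _; rewrite sqr_ge0.
  rewrite addNr powRr0 mul1r; congr cosint; apply: eq_bigr => l _.
  by rewrite mul0r addr0.
have Sb n : (0 < n)%N -> `|S n x - \sum_j Lj j * S n (pt j)| <=
    Cb * (A0 * B) * de `^ (2 * ka).
  move=> n0.
  (* [cf] is the interpolation error of a single frequency, and [af] - 1 is |k|^2; a factor exp (-t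
     |k|^2) therefore produces the interpolation error of the heat flow at time t. *)
  pose cf (f : {ffun 'I_q -> 'I_n.*2.+1}) := kweight n 0 (fun=> 0%N) (kvec f) *
    (cosint Phi (fun l => - kvec f l) (\sum_l (kvec f l)%:~R * x 0 l) -
     \sum_j Lj j * cosint Phi (fun l => - kvec f l) (\sum_l (kvec f l)%:~R * (pt j) 0 l)).
  pose af (f : {ffun 'I_q -> 'I_n.*2.+1}) : R := \sum_l (kvec f l)%:~R ^+ 2 + 1.
  have -> : S n x - \sum_j Lj j * S n (pt j) = \sum_f cf f * af f `^ (- (s / 2)).
    rewrite SE; under [X in _ - X]eq_bigr do rewrite SE mulr_sumr.
    rewrite exchange_big/= -sumrB; apply: eq_bigr => f _.
    rewrite /cf /af mulrBr mulrBl; congr (_ - _); first by ring.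
    by rewrite mulr_sumr mulr_suml; apply: eq_bigr => j _; ring.
  apply: hCb => //.
  - by rewrite mulr_ge0// ltW.
  - by move=> f; rewrite /af lerDr sumr_ge0// => l _; rewrite sqr_ge0.
  move=> t t0; exists (kscale n t); split; [exact: kscale_ge1|exact: kscale_le|].
  set N := kscale n t; have N1 : 1 <= N := kscale_ge1 n t.
  have N0 : 0 < N by lra.
  (* The a-th derivative of the heat flow along the line through x in direction i; [dG] says that
     each is the derivative of the preceding one. *)
  pose G a r := \sum_(f : {ffun 'I_q -> 'I_n.*2.+1}) kweight n t (degs i a) (kvec f) *
    cosint Phi (fun l => - kvec f l)
      (\sum_l ((kvec f l)%:~R * (upd x i r) 0 l + (degs i a l)%:R * (pi / 2))).
  have GE r : G 0%N r = \sum_(f : {ffun 'I_q -> 'I_n.*2.+1})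
      kweight n t (fun=> 0%N) (kvec f) *
      cosint Phi (fun l => - kvec f l) (\sum_l (kvec f l)%:~R * (upd x i r) 0 l).
    apply: eq_bigr => f _; rewrite kweight_degs expr0 mul1r; congr (_ * _).
    by congr cosint; rewrite degs_phase mul0r addr0.
  have -> : \sum_f cf f * expR (- t * (af f - 1)) =
      G 0%N (x 0 i) - \sum_j Lj j * G 0%N (c + de * lnode R j).
    rewrite GE upd_id; under [X in _ - X]eq_bigr do rewrite GE mulr_sumr.
    rewrite exchange_big/= -sumrB; apply: eq_bigr => f _.
    rewrite kweight0 /cf /af addrK mulrBr mulrBl; congr (_ - _); first by ring.
    by rewrite mulr_sumr mulr_suml; apply: eq_bigr => j _; rewrite kweight0; ring.
  have dG a (r : R) : is_derive r 1 (G a) (G a.+1 r).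
    have phE (f : {ffun 'I_q -> 'I_n.*2.+1}) r' :
       \sum_l ((kvec f l)%:~R * (upd x i r') 0 l + (degs i a l)%:R * (pi / 2)) =
       (kvec f i)%:~R * r' + (\sum_(l | l != i) (kvec f l)%:~R * x 0 l + a%:R * (pi / 2)).
      rewrite degs_phase (bigD1 i)//= mxE eqxx -addrA; congr (_ + (_ + _)).
      by apply: eq_bigr => l /negPf li; rewrite mxE li.
    have H (sq : seq {ffun 'I_q -> 'I_n.*2.+1}) : is_derive r 1
      (fun r : R => \sum_(f <- sq) kweight n t (degs i a) (kvec f) *
         cosint Phi (fun l => - kvec f l) ((kvec f i)%:~R * r +
           (\sum_(l | l != i) (kvec f l)%:~R * x 0 l + a%:R * (pi / 2))))
      (\sum_(f <- sq) kweight n t (degs i a) (kvec f) * ((kvec f i)%:~R *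
         cosint Phi (fun l => - kvec f l) ((kvec f i)%:~R * r +
           (\sum_(l | l != i) (kvec f l)%:~R * x 0 l + a%:R * (pi / 2)) + pi / 2))).
      elim: sq => [|f sq IH].
        by rewrite big_nil; under eq_fun do rewrite big_nil; exact: der_cst.
      rewrite big_cons; under eq_fun do rewrite big_cons.
      apply: (der_add _ IH); apply: der_scale; exact: derive_cosint.
    have := H (index_enum _).
    rewrite (_ : (fun r : R => _) = G a); last first.
      by apply/funext => r'; apply: eq_bigr => f _; rewrite phE.
    move=> h1; apply: (is_derive_eq h1); apply: eq_bigr => f _.
    rewrite !kweight_degs exprS -phE !degs_phase -[a.+1%:R]natr1.
    have -> : \sum_l (kvec f l)%:~R * (upd x i r) 0 l + (a%:R + 1) * (pi / 2) =
      \sum_l (kvec f l)%:~R * (upd x i r) 0 l + a%:R * (pi / 2) + pi / 2 by ring.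
    by ring.
  have bG0 r : `|G 0%N r| <= D0 * N `^ qdivp q p * B.
    have := hD0 p Phi h B i n t (upd x i r) p1 B0 iP mh hP hL n0 t0.
    by rewrite /= -/N ?expr0 mulr1.
  have bGm r : `|G m r| <= Dm * N ^+ m * N `^ qdivp q p * B.
    exact: (hDm p Phi h B i n t (upd x i r) p1 B0 iP mh hP hL n0 t0).
  set W := N `^ qdivp q p in bG0 bGm *.
  have W0 : 0 <= W by exact: powR_ge0.
  (* Trivial estimate: the value at x and the m weighted node values are bounded separately. *)
  have E1 : `|G 0%N (x 0 i) - \sum_j Lj j * G 0%N (c + de * lnode R j)| <= A0 * B * W.
    apply: le_trans (ler_normB _ _) _.
    apply: (@le_trans _ _ (K1 * (D0 * W * B))).
      rewrite /K1 mulrDl mul1r; apply: lerD => //.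
      apply: le_trans (ler_norm_sum _ _ _) _.
      rewrite -mulrA mulr_natl -[X in _ *+ X]card_ord -sumr_const.
      by apply: ler_sum => j _; rewrite normrM; apply: ler_pM.
    have e2 : (1 : R) <= 2 ^+ m by rewrite exprn_ege1// ler1n.
    have -> : A0 * B * W = (K1 * (Dm + D0) * W * B) * 2 ^+ m by rewrite /A0; ring.
    have p2 : 0 <= K1 * (Dm + D0) * W * B.
      by nneg.
    apply: le_trans (ler_peMr p2 e2).
    have : 0 <= K1 * Dm * W * B by nneg.
    by lra.
  (* Estimate by [lagrange_bound], where the m-th derivative costs N^m and the spacing gains
     de^m. *)
  have E2 : `|G 0%N (x 0 i) - \sum_j Lj j * G 0%N (c + de * lnode R j)| <=
      A0 * B * W * (de * N) ^+ m.
    apply: le_trans (lagrange_bound m0 K0 hK1 de0 dG bGm hx) _.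
    rewrite -/K1 !exprMn.
    have : 0 <= K1 * 2 ^+ m * D0 * (B * W * (de ^+ m * N ^+ m)).
      by nneg.
    by rewrite /A0; lra.
  rewrite mulrA; case: (leP 1 ((de * N) ^+ m)) => _; first by rewrite mulr1.
  exact: E2.
(* Passing from the means back to [F] costs e at x and at most K e at each of the m nodes, which
   makes [e * K1] in total. The index n lies beyond the thresholds of all these points. *)
have lim e : 0 < e -> P * `|F x - \sum_j Lj j * F (pt j)| <=
    Cb * (A0 * B) * de `^ (2 * ka) + e * K1.
  move=> e0.
  have ev y := fejer_approx (cF y) pF bF mF e0.
  have [nx hnx] := ev x; have [nj hnj] := choice (fun j => ev (pt j)).
  pose n := (nx + \sum_j nj j).+1.
  have hx' := hnx n (leq_addr _ _).
  have hj' j : `|S n (pt j) - P * F (pt j)| <= e.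
    apply: hnj; rewrite /n ltnS (bigD1 j)//= addnCA leq_addr//.
  have := Sb n (ltn0Sn _) => H.
  have -> : P * `|F x - \sum_j Lj j * F (pt j)| =
     `|P * F x - \sum_j Lj j * (P * F (pt j))|.
    rewrite -{1}(gtr0_norm P0) -normrM mulrBr mulr_sumr; congr `|_ - _|.
    by apply: eq_bigr => j _; ring.
  have -> : P * F x - \sum_j Lj j * (P * F (pt j)) =
    (S n x - \sum_j Lj j * S n (pt j)) +
    (- (S n x - P * F x) + \sum_j Lj j * (S n (pt j) - P * F (pt j))).
    under [X in _ + (_ + X)]eq_bigr do rewrite mulrBr.
    by rewrite sumrB; ring.
  apply: le_trans (ler_normD _ _) _; apply: lerD => //.
  apply: le_trans (ler_normD _ _) _; rewrite normrN.
  rewrite /K1 mulrDr mulr1; apply: lerD => //.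
  apply: le_trans (ler_norm_sum _ _ _) _.
  rewrite mulrCA mulr_natl -[X in _ *+ X]card_ord -sumr_const.
  by apply: ler_sum => j _; rewrite normrM mulrC; apply: ler_pM.
have : P * `|F x - \sum_j Lj j * F (pt j)| <= Cb * (A0 * B) * de `^ (2 * ka).
  apply/ler_addgt0Pr => e e0.
  have := lim (e / K1); rewrite divr_gt0// => /(_ isT).
  by rewrite mulfVK// gt_eqF.
rewrite -/(pt _) mulrC -ler_pdivlMr// => H; apply: le_trans H _.
by rewrite le_eqVlt; apply/orP; left; apply/eqP; ring.
Qed.

End interpolation_error.

(** * Trigonometric polynomials *)
Section trig_polynomials.
Variables (R : realType) (q : nat).
Local Notation RT := (measurableTypeR R).
Local Notation C := (complex R).
Local Notation point := 'rV[R]_q.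
Local Notation freq := 'rV[int]_q.
Local Notation normc := ComplexField.Normc.normc.
Local Notation lam := (lebesgueq q).
Local Notation cT := (@cellT R q).
Implicit Types (f g : point -> C) (x y : point) (k l : freq).

Lemma normC_lt (z : C) (e : R) : (`|z| < Complex e 0) = (normc z < e).
Proof. by case: z => a b; rewrite /= ltcE /= eqxx. Qed.

Lemma normc_distC (z w : C) : normc (z - w) = normc (w - z).
Proof.
case: z => a b; case: w => c d; rewrite /=; congr Num.sqrt.
by rewrite -[a - c]opprB -[b - d]opprB !sqrrN.
Qed.

Lemma continuous_ReIm f :
  (forall x e, 0 < e -> exists2 d, 0 < d & forall y,
    (forall i, `|y 0 i - x 0 i| < d) -> normc (f y - f x) < e) <->
  continuous (f : point -> C^o).
Proof.
split=> [h x|h x e e0].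
  apply/(cvgrPdist_lt (V := C^o) (FF := nbhs_filter x)) => -[e e'] e0.
  have : 0 < Complex e e' := e0; rewrite ltcE /= => /andP[/eqP ? e1].
  subst e'; have [d d0 hd] := h x e e1.
  apply/nbhs_ballP; exists d => // y xy; rewrite normC_lt.
  rewrite normc_distC; apply: hd => i.
  by have [_ /(_ 0 i)] := xy; rewrite /ball/= distrC.
have e0' : (0 : C) < Complex e 0 by rewrite ltcE/= eqxx.
have := h x; move/(@cvgrPdist_lt _ C^o) => /(_ _ e0') /nbhs_ballP[d d0 hd].
exists d => // y hy; have := hd y.
rewrite normC_lt normc_distC; apply.
by split => // i j; rewrite /ball/= distrC ord1; exact: hy.
Qed.

Lemma periodic_bounded (F : point -> R) :
  (forall x e, 0 < e -> exists2 d, 0 < d & forall y,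
    (forall i, `|y 0 i - x 0 i| < d) -> `|F y - F x| < e) ->
  (forall y k, F (y + (2 * pi) *: intvec k) = F y) ->
  exists Mb, forall y, `|F y| <= Mb.
Proof.
move=> cF pF.
have cts : continuous F.
  move=> x; apply/(cvgrPdist_lt (FF := nbhs_filter x)) => e e0.
  have [d d0 hd] := cF x e e0; apply/nbhs_ballP; exists d => // y xy.
  rewrite distrC; apply: hd => i.
  by have [_ /(_ 0 i)] := xy; rewrite /ball/= distrC.
have := @rV_compact R q (fun _ => `[(- pi)%R, pi]%classic) (fun _ => @segment_compact R _ _).
move=> /(continuous_compact (continuous_subspaceT cts)) /compact_bounded.
move=> [M [Mr hM]]; exists (M + 1) => y.
have [k hk] := choice (fun i => mod_2pi (y 0 i)).
rewrite -(pF y (\row_i (- k i))); apply: (hM (M + 1)); first by rewrite ltrDl.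
exists (y + (2 * pi) *: intvec (\row_i (- k i))) => // i /=.
rewrite !mxE in_itv/=; have := hk i; rewrite ler_norml mulrNz => /andP[h1 h2].
by apply/andP; split; lra.
Qed.

Definition dotp k x : R := \sum_i (k 0 i)%:~R * x 0 i.

Lemma dotp_torow k (u : q.-tuple RT) : dotp k (torow u) = theta (fun i => k 0 i) (tnth u).
Proof. by apply: eq_bigr => i _; rewrite mxE. Qed.

Lemma expiE k x : expi k x = cis (dotp k x).
Proof. by []. Qed.

Lemma dotpD k l x : dotp (k + l) x = dotp k x + dotp l x.
Proof.
by rewrite /dotp -big_split/=; apply: eq_bigr => i _; rewrite mxE intrD; ring.
Qed.

Lemma dotp_shift k x l : exists z : int, dotp k (x + (2 * pi) *: intvec l) =
  dotp k x + 2 * pi * z%:~R.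
Proof.
exists (\sum_i k 0 i * l 0 i); rewrite rmorph_sum/= mulr_sumr -big_split/=.
by apply: eq_bigr => i _; rewrite !mxE rmorphM/=; ring.
Qed.

Lemma sin_2pi_int (v : R) (z : int) : sin (v + 2 * pi * z%:~R) = sin v.
Proof.
have := cos_2pi_int (v - pi / 2) z.
by rewrite cosBpihalf addrAC cosBpihalf.
Qed.

Lemma expi_periodic k : Defs.periodic (expi k : point -> C).
Proof.
move=> x l; rewrite !expiE /cis; have [z ->] := dotp_shift k x l.
by rewrite cos_2pi_int sin_2pi_int.
Qed.

Definition tpoly (r : seq freq) (a : freq -> C) x : C := \sum_(k <- r) a k * expi k x.

Lemma trigpolyE t (a : freq -> C) :
  trigpoly t a = tpoly (finmap.enum_fset (fset_set (freqs t))) a.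
Proof. by apply/funext => x; rewrite /trigpoly fsbig_finite//; exact: finite_freqs. Qed.

Lemma tpoly_periodic r a : Defs.periodic (tpoly r a).
Proof. by move=> x l; apply: eq_bigr => k _; rewrite expi_periodic. Qed.

Lemma tpolyReIm r a x :
  complex.Re (tpoly r a x) = \sum_(k <- r) (complex.Re (a k) * cos (dotp k x)
     - complex.Im (a k) * sin (dotp k x)) /\
  complex.Im (tpoly r a x) = \sum_(k <- r) (complex.Re (a k) * sin (dotp k x)
     + complex.Im (a k) * cos (dotp k x)).
Proof.
rewrite /tpoly; elim: r => [|k r [IH1 IH2]]; first by rewrite !big_nil.
rewrite !big_cons -IH1 -IH2 expiE /cis; case: (a k) => b c /=.
by case: (\sum_(_ <- _) _) => d e /=.
Qed.

Lemma measurable_cos_dotp k : measurable_fun setT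
  (fun u : q.-tuple RT => cos (dotp k (torow u))).
Proof.
have := measurable_cos_theta (fun i => k 0 i) (0 : R).
by under eq_fun do rewrite addr0; under [in X in _ -> X]eq_fun do rewrite dotp_torow.
Qed.

Lemma measurable_sin_dotp k : measurable_fun setT
  (fun u : q.-tuple RT => sin (dotp k (torow u))).
Proof.
have := measurable_cos_theta (fun i => k 0 i) (- (pi / 2) : R).
under eq_fun do rewrite cosBpihalf.
by under [in X in _ -> X]eq_fun do rewrite dotp_torow.
Qed.

Lemma measurable_Re_tpoly r a : measurable_fun setT
  (fun u : q.-tuple RT => complex.Re (tpoly r a (torow u))).
Proof.
rewrite (_ : (fun u => _) = fun u : q.-tuple RT => \sum_(k <- r)
   (complex.Re (a k) * cos (dotp k (torow u)) - complex.Im (a k) * sin (dotp k (torow u)))).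
  apply: measurable_sum => k; apply: measurable_funB; apply: measurable_funM => //.
  - exact: measurable_cos_dotp.
  - exact: measurable_sin_dotp.
by apply/funext => u; rewrite (tpolyReIm r a _).1.
Qed.

Lemma measurable_Im_tpoly r a : measurable_fun setT
  (fun u : q.-tuple RT => complex.Im (tpoly r a (torow u))).
Proof.
rewrite (_ : (fun u => _) = fun u : q.-tuple RT => \sum_(k <- r)
   (complex.Re (a k) * sin (dotp k (torow u)) + complex.Im (a k) * cos (dotp k (torow u)))).
  apply: measurable_sum => k; apply: measurable_funD; apply: measurable_funM => //.
  - exact: measurable_sin_dotp.
  - exact: measurable_cos_dotp.
by apply/funext => u; rewrite (tpolyReIm r a _).2.
Qed.

Lemma normc_cis (v : R) : normc (cis v) = 1.
Proof. by rewrite /cis/= cos2Dsin2 sqrtr1. Qed.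

Lemma normc_sum (I : Type) (r : seq I) (F : I -> C) :
  normc (\sum_(i <- r) F i) <= \sum_(i <- r) normc (F i).
Proof.
elim: r => [|i r IH]; first by rewrite !big_nil ComplexField.Normc.normc0.
rewrite !big_cons; apply: le_trans (le_normcD _ _) _.
by rewrite lerD2l.
Qed.

Lemma tpoly_bound r a x : normc (tpoly r a x) <= \sum_(k <- r) normc (a k).
Proof.
apply: le_trans (normc_sum _ _) _; apply: ler_sum => k _.
by rewrite ComplexField.Normc.normcM expiE normc_cis mulr1.
Qed.

Lemma normc_ge0 (z : C) : 0 <= normc z.
Proof. by case: z => a b; exact: sqrtr_ge0. Qed.

Lemma bounded_Lp (p : \bar R) f (B : R) : (1 <= p)%E -> Defs.periodic f ->
  measurable_fun setT (fun u : q.-tuple RT => complex.Re (f (torow u))) ->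
  measurable_fun setT (fun u : q.-tuple RT => complex.Im (f (torow u))) ->
  (forall x, normc (f x) <= B) -> Lp p f.
Proof.
move=> p1 pf mR mI fB; split=> //; rewrite LpnormE.
have B0 : 0 <= B by apply: le_trans (fB 0); exact: normc_ge0.
have mh : measurable_fun setT (fun u : q.-tuple RT => normc (f (torow u))).
  rewrite (_ : (fun u => _) = fun u : q.-tuple RT =>
    Num.sqrt (complex.Re (f (torow u)) ^+ 2 + complex.Im (f (torow u)) ^+ 2)).
    apply: (measurableT_comp (f := @Num.sqrt R)).
      by apply: continuous_measurable_fun; exact: sqrt_continuous.
    by apply: measurable_funD; apply: measurable_funX.
  by apply/funext => u; case: (f _).
have mc := @measurable_cellT R q.
case: p p1 => [r| |]//; last first.
  move=> _; rewrite unlock; case: ifPn => // _.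
  apply: (@le_lt_trans _ _ B%:E); last exact: ltry.
  apply/ess_supP; apply: aeW => u /=; rewrite patchE; case: ifPn => _ /=.
    by rewrite lee_fin ger0_norm ?normc_ge0.
  by rewrite normr0 lee_fin.
rewrite lee_fin => r1; have r0 : 0 < r by lra.
rewrite unlock /=.
suff : (\int[lam]_u (`|((EFin \o (fun u : q.-tuple RT => normc (f (torow u)))) \_ cT) u| `^ r)
    < +oo)%E.
  by move=> H; exact: poweR_lty.
apply: (@le_lt_trans _ _ (\int[lam]_(u in cT) (B `^ r)%:E)%E); last first.
  rewrite integral_cst//.
  apply: (eq_ind_r (fun z => ((B `^ r)%:E * z < +oo)%E) _ (lebesgueq_cell R q)).
  by rewrite -EFinM ltry.
rewrite [leRHS]integral_mkcond.
have m1 : measurable_fun setT (fun u : q.-tuple RT =>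
    (`|((EFin \o (fun u : q.-tuple RT => normc (f (torow u)))) \_ cT) u| `^ r)%E).
  apply: (measurableT_comp (f := fun z : \bar R => (z `^ r)%E)); first exact: measurable_poweR.
  apply: measurableT_comp => //; apply/(measurable_restrictT _ _).1 => //.
  by apply/measurable_EFinP/measurable_funTS.
have m2 : measurable_fun setT ((fun _ : q.-tuple RT => (B `^ r)%:E) \_ cT).
  by apply/(measurable_restrictT _ _).1.
have n1 (u : q.-tuple RT) : (0 <=
    `|((EFin \o (fun u : q.-tuple RT => normc (f (torow u)))) \_ cT) u| `^ r)%E.
  exact: poweR_ge0.
have n2 (u : q.-tuple RT) : (0 <= ((fun _ : q.-tuple RT => (B `^ r)%:E) \_ cT) u)%E.
  by rewrite patchE; case: ifPn => // _; rewrite lee_fin powR_ge0.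
apply: ge0_le_integral => //.
move=> u _; rewrite !patchE; case: ifPn => _ /=.
  rewrite ger0_norm ?normc_ge0// lee_fin; apply: ge0_powR_le => //; first exact: ltW.
  exact: normc_ge0.
by rewrite normr0 powR0// gt_eqF.
Qed.

Lemma tpoly_Lp (p : \bar R) r a : (1 <= p)%E -> Lp p (tpoly r a).
Proof.
move=> p1; apply: (bounded_Lp p1 (@tpoly_periodic r a) _ _ (@tpoly_bound r a)).
  exact: measurable_Re_tpoly.
exact: measurable_Im_tpoly.
Qed.

End trig_polynomials.

(** * Trigonometric polynomials as Sobolev functions *)

Section trig_sobolev.
Variables (R : realType) (q : nat).
Local Notation RT := (measurableTypeR R).
Local Notation C := (complex R).
Local Notation point := 'rV[R]_q.
Local Notation freq := 'rV[int]_q.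
Local Notation normc := ComplexField.Normc.normc.
Local Notation lam := (lebesgueq q).
Local Notation cT := (@cellT R q).
Implicit Types (f g : point -> C) (x y : point) (k l m : freq) (r : seq freq).

Lemma Rintegral_cos (k : 'I_q -> int) (be : R) :
  \int[lam]_(u in cT) cos (theta k (tnth u) + be) =
  (2 * pi) ^+ q * (cos be * \prod_i ((k i == 0)%:R : R)).
Proof.
have mc := @measurable_cellT R q.
have i1 : cell_integrable (fun _ : q.-tuple RT => 1 : R).
  by apply: (@cell_integrable_bounded _ _ _ 1) => // u; rewrite normr1.
have ic : cell_integrable (fun u : q.-tuple RT => cos (theta k (tnth u) + be)).
  apply: (@cell_integrable_bounded _ _ _ 1); first exact: measurable_cos_theta.
  by move=> u; rewrite ler_norml cos_geN1 cos_le1.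
have h1 : \int[lam]_(u in cT) (1 + cos (theta k (tnth u) + be)) =
    (2 * pi) ^+ q * (1 + cos be * (\prod_i ((k i == 0)%:R : R))).
  by rewrite /Rintegral integral_cell_cos.
have h2 : \int[lam]_(u in cT) (1 : R) = (2 * pi) ^+ q.
  rewrite Rintegral_cst// mul1r; exact: (congr1 fine (lebesgueq_cell R q)).
by move: h1; rewrite (RintegralD mc i1 ic) h2; lra.
Qed.

Lemma prod_eq0 m : \prod_i ((m 0 i == 0)%:R : R) = (m == 0)%:R.
Proof.
have [->|m0] := eqVneq m 0; first by rewrite big1// => i _; rewrite mxE eqxx.
have [i hi] : exists i, m 0 i != 0.
  apply/existsP; rewrite -negb_forall; apply: contra m0 => /forallP h.
  by apply/eqP/rowP => i; rewrite mxE; exact/eqP/h.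
by rewrite (bigD1 i)//= (negPf hi) mul0r.
Qed.

Lemma Rintegral_cos_dotp m : \int[lam]_(u in cT) cos (dotp m (torow u)) =
  (2 * pi) ^+ q * (m == 0)%:R :> R.
Proof.
have := Rintegral_cos (fun i => m 0 i) 0; rewrite cos0 mul1r prod_eq0 => <-.
by apply: eq_Rintegral => u _; rewrite dotp_torow addr0.
Qed.

Lemma Rintegral_sin_dotp m : \int[lam]_(u in cT) sin (dotp m (torow u)) = 0 :> R.
Proof.
transitivity (\int[lam]_(u in cT) cos (theta (fun i => m 0 i) (tnth u) + - (pi / 2)) : R).
  by apply: eq_Rintegral => u _; rewrite dotp_torow cosBpihalf.
by rewrite Rintegral_cos cosN cos_pihalf mul0r mulr0.
Qed.

(** Orthogonality of the characters. The list [r] may contain repetitions, hence the sums of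
    indicators. *)
Lemma fourier_tpoly r (a : freq -> C) m : fourier (tpoly r a) m =
  Complex (\sum_(k <- r) complex.Re (a k) * (k == m)%:R)
          (\sum_(k <- r) complex.Im (a k) * (k == m)%:R).
Proof.
have mc := @measurable_cellT R q.
have P0 : (2 * pi) ^+ q != 0 :> R by rewrite expf_neq0// mulf_neq0// gt_eqF// pi_gt0.
have E x : tpoly r a x * expi (- m) x = tpoly r (fun k => a k * expi (- m) x) x.
  by rewrite /tpoly mulr_suml; apply: eq_bigr => k _; rewrite mulrAC.
have ReE x : complex.Re (tpoly r a x * expi (- m) x) =
    \sum_(k <- r) (complex.Re (a k) * cos (dotp (k - m) x) +
      - complex.Im (a k) * sin (dotp (k - m) x)).
  rewrite /tpoly; elim: r {E} => [|k r IH]; first by rewrite !big_nil mul0r.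
  rewrite !big_cons mulrDl -IH -mulrA !expiE -cisD -dotpD.
  by case: (a k) => b c; case: (\sum_(_ <- _) _) => d e; rewrite /cis/=; ring.
have ImE x : complex.Im (tpoly r a x * expi (- m) x) =
    \sum_(k <- r) (complex.Re (a k) * sin (dotp (k - m) x) +
      complex.Im (a k) * cos (dotp (k - m) x)).
  rewrite /tpoly; elim: r {E ReE} => [|k r IH]; first by rewrite !big_nil mul0r.
  rewrite !big_cons mulrDl -IH -mulrA !expiE -cisD -dotpD.
  by case: (a k) => b c; case: (\sum_(_ <- _) _) => d e; rewrite /cis/=; ring.
have ic k : cell_integrable (fun u : q.-tuple RT => cos (dotp k (torow u))).
  apply: (@cell_integrable_bounded _ _ _ 1); first exact: measurable_cos_dotp.
  by move=> u; rewrite ler_norml cos_geN1 cos_le1.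
have isn k : cell_integrable (fun u : q.-tuple RT => sin (dotp k (torow u))).
  apply: (@cell_integrable_bounded _ _ _ 1); first exact: measurable_sin_dotp.
  by move=> u; rewrite ler_norml sin_geN1 sin_le1.
have kmE (k : freq) : (k - m == 0) = (k == m) by rewrite subr_eq0.
have lin (b c : freq -> R) :
    (\int[lam]_(u in cT) (\sum_(k <- r) (b k * cos (dotp (k - m) (torow u)) +
       c k * sin (dotp (k - m) (torow u)))) : R) =
    (2 * pi) ^+ q * \sum_(k <- r) b k * (k == m)%:R.
  rewrite Rintegral_sum//; last first.
    move=> k; have := integrableD mc (integrable_RZl mc (b k) (ic (k - m)))
      (integrable_RZl mc (c k) (isn (k - m))).
    by apply: eq_integrable.
  rewrite mulr_sumr; apply: eq_bigr => k _.
  rewrite (RintegralD mc (integrable_RZl mc (b k) (ic (k - m)))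
     (integrable_RZl mc (c k) (isn (k - m)))).
  rewrite (RintegralZl _ mc (ic _)) (RintegralZl _ mc (isn _)).
  by rewrite Rintegral_cos_dotp Rintegral_sin_dotp mulr0 addr0 kmE; ring.
rewrite /fourier /integral_cell.
have -> : \int[lam]_(u in torow @^-1` cell) complex.Re (tpoly r a (torow u) * expi (- m) (torow u)) =
    (2 * pi) ^+ q * \sum_(k <- r) complex.Re (a k) * (k == m)%:R.
  by rewrite -(lin _ (fun k => - complex.Im (a k))); apply: eq_Rintegral => u _; exact: ReE.
have -> : \int[lam]_(u in torow @^-1` cell) complex.Im (tpoly r a (torow u) * expi (- m) (torow u)) =
    (2 * pi) ^+ q * \sum_(k <- r) complex.Im (a k) * (k == m)%:R.
  rewrite -(lin _ (fun k => complex.Re (a k))); apply: eq_Rintegral => u _.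
  by rewrite ImE; apply: eq_bigr => k _; rewrite addrC.
by simpc; rewrite !mulrA mulVf// !mul1r.
Qed.

Lemma derive_cos_lipschitz (a b : R) : `|cos a - cos b| <= `|a - b|.
Proof.
have := @derive_bound_abs R cos (fun z => - sin z) 1 b a (fun z => is_derive_cos z).
rewrite mul1r; apply => z _; rewrite normrN ler_norml sin_geN1 sin_le1//.
Qed.

Lemma derive_sin_lipschitz (a b : R) : `|sin a - sin b| <= `|a - b|.
Proof.
have := @derive_bound_abs R sin cos 1 b a (fun z => is_derive_sin z).
rewrite mul1r; apply => z _; rewrite ler_norml cos_geN1 cos_le1//.
Qed.

Lemma expi_lipschitz k x y : normc (expi k y - expi k x) <=
  2 * \sum_i `|(k 0 i)%:~R| * `|y 0 i - x 0 i|.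
Proof.
apply: le_trans (normc_le_ReIm _) _; rewrite !expiE /cis/=.
have h : `|dotp k y - dotp k x| <= \sum_i `|(k 0 i)%:~R| * `|y 0 i - x 0 i|.
  rewrite /dotp -sumrB; apply: le_trans (ler_norm_sum _ _ _) _.
  by apply: ler_sum => i _; rewrite -mulrBr normrM.
have := derive_cos_lipschitz (dotp k y) (dotp k x).
have := derive_sin_lipschitz (dotp k y) (dotp k x).
by lra.
Qed.

Lemma tpoly_continuous r (a : freq -> C) : continuous (tpoly r a : point -> C^o).
Proof.
apply/continuous_ReIm => x e e0.
pose L := \sum_(k <- r) normc (a k) * (2 * \sum_i `|(k 0 i)%:~R : R|).
have L0 : 0 <= L.
  apply: sumr_ge0 => k _; apply: mulr_ge0; first exact: normc_ge0.
  by apply: mulr_ge0 => //; apply: sumr_ge0.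
have L1 : 0 < L + 1 by lra.
exists (e / (L + 1)); first exact: divr_gt0.
move=> y hy; have d0 : 0 < e / (L + 1) by exact: divr_gt0.
apply: (@le_lt_trans _ _ (L * (e / (L + 1)))).
  rewrite /tpoly -sumrB; apply: le_trans (normc_sum _ _) _.
  rewrite mulr_suml; apply: ler_sum => k _.
  rewrite -mulrBr ComplexField.Normc.normcM -mulrA.
  apply: ler_wpM2l; first exact: normc_ge0.
  apply: le_trans (expi_lipschitz _ _ _) _; rewrite -mulrA ler_pM2l// mulr_suml.
  by apply: ler_sum => i _; apply: ler_wpM2l => //; exact: ltW.
rewrite mulrA ltr_pdivrMr// mulrC ltr_pM2l//; lra.
Qed.

(** The derivative of order s is the polynomial with coefficients multiplied by the weights. This
    makes the estimates for Sobolev functions available for the interpolants. *)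
Lemma trig_csobolev (p : \bar R) (s t : R) f : (1 <= p)%E -> trig_space t f ->
  csobolev p s f.
Proof.
move=> p1 [a _ <-]; rewrite trigpolyE; set r := finmap.enum_fset _.
split; last exact: tpoly_continuous.
split; first exact: tpoly_Lp.
exists (tpoly r (fun k => weight s k * a k)); split; first exact: tpoly_Lp.
move=> m; rewrite !fourier_tpoly weightE; simpc.
congr Complex; rewrite mulr_sumr; apply: eq_bigr => k _; rewrite weightE.
  have [->|_] := eqVneq k m; last by rewrite !mulr0.
  by rewrite !mulr1; case: (a m) => b c /=; rewrite mul0r subr0.
have [->|_] := eqVneq k m; last by rewrite !mulr0.
by rewrite !mulr1; case: (a m) => b c /=; rewrite mul0r addr0.
Qed.

End trig_sobolev.

(** * Zeros of differences of Sobolev functions *)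
Section sobolev_estimates.
Variables (R : realType) (q : nat).
Local Notation RT := (measurableTypeR R).
Local Notation C := (complex R).
Local Notation point := 'rV[R]_q.
Local Notation freq := 'rV[int]_q.
Local Notation normc := ComplexField.Normc.normc.
Local Notation lam := (lebesgueq q).
Local Notation cT := (@cellT R q).
Implicit Types (f g : point -> C) (D : point -> R) (x y z : point) (k : freq) (Y : set point).

Lemma csobolev_sderiv (p : \bar R) s f : csobolev p s f -> is_sderiv p s f (sderiv p s f).
Proof. by move=> [[_ ex] _]; exact: xgetPex. Qed.

Lemma Wnorm_fin (p : \bar R) s f : csobolev p s f ->
  Wnorm p s f = (fine (Wnorm p s f))%:E /\ 0 <= fine (Wnorm p s f).
Proof.
move=> /csobolev_sderiv[[_ _ _ fin] _].
have n0 : (0 <= Wnorm p s f)%E by rewrite /Wnorm LpnormE Lnorm_ge0.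
by rewrite fineK ?fine_ge0// ge0_fin_numE.
Qed.

Definition interp_err m (D : point -> R) x i (c de : R) : R :=
  `|D x - \sum_(j < m) (lpoly R j).[(x 0 i - c) / de] * D (upd x i (c + de * lnode R j))|.

Definition sup_continuous D := forall x (e : R), 0 < e -> exists2 d : R, 0 < d &
  forall y, (forall i, `|y 0 i - x 0 i| < d) -> `|D y - D x| < e.

Lemma csobolev_parts (p : \bar R) s f : csobolev p s f ->
  [/\ sup_continuous (fun y => complex.Re (f y)),
      sup_continuous (fun y => complex.Im (f y)),
      exists Mb, forall y, `|complex.Re (f y)| <= Mb &
      exists Mb, forall y, `|complex.Im (f y)| <= Mb].
Proof.
move=> [[[pf _ _ _] _] cf].
have cfe := (continuous_ReIm f).2 cf.
have cR (y : point) (e : R) : 0 < e -> exists2 d : R, 0 < d & forall z : point,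
    (forall i, `|z 0 i - y 0 i| < d) -> `|complex.Re (f z) - complex.Re (f y)| < e.
  move=> e0; have [d d0 hd] := cfe y e e0; exists d => // z hz.
  apply: le_lt_trans (hd z hz); apply: le_trans (Re_le_normc _).
  by case: (f z) => ? ?; case: (f y).
have cI (y : point) (e : R) : 0 < e -> exists2 d : R, 0 < d & forall z : point,
    (forall i, `|z 0 i - y 0 i| < d) -> `|complex.Im (f z) - complex.Im (f y)| < e.
  move=> e0; have [d d0 hd] := cfe y e e0; exists d => // z hz.
  apply: le_lt_trans (hd z hz); apply: le_trans (Im_le_normc _).
  by case: (f z) => ? ?; case: (f y).
have pR y k : complex.Re (f (y + (2 * pi) *: intvec k)) = complex.Re (f y) by rewrite pf.
have pI y k : complex.Im (f (y + (2 * pi) *: intvec k)) = complex.Im (f y) by rewrite pf.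
have [MR hMR] := @periodic_bounded R q (fun y => complex.Re (f y)) cR pR.
have [MI hMI] := @periodic_bounded R q (fun y => complex.Im (f y)) cI pI.
by split=> //; [exists MR|exists MI].
Qed.

Lemma sobolev_interp_err (p : \bar R) (s ka : R) (m : nat) : (1 <= p)%E -> (0 < m)%N ->
  0 < ka -> 2 * ka < m%:R -> 2 * ka <= s - qdivp q p ->
  exists2 Ci : R, 0 < Ci & forall f, csobolev p s f ->
    forall x i c de, 0 < de -> `|x 0 i - c| <= 2 * de ->
    let E := Ci * fine (Wnorm p s f) * de `^ (2 * ka) in
    interp_err m (fun y => complex.Re (f y)) x i c de <= E /\
    interp_err m (fun y => complex.Im (f y)) x i c de <= E.
Proof.
move=> p1 m0 ka0 km ks.
have [Ci Ci0 hCi] := @interp_error_real R q p s ka m p1 m0 ka0 km ks.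
exists Ci => // f sf x i c de de0 hx /=.
have [WE W0] := Wnorm_fin sf; set W := fine (Wnorm p s f) in WE W0 *.
have [Lg gf] := csobolev_sderiv sf; set g := sderiv p s f in Lg gf.
have [[Lf _] _] := sf; have [pf mRf mIf _] := Lf.
have [_ mRg mIg _] := Lg.
have [cR cI [MR hMR] [MI hMI]] := csobolev_parts sf.
have pR y k : complex.Re (f (y + (2 * pi) *: intvec k)) = complex.Re (f y) by rewrite pf.
have pI y k : complex.Im (f (y + (2 * pi) *: intvec k)) = complex.Im (f y) by rewrite pf.
have mh := measurable_normc Lg.
have dl0 : 0 <= de `^ (2 * ka) := powR_ge0 _ _.
have hB e : 0 < e -> 0 < W + e /\
    (Lnorm lam p ((EFin \o (fun u : q.-tuple RT => normc (g (torow u)))) \_ cT) <= (W + e)%:E)%E.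
  move=> e0; split; first by rewrite ltr_wpDl.
  by rewrite -LpnormE -[Lpnorm _ _]/(Wnorm p s f) WE lee_fin lerDl ltW.
(* [interp_error_real] asks for a positive bound on the norm, whereas W may be 0; so it is applied
   with W + e for every e > 0. *)
have lim (z : R) : (forall e, 0 < e -> z <= Ci * (W + e) * de `^ (2 * ka)) ->
    z <= Ci * W * de `^ (2 * ka).
  move=> h; apply/ler_addgt0Pr => e e0.
  have K0 : 0 < Ci * de `^ (2 * ka) + 1 by rewrite ltr_wpDl// mulr_ge0// ltW.
  have := h (e / (Ci * de `^ (2 * ka) + 1)); rewrite divr_gt0// => /(_ isT) H.
  apply: le_trans H _; rewrite mulrDr mulrDl lerD2l.
  have -> : Ci * (e / (Ci * de `^ (2 * ka) + 1)) * de `^ (2 * ka) =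
    e * (Ci * de `^ (2 * ka)) / (Ci * de `^ (2 * ka) + 1) by ring.
  by rewrite ler_pdivrMr// ler_pM2l// lerDl.
split; apply: lim => e e0; have [B0 hL] := hB e e0.
- apply: (hCi (fun y => complex.Re (f y)) (ReT g)
    (fun u => normc (g (torow u))) (W + e) MR cR pR hMR mRf B0) => //.
  + exact: integrable_ReT Lg.
  + by move=> u; exact: Re_le_normc.
  + by move=> k be; have [] := cosint_sderiv k p1 Lf Lg gf be.
- apply: (hCi (fun y => complex.Im (f y)) (ImT g)
    (fun u => normc (g (torow u))) (W + e) MI cI pI hMI mIf B0) => //.
  + exact: integrable_ImT Lg.
  + by move=> u; exact: Im_le_normc.
  + by move=> k be; have [] := cosint_sderiv k p1 Lf Lg gf be.
Qed.

Lemma interp_err_sub m D1 D2 x i (c de E1 E2 : R) :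
  interp_err m D1 x i c de <= E1 -> interp_err m D2 x i c de <= E2 ->
  interp_err m (fun y => D1 y - D2 y) x i c de <= E1 + E2.
Proof.
move=> h1 h2; apply: le_trans (lerD h1 h2); rewrite /interp_err.
rewrite [X in `|X| <= _](_ : _ = (D1 x - \sum_(j < m) (lpoly R j).[(x 0 i - c) / de] *
   D1 (upd x i (c + de * lnode R j))) - (D2 x - \sum_(j < m)
   (lpoly R j).[(x 0 i - c) / de] * D2 (upd x i (c + de * lnode R j)))).
  exact: ler_normB.
under eq_bigr do rewrite mulrBr.
by rewrite sumrB; ring.
Qed.

(* [mixp x z j] agrees with [z] on the first [j] coordinates and with [x] on the others *)
Definition mixp (x z : point) (j : nat) : point := \row_i (if (i < j)%N then z 0 i else x 0 i).

Lemma mixp0 (x z : point) : mixp x z 0 = x.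
Proof. by apply/rowP => i; rewrite mxE. Qed.

Lemma mixpq (x z : point) : mixp x z q = z.
Proof. by apply/rowP => i; rewrite mxE ltn_ord. Qed.

Lemma mixpS x z (i : 'I_q) : mixp x z i.+1 = upd (mixp x z i) i (z 0 i).
Proof.
apply/rowP => l; rewrite !mxE ltnS leq_eqVlt -val_eqE/=.
by case: eqP => //= /val_inj ->.
Qed.

Lemma upd_mixpS x z (i : 'I_q) (r : R) : upd (mixp x z i.+1) i r = upd (mixp x z i) i r.
Proof.
by rewrite mixpS; apply/rowP => l; rewrite !mxE; case: eqP.
Qed.

Lemma path_bound D x z (A : R) :
  (forall i : 'I_q, `|D (mixp x z i) - D (mixp x z i.+1)| <= A) ->
  `|D x - D z| <= q%:R * A.
Proof.
move=> h.
suff H j : (j <= q)%N -> `|D (mixp x z 0) - D (mixp x z j)| <= j%:R * A.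
  by have := H q (leqnn q); rewrite mixp0 mixpq.
elim: j => [|j IH] jq; first by rewrite subrr normr0 mul0r.
rewrite -(subrK (D (mixp x z j)) (D (mixp x z 0))) -addrA -natr1 mulrDl mul1r.
apply: le_trans (ler_normD _ _) _; apply: lerD; first exact: IH (ltnW jq).
exact: (h (Ordinal jq)).
Qed.

(** For m = 1 the interpolant of D along coordinate i is the value of D with that coordinate
    replaced by z_i. The error hypothesis thus bounds each step of the path from x to z, where D
    vanishes. *)
Lemma small_error_near_zero D x z (de E : R) : 0 < de ->
  (forall i, `|x 0 i - z 0 i| <= 2 * de) -> D z = 0 ->
  (forall y i, `|y 0 i - z 0 i| <= 2 * de -> interp_err 1 D y i (z 0 i) de <= E) ->
  `|D x| <= q%:R * E.
Proof.
move=> de0 hz Dz hE; rewrite -[D x]subr0 -Dz; apply: path_bound => i.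
have := hE (mixp x z i) i; rewrite mxE ltnn => /(_ (hz i)).
rewrite /interp_err big_ord1 /lpoly big_pred0; last by move=> j; rewrite !ord1 eqxx.
by rewrite hornerE mul1r /lnode mul0r mulr0 addr0 -mixpS.
Qed.

Lemma zeros_bound m (K ga : R) D x0 (de E Mb : R) : (0 < m)%N -> 0 <= K ->
  (forall (j : 'I_m) a b, `|a| <= 2 -> `|b| <= 2 ->
     `|(lpoly R j).[a]| <= K /\ `|(lpoly R j).[a] - (lpoly R j).[b]| <= K * `|a - b|) ->
  0 <= ga -> ga <= 1 -> q%:R * (m%:R * K * ga) * (1 + m%:R * K) ^+ q <= 2^-1 ->
  0 < de -> 0 <= E -> (forall y, `|D y| <= Mb) ->
  (forall y i, `|y 0 i - x0 0 i| <= 2 * de -> interp_err m D y i (x0 0 i) de <= E) ->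
  (forall x, box x0 de x -> exists2 z, D z = 0 & forall i, `|x 0 i - z 0 i| <= ga * de) ->
  forall x, box x0 de x -> `|D x| <= (4 * q%:R + 1) * E.
Proof.
move=> m0 K0 hK ga0 ga1 hga de0 E0 DM hE hZ.
pose La := 1 + m%:R * K; have La1 : 1 <= La by rewrite lerDl mulr_ge0.
have La0 : 0 <= La by exact: le_trans La1.
have boxE x : box x0 de x <-> forall i, `|x 0 i - x0 0 i| <= de.
  split=> h i; have := h i; rewrite ?in_itv/= ler_distl//.
have nodeP (l : 'I_m) : 0 <= de * lnode R l /\ de * lnode R l <= de.
  by have /andP[t0 t1] := lnode_itv R l; rewrite mulr_ge0 ?(ltW de0)// ler_piMr ?(ltW de0).
(* A bound [B] on the box extends to the doubled box, one coordinate at a time,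
   and the path from a zero of [D] then halves it, up to a multiple of [E]. *)
have step B : 0 <= B -> (forall x, box x0 de x -> `|D x| <= B) ->
    forall x, box x0 de x -> `|D x| <= (2 * q%:R + 2^-1) * E + B / 2.
  move=> B0 hB.
  (* The first j coordinates may range over the doubled box. Interpolation in the next coordinate
     uses only nodes inside the original interval, to which the induction hypothesis applies. *)
  have ext j : forall x, (forall i : 'I_q, `|x 0 i - x0 0 i| <= 2 * de) ->
      (forall i : 'I_q, (j <= i)%N -> `|x 0 i - x0 0 i| <= de) ->
      `|D x| <= La ^+ j * (E + B).
    elim: j => [|j IH] x h2 h1.
      rewrite expr0 mul1r; apply: le_trans (hB x _) _; last by rewrite lerDr.
      by apply/boxE => i; exact: h1.
    have [jq|jq] := ltnP j q; last first.
      apply: le_trans (IH x h2 _) _.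
        by move=> i ji; have := ltn_ord i; rewrite ltnNge (leq_trans jq ji).
      apply: ler_wpM2r; first exact: addr_ge0.
      by rewrite exprS ler_peMl// exprn_ge0.
    pose i := Ordinal jq; have hi := hE x i (h2 i).
    have nodes (l : 'I_m) : `|D (upd x i (x0 0 i + de * lnode R l))| <= La ^+ j * (E + B).
      have [t0 t1] := nodeP l.
      apply: IH => i'; rewrite mxE.
        case: eqP => [->|_]; last exact: h2.
        by rewrite addrC addKr ger0_norm//; lra.
      move=> ji; case: eqP => [->|/eqP ii].
        by rewrite addrC addKr ger0_norm//; lra.
      by apply: h1; rewrite ltn_neqAle ji andbT eq_sym.
    rewrite exprS -mulrA /La mulrDl mul1r -/La.
    have X0 : 0 <= La ^+ j * (E + B).
      by apply: mulr_ge0; [exact: exprn_ge0|exact: addr_ge0].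
    have EX : E <= La ^+ j * (E + B).
      apply: (@le_trans _ _ (E + B)); first by rewrite lerDl.
      by rewrite ler_peMl ?addr_ge0// exprn_ege1.
    rewrite /interp_err in hi.
    set S := \sum_(l < m) _ in hi.
    have -> : D x = (D x - S) + S by rewrite subrK.
    apply: le_trans (ler_normD _ _) _; apply: lerD; first exact: le_trans EX.
    apply: le_trans (ler_norm_sum _ _ _) _.
    rewrite -mulrA mulr_natl -[X in _ *+ X]card_ord -sumr_const.
    apply: ler_sum => l _; rewrite normrM; apply: ler_pM => //.
    have a2 : `|(x 0 i - x0 0 i) / de| <= 2.
      by rewrite normrM normfV (gtr0_norm de0) ler_pdivrMr.
    by have [] := hK l _ _ a2 a2.
  have ext2 x : (forall i : 'I_q, `|x 0 i - x0 0 i| <= 2 * de) ->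
      `|D x| <= La ^+ q * (E + B).
    by move=> h2; apply: ext => // i; rewrite leqNgt ltn_ord.
  set M2 := La ^+ q * (E + B) in ext2.
  have M20 : 0 <= M2 by apply: mulr_ge0; [exact: exprn_ge0|exact: addr_ge0].
  move=> x /[dup] xK /boxE hx; have [z Dz hz] := hZ x xK.
  have hz2 i : `|z 0 i - x0 0 i| <= 2 * de.
    have -> : z 0 i - x0 0 i = - (x 0 i - z 0 i) + (x 0 i - x0 0 i) by ring.
    apply: le_trans (ler_normD _ _) _; rewrite normrN.
    by have := hz i; have := hx i; nra.
  have hx2 i : `|x 0 i - x0 0 i| <= 2 * de by have := hx i; lra.
  have mix2 j (i : 'I_q) : `|(mixp x z j) 0 i - x0 0 i| <= 2 * de.
    by rewrite mxE; case: ifP.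
  (* The two points differ in coordinate i alone, so their interpolants use the same nodes. They
     differ only through the Lagrange polynomials, at arguments at most ga apart, and the Lipschitz
     bound supplies the small factor ga. *)
  have stepi (i : 'I_q) : `|D (mixp x z i) - D (mixp x z i.+1)| <=
      2 * E + m%:R * K * ga * M2.
    have e1 := hE _ i (mix2 i i); have e2 := hE _ i (mix2 i.+1 i).
    rewrite /interp_err in e1 e2.
    move: e1 e2; under [in X in _ -> X -> _]eq_bigr do rewrite upd_mixpS.
    have -> : mixp x z i 0 i = x 0 i by rewrite mxE ltnn.
    have -> : mixp x z i.+1 0 i = z 0 i by rewrite mxE ltnS leqnn.
    set a := (x 0 i - _) / de; set b := (z 0 i - _) / de.
    set S1 := \sum_(_ < m) _; set S2 := \sum_(_ < m) _ => e1 e2.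
    have -> : D (mixp x z i) - D (mixp x z i.+1) =
      (D (mixp x z i) - S1) - (D (mixp x z i.+1) - S2) + (S1 - S2) by ring.
    apply: le_trans (ler_normD _ _) _; apply: lerD.
      apply: le_trans (ler_normB _ _) _; lra.
    rewrite /S1 /S2 -sumrB; apply: le_trans (ler_norm_sum _ _ _) _.
    have -> : m%:R * K * ga * M2 = \sum_(l < m) (K * ga) * M2.
      by rewrite sumr_const card_ord -[_ *+ m]mulr_natl; ring.
    apply: ler_sum => l _; rewrite -mulrBl normrM; apply: ler_pM => //.
      have a2 : `|a| <= 2 by rewrite normrM normfV (gtr0_norm de0) ler_pdivrMr.
      have b2 : `|b| <= 2 by rewrite normrM normfV (gtr0_norm de0) ler_pdivrMr.
      have [_ h] := hK l a b a2 b2; apply: le_trans h _; apply: ler_wpM2l => //.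
      have -> : a - b = (x 0 i - z 0 i) / de by rewrite /a /b; ring.
      by rewrite normrM normfV (gtr0_norm de0) ler_pdivrMr.
    apply: ext2 => i'; rewrite mxE; case: eqP => [->|_]; last exact: mix2.
    have [t0 t1] := nodeP l.
    by rewrite addrC addKr ger0_norm//; lra.
  have := path_bound stepi; rewrite Dz subr0 => H; apply: le_trans H _.
  have : q%:R * (m%:R * K * ga * M2) <= 2^-1 * (E + B).
    have -> : q%:R * (m%:R * K * ga * M2) =
       q%:R * (m%:R * K * ga) * La ^+ q * (E + B) by rewrite /M2; ring.
    by apply: ler_wpM2r => //; exact: addr_ge0.
  by rewrite mulrDr; lra.
(* The a priori bound Mb makes the supremum finite, so that sup <= (2 q + 1/2) E + sup / 2 can be
   solved for it. *)
pose A := [set `|D x| | x in box x0 de].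
have x0K : box x0 de x0 by apply/boxE => i; rewrite subrr normr0 ltW.
have hub : has_ubound A by exists Mb => _ [x _ <-]; exact: DM.
have Sub x : box x0 de x -> `|D x| <= sup A.
  by move=> xK; apply: ub_le_sup => //; exists x.
have S0 : 0 <= sup A by apply: le_trans (Sub _ x0K).
have : sup A <= (2 * q%:R + 2^-1) * E + sup A / 2.
  apply: ge_sup; first by exists `|D x0|; exists x0.
  by move=> _ [x xK <-]; exact: step.
move=> H x xK; apply: le_trans (Sub x xK) _; lra.
Qed.

Lemma le_enorm x i : `|x 0 i| <= enorm x.
Proof.
rewrite -sqrtr_sqr /enorm ler_wsqrtr// (bigD1 i)//= lerDl.
by apply: sumr_ge0 => j _; exact: sqr_ge0.
Qed.

Lemma enorm_ge0 x : 0 <= enorm x. Proof. exact: sqrtr_ge0. Qed.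

Lemma dist_set_lt Y x (r : R) : Y !=set0 -> dist_set Y x < r ->
  exists2 y, Y y & exists k, forall i, `|x 0 i - (y - (2 * pi) *: intvec k) 0 i| < r.
Proof.
move=> [y0 Yy0] h.
have [y Yy hy] : exists2 y, Y y & tdist x y < r.
  apply: contrapT => hn; move: h; apply/negP; rewrite -leNgt.
  apply: lb_le_inf; first by exists (tdist x y0); exists y0.
  move=> _ [y Yy <-]; rewrite leNgt; apply/negP => hy; apply: hn; exists y => //.
exists y => //.
have [k hk] : exists k, enorm (x - y + (2 * pi) *: intvec k) < r.
  apply: contrapT => hn; move: hy; apply/negP; rewrite -leNgt.
  apply: lb_le_inf; first by exists (enorm (x - y + (2 * pi) *: intvec 0)); exists 0.
  move=> _ [k _ <-]; rewrite leNgt; apply/negP => hk; apply: hn; by exists k.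
exists k => i; apply: le_lt_trans hk; apply: le_trans (le_enorm _ i).
by rewrite le_eqVlt; apply/orP; left; apply/eqP; congr `|_|; rewrite !mxE; ring.
Qed.

Lemma tdist_ge0 x y : 0 <= tdist x y.
Proof.
apply: lb_le_inf; first by exists (enorm (x - y + (2 * pi) *: intvec 0)); exists 0.
by move=> _ [k _ <-]; exact: enorm_ge0.
Qed.

(** A supremum dominates its members only if the set is bounded above; the explicit bound measures
    distances to one fixed point of Y. *)
Lemma dist_set_le_mesh Y x0 (de : R) x : Y !=set0 -> box x0 de x ->
  dist_set Y x <= mesh_norm Y (box x0 de).
Proof.
move=> [y0 Yy0] xK; apply: ub_le_sup; last by exists x.
exists (Num.sqrt (\sum_i (`|x0 0 i - y0 0 i| + de) ^+ 2)) => _ [y yK <-].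
apply: (@le_trans _ _ (tdist y y0)).
  apply: ge_inf; last by exists y0.
  by exists 0 => _ [z _ <-]; exact: tdist_ge0.
apply: (@le_trans _ _ (enorm (y - y0 + (2 * pi) *: intvec 0))).
  apply: ge_inf; last by exists 0.
  by exists 0 => _ [k _ <-]; exact: enorm_ge0.
rewrite /enorm ler_wsqrtr//; apply: ler_sum => i _; rewrite !mxE mulr0 addr0.
rewrite -real_normK ?num_real//; have := yK i; rewrite in_itv/= -ler_distl => h.
apply: lerXn2r; rewrite ?nnegrE//.
  by rewrite addr_ge0// (le_trans _ h).
have -> : y 0 i - y0 0 i = (x0 0 i - y0 0 i) + (y 0 i - x0 0 i) by ring.
by apply: le_trans (ler_normD _ _) _; rewrite lerD2l.
Qed.

End sobolev_estimates.

(** * Sobolev functions that agree at one point or on a dense set of points *)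

Section difference_estimates.
Variables (R : realType) (q : nat).
Local Notation C := (complex R).
Local Notation point := 'rV[R]_q.
Local Notation normc := ComplexField.Normc.normc.
Implicit Types (f g : point -> C) (x y z : point).

Lemma difference_near_agreement (p : \bar R) (s : R) : (1 <= p)%E -> qdivp q p < s ->
  exists A be : R, [/\ 0 < A, 0 < be & forall f g, csobolev p s f -> csobolev p s g ->
    forall x z (de : R), 0 < de -> (forall i, `|x 0 i - z 0 i| <= 2 * de) -> f z = g z ->
    normc (f x - g x) <= A * (fine (Wnorm p s f) + fine (Wnorm p s g)) * de `^ be].
Proof.
move=> p1 bs; pose ka := Num.min ((s - qdivp q p) / 2) 4^-1.
have ka0 : 0 < ka by rewrite lt_min; lra.
have ka1 : ka <= (s - qdivp q p) / 2 by rewrite ge_min lexx.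
have ka2 : ka <= 4^-1 by rewrite ge_min lexx orbT.
have [||B B0 hB] := @sobolev_interp_err R q p s ka 1 p1 isT ka0; [lra|lra|].
have q0 : 0 <= q%:R :> R by [].
exists (2 * q%:R * B + 1), (2 * ka); split; [by nra|lra|].
move=> f g sf sg x z de de0 hz fg.
pose Wf := fine (Wnorm p s f); have Wf0 : 0 <= Wf := (Wnorm_fin sf).2.
pose Wg := fine (Wnorm p s g); have Wg0 : 0 <= Wg := (Wnorm_fin sg).2.
change (normc (f x - g x) <= (2 * q%:R * B + 1) * (Wf + Wg) * de `^ (2 * ka)).
have d0 : 0 <= de `^ (2 * ka) := powR_ge0 _ _.
set E := B * Wf * de `^ (2 * ka) + B * Wg * de `^ (2 * ka).
have part (h : C -> R) : (forall y i, `|y 0 i - z 0 i| <= 2 * de ->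
      interp_err 1 (fun y => h (f y) - h (g y)) y i (z 0 i) de <= E) ->
    `|h (f x) - h (g x)| <= q%:R * E.
  move=> hE; apply: (small_error_near_zero (D := fun y => h (f y) - h (g y)) de0 hz) => //.
  by rewrite fg subrr.
have hR := part (@complex.Re R); have hI := part (@complex.Im R).
apply: le_trans (normc_le_ReIm _) _.
have -> : complex.Re (f x - g x) = complex.Re (f x) - complex.Re (g x).
  by case: (f x) => ? ?; case: (g x).
have -> : complex.Im (f x - g x) = complex.Im (f x) - complex.Im (g x).
  by case: (f x) => ? ?; case: (g x).
apply: (@le_trans _ _ (q%:R * E + q%:R * E)).
  apply: lerD; [apply: hR|apply: hI] => y i hy; apply: interp_err_sub.
  - by have [] := hB f sf y i _ _ de0 hy.
  - by have [] := hB g sg y i _ _ de0 hy.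
  - by have [] := hB f sf y i _ _ de0 hy.
  - by have [] := hB g sg y i _ _ de0 hy.
have W0 : 0 <= (Wf + Wg) * de `^ (2 * ka) by apply: mulr_ge0 (addr_ge0 Wf0 Wg0) d0.
have -> : (2 * q%:R * B + 1) * (Wf + Wg) * de `^ (2 * ka) =
  q%:R * E + q%:R * E + (Wf + Wg) * de `^ (2 * ka) by rewrite /E; ring.
by rewrite lerDl.
Qed.

Lemma difference_dense_agreement (p : \bar R) (s : R) : (1 <= p)%E -> qdivp q p < s ->
  exists A ga : R, [/\ 0 < A, 0 < ga & forall f g, csobolev p s f -> csobolev p s g ->
    forall x0 (de : R), 0 < de ->
    (forall x, box x0 de x -> exists2 z, f z = g z & forall i, `|x 0 i - z 0 i| <= ga * de) ->
    forall x, box x0 de x -> normc (f x - g x) <=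
      A * (fine (Wnorm p s f) + fine (Wnorm p s g)) * de `^ (s - qdivp q p)].
Proof.
move=> p1 bs; set b := qdivp q p in bs *.
have sb0 : 0 < s - b by rewrite subr_gt0.
pose m := Num.bound (s - b).
(* Enough nodes to use 2 ka = s - q/p, the full rate. *)
have mb : s - b < m%:R by apply: archi_boundP; exact: ltW.
have m0 : (0 < m)%N by rewrite -(ltr_nat R); exact: lt_trans mb.
have ka0 : 0 < (s - b) / 2 by lra.
have [||B B0 hB] := @sobolev_interp_err R q p s ((s - b) / 2) m p1 m0 ka0;
  [lra|rewrite -/b; lra|].
have [K [K0 hK]] := lpoly_lipschitz R m.
have q0 : 0 <= q%:R :> R by [].
pose S := q%:R * (m%:R * K) * (1 + m%:R * K) ^+ q.
have S0 : 0 <= S by rewrite !mulr_ge0 ?exprn_ge0 ?addr_ge0 ?mulr_ge0.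
(* This value gives both S ga <= 1/2, as [zeros_bound] requires, and ga <= 1. *)
pose ga := (2 * S + 2)^-1.
have ga0 : 0 < ga by rewrite invr_gt0; lra.
have ga1 : ga <= 1 by rewrite invf_le1; lra.
have hga : q%:R * (m%:R * K * ga) * (1 + m%:R * K) ^+ q <= 2^-1.
  have -> : q%:R * (m%:R * K * ga) * (1 + m%:R * K) ^+ q = S * ga by rewrite /S; ring.
  by rewrite ler_pdivrMr; lra.
exists (2 * (4 * q%:R + 1) * B), ga; split; [|exact: ga0|].
  by apply: mulr_gt0 B0; apply: mulr_gt0; lra.
move=> f g sf sg x0 de de0 hz x xK.
pose Wf := fine (Wnorm p s f); have Wf0 : 0 <= Wf := (Wnorm_fin sf).2.
pose Wg := fine (Wnorm p s g); have Wg0 : 0 <= Wg := (Wnorm_fin sg).2.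
change (normc (f x - g x) <= (2 * (4 * q%:R + 1) * B) * (Wf + Wg) * de `^ (s - b)).
have d0 : 0 <= de `^ (s - b) := powR_ge0 _ _.
have e2 : 2 * ((s - b) / 2) = s - b by field.
set E := B * Wf * de `^ (s - b) + B * Wg * de `^ (s - b).
have E0 : 0 <= E.
  exact: addr_ge0 (mulr_ge0 (mulr_ge0 (ltW B0) Wf0) d0) (mulr_ge0 (mulr_ge0 (ltW B0) Wg0) d0).
have part (h : C -> R) : (exists Mb, forall y, `|h (f y)| <= Mb) ->
    (exists Mb, forall y, `|h (g y)| <= Mb) ->
    (forall y i, `|y 0 i - x0 0 i| <= 2 * de ->
      interp_err m (fun y => h (f y) - h (g y)) y i (x0 0 i) de <= E) ->
    `|h (f x) - h (g x)| <= (4 * q%:R + 1) * E.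
  move=> [M1 hM1] [M2 hM2] hE.
  apply: (zeros_bound (D := fun y => h (f y) - h (g y)) m0 K0 hK (ltW ga0) ga1 hga de0 E0
    (Mb := M1 + M2)) xK => // [y|y yK].
    exact: le_trans (ler_normB _ _) (lerD (hM1 y) (hM2 y)).
  by have [z fg hz'] := hz y yK; exists z => //; rewrite fg subrr.
have [_ _ bRf bIf] := csobolev_parts sf; have [_ _ bRg bIg] := csobolev_parts sg.
have hR := part (@complex.Re R) bRf bRg; have hI := part (@complex.Im R) bIf bIg.
apply: le_trans (normc_le_ReIm _) _.
have -> : complex.Re (f x - g x) = complex.Re (f x) - complex.Re (g x).
  by case: (f x) => ? ?; case: (g x).
have -> : complex.Im (f x - g x) = complex.Im (f x) - complex.Im (g x).
  by case: (f x) => ? ?; case: (g x).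
have -> : 2 * (4 * q%:R + 1) * B * (Wf + Wg) * de `^ (s - b) =
  (4 * q%:R + 1) * E + (4 * q%:R + 1) * E by rewrite /E; ring.
apply: lerD; [apply: hR|apply: hI] => y i hy; apply: interp_err_sub.
- by have [] := hB f sf y i _ _ de0 hy; rewrite e2.
- by have [] := hB g sg y i _ _ de0 hy; rewrite e2.
- by have [] := hB f sf y i _ _ de0 hy; rewrite e2.
- by have [] := hB g sg y i _ _ de0 hy; rewrite e2.
Qed.

Lemma Lpnorm_oo_le K f (B : R) : 0 <= B -> (forall x, K x -> normc (f x) <= B) ->
  (LpnormK K +oo f <= B%:E)%E.
Proof.
move=> B0 h; rewrite /LpnormK unlock; case: ifP => _; last by rewrite lee_fin.
apply/ess_supP; apply: nearW => u /=; rewrite patchE; case: ifP => [/set_mem uK|_].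
  by rewrite lee_fin ger0_norm ?normc_ge0//; exact: h.
by rewrite abse0 lee_fin.
Qed.

(** A point of Y is close to x only modulo the period; by periodicity both functions also agree at
    its translate near x. *)
Lemma interpolates_near Y f g x (r : R) : Defs.periodic f -> Defs.periodic g ->
  interpolates Y f g -> Y !=set0 -> dist_set Y x < r ->
  exists2 z, f z = g z & forall i, `|x 0 i - z 0 i| < r.
Proof.
move=> pf pg fg Y0 /(dist_set_lt Y0)[y Yy [k hk]].
exists (y - (2 * pi) *: intvec k) => //.
by rewrite -(pf _ k) -(pg _ k) subrK fg.
Qed.

End difference_estimates.

Theorem theorem2p2 (R : realType) (q : nat) (p : \bar R) (s : R)
    (hq : (0 < q)%N) (hp : (1 <= p)%E) (hs : qdivp q p < s)
    (c1 c2 c3 c4 : R) (hc1 : 0 < c1) (hc2 : 0 < c2) (hc3 : 0 < c3)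
    (hc4 : 0 < c4) :
  exists gamma c : R, [/\ 0 < gamma, 0 < c &
    forall (f : 'rV[R]_q -> complex R) (M : nat -> nat)
        (y : forall n, 'I_(M n) -> 'rV[R]_q) (N : nat -> nat)
        (P : nat -> 'rV[R]_q -> complex R),
      csobolev p s f ->
      (forall n j, (0 < n)%N -> cell (y n j)) ->
      (forall n, (0 < n)%N -> exists i j, ~ torus_eq (y n i) (y n j)) ->
      (forall n, (0 < n)%N ->
        admissible_degree c1 c2 c3 p s (range (y n)) (N n)) ->
      (forall n, (0 < n)%N ->
        minimal_interpolant p s (range (y n)) (N n) f (P n)) ->
      (forall n, (0 < n)%N -> (Wnorm p s (P n) <= c4%:E * Wnorm p s f)%E) ->
      (forall (L : nat -> nat) (x0 : 'rV[R]_q),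
        (forall i, (0 < L i)%N) -> {homo L : i j / (i < j)%N} ->
        cell x0 ->
        dist_set (range (y (L i))) x0 @[i --> \oo] --> (0 : R) ->
        (P (L i) x0 : (complex R)^o) @[i --> \oo] --> (f x0 : (complex R)^o))
      /\
      (forall (n : nat) (x0 : 'rV[R]_q) (delta : R),
        (0 < n)%N -> cell x0 -> 0 < delta ->
        mesh_norm (range (y n)) (box x0 delta) <= gamma * delta ->
        (LpnormK (box x0 delta) +oo (f \- P n)%R <=
          (c * delta `^ (s - qdivp q p))%:E * Wnorm p s f)%E)].
Proof.
have [A1 [be [A10 be0 near0]]] := difference_near_agreement hp hs.
have [A2 [ga [A20 ga0 dense]]] := difference_dense_agreement hp hs.
(* Half of [ga] leaves a strict inequality, so that the infimum defining the distance is undercut by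
   an actual node. The factor 1 + c4 bounds the sum of the norms of f and of its interpolant by that
   of f. *)
exists (ga / 2), (A2 * (1 + c4)); split; [lra|by apply: mulr_gt0; lra|].
move=> f M y N P sf _ hY _ hP hW.
have [WE W0] := Wnorm_fin sf; set W := fine _ in WE W0.
have sP n : (0 < n)%N -> csobolev p s (P n).
  by move=> /hP[tP _ _]; exact: trig_csobolev tP.
have WP n : (0 < n)%N -> W + fine (Wnorm p s (P n)) <= (1 + c4) * W.
  move=> n0; have [WPE _] := Wnorm_fin (sP n n0).
  have := hW n n0; rewrite WE WPE -EFinM lee_fin; lra.
have Y0 n : (0 < n)%N -> range (y n) !=set0.
  by move=> /hY[i _]; exists (y n i); exists i.
have pf : Defs.periodic f by have [[[]]] := sf.
have close n x r : (0 < n)%N -> dist_set (range (y n)) x < r ->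
    exists2 z, f z = P n z & forall i, `|x 0 i - z 0 i| < r.
  move=> n0; have [[[pP _ _ _] _] _] := sP n n0; have [_ iP _] := hP n n0.
  by apply: interpolates_near (Y0 n n0) => // z Yz; rewrite iP.
split=> [L x0 L0 _ _ hd|n x0 de n0 _ de0 hmesh].
  apply/(cvgrPdist_lt (V := (complex R)^o)) => -[e e'].
  rewrite ltcE/= => /andP[/eqP-> e0].
  pose a := A1 * ((1 + c4) * W).
  have a0 : 0 <= a by rewrite !mulr_ge0//; lra.
  (* With this radius a de^be = a e / (a + 1) < e, also when a = 0. *)
  pose de := (e / (a + 1)) `^ be^-1.
  have r0 : 0 < e / (a + 1) by rewrite divr_gt0//; lra.
  have de0 : 0 < de by rewrite powR_gt0.
  have deE : de `^ be = e / (a + 1).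
    by rewrite /de -powRrM mulVf ?gt_eqF// powRr1// ltW.
  have := hd; move/cvgrPdist_lt => /(_ _ de0); apply: filterS => i.
  rewrite sub0r normrN => /(le_lt_trans (ler_norm _)) hi.
  have [z fz hz] := close _ _ _ (L0 i) hi.
  rewrite normC_lt; apply: le_lt_trans
    (near0 f (P (L i)) sf (sP _ (L0 i)) x0 z de de0 _ fz) _.
    by move=> j; have := hz j; lra.
  rewrite deE; apply: (@le_lt_trans _ _ (a * (e / (a + 1)))).
    apply: ler_wpM2r; first exact: ltW.
    by apply: ler_wpM2l (WP _ (L0 i)); exact: ltW.
  rewrite mulrA ltr_pdivrMr; last lra.
  by rewrite mulrC ltr_pM2l//; lra.
rewrite WE -EFinM; apply: Lpnorm_oo_le => [|x xK].
  by rewrite !mulr_ge0 ?powR_ge0//; lra.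
have hz w : box x0 de w -> exists2 z, f z = P n z & forall i, `|w 0 i - z 0 i| <= ga * de.
  move=> wK; have [|z fz hz] := close n w (ga * de) n0.
    apply: le_lt_trans (dist_set_le_mesh (Y0 n n0) wK) _.
    by apply: le_lt_trans hmesh _; rewrite ltr_pM2r//; lra.
  by exists z => // i; exact: ltW.
apply: le_trans (dense f (P n) sf (sP n n0) x0 de de0 hz x xK) _.
rewrite mulrAC -[leRHS]mulrA [X in _ <= _ * X]mulrC mulrA.
have d0 : 0 <= de `^ (s - qdivp q p) := powR_ge0 _ _.
have := WP n n0; set V := W + _ => hV.
have : A2 * de `^ (s - qdivp q p) * V <= A2 * de `^ (s - qdivp q p) * ((1 + c4) * W).
  by apply: ler_wpM2l => //; rewrite mulr_ge0// ltW.
by move=> H; apply: le_trans H _; rewrite le_eqVlt; apply/orP; left; apply/eqP; ring.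
Qed.
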